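(* Let $\omega=1$, $s>0$, $\beta_2\in\mathbb R$. For $\ell\in\mathbb Z_{\ge0}$, a pitchfork bifurcation of the fundamental solitary wave $(e^{it}U_0(x),0)$ with $U_0(x)=\sqrt2\operatorname{sech}x$, in the cubic coupled nonlinear Schrödinger equations with control parameter $\beta_1$, occurs at $$\beta_1=\beta_1^{(\ell)}:=\frac{(\sqrt s+\ell)(\sqrt s+\ell+1)}{2}$$ if $\bar b_2\neq0$. In addition, it is supercritical or subcritical, depending on whether $\bar b_2>0$ or $\bar b_2<0$. Moreover, the bifurcated solitary waves are expressed as $(e^{it}U_\epsilon(x),e^{ist}V_\epsilon(x))$ with $$U_\epsilon(x)=U_0(x)+\epsilon^2U_2(x)+O(\epsilon^4),\qquad V_\epsilon(x)=\pm(\epsilon V_1^{(\ell)}(x)+O(\epsilon^3)),$$ where $\epsilon>0$ is a small parameter such that $\beta_1=\beta_1^{(\ell)}+O(\epsilon^2)$.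
   Context: The cubic coupled nonlinear Schrödinger equations are $$i\partial_tu+\partial_x^2u+(|u|^2+\beta_1|v|^2)u=0,\quad i\partial_tv+\partial_x^2v+(\beta_1|u|^2+\beta_2|v|^2)v=0,$$ with real constants $\beta_1,\beta_2$. A real solution $(U,V)$ of $-U''+U-(U^2+\beta_1V^2)U=0$, $-V''+sV-(\beta_1U^2+\beta_2V^2)V=0$ with $U,V\to0$ as $x\to\pm\infty$ (a homoclinic solution) gives the solitary wave $(e^{it}U(x),e^{ist}V(x))$. Notation. ${}_2F_1$ is the Gauss hypergeometric function. For $\ell'\in\mathbb Z_{\ge0}$, $$V_1^{(\ell)}(x)=\operatorname{sech}^{\sqrt s}x\;{}_2F_1\bigl(-\ell',\sqrt s+\ell'+\tfrac12;\sqrt s+1;\operatorname{sech}^2x\bigr)\ \text{ if }\ell=2\ell',$$ $$V_1^{(\ell)}(x)=\operatorname{sech}^{\sqrt s}x\tanh x\;{}_2F_1\bigl(-\ell',\sqrt s+\ell'+\tfrac32;\sqrt s+1;\operatorname{sech}^2x\bigr)\ \text{ if }\ell=2\ell'+1.$$ $$\phi_{11}(x)=\tfrac12\operatorname{sech}x\,(3-\cosh^2x-3x\tanh x),\qquad\phi_{12}(x)=\operatorname{sech}x\tanh x,$$ $$U_2(x)=-\sqrt2\,\beta_1^{(\ell)}\left[\phi_{11}(x)\int_x^\infty\phi_{12}(y)V_1^{(\ell)}(y)^2\operatorname{sech}y\,dy+\phi_{12}(x)\int_0^x\phi_{11}(y)V_1^{(\ell)}(y)^2\operatorname{sech}y\,dy\right],$$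 $$\bar b_2=8\bigl(\beta_1^{(\ell)}\bigr)^2\int_{-\infty}^\infty\phi_{11}(x)V_1^{(\ell)}(x)^2\operatorname{sech}x\left(\int_x^\infty\phi_{12}(y)V_1^{(\ell)}(y)^2\operatorname{sech}y\,dy\right)dx-\beta_2\int_{-\infty}^\infty V_1^{(\ell)}(x)^4\,dx.$$ Terminology. ''Pitchfork bifurcation at $\beta_1=\beta_1^{(\ell)}$'' means that, besides the branch $(U_0,0)$ existing for all $\beta_1$, a pair of homoclinic solutions with nonzero $V$-components $\pm V$ is born from $(U_0,0)$ at $\beta_1=\beta_1^{(\ell)}$; it is supercritical if the pair exists for $\beta_1>\beta_1^{(\ell)}$ near $\beta_1^{(\ell)}$, and subcritical if it exists for $\beta_1<\beta_1^{(\ell)}$ near $\beta_1^{(\ell)}$. *)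

(* Defs.v *)
From Stdlib Require Import Reals Factorial.
From Coquelicot Require Import Coquelicot.
Open Scope R_scope.

Definition sech (x : R) : R := / cosh x.

(* Rising factorial a (a + 1) ... (a + n - 1). *)
Fixpoint poch (a : R) (n : nat) : R :=
  match n with
  | O => 1
  | S m => poch a m * (a + INR m)
  end.

Definition hyp2F1 (a b c z : R) : R :=
  PSeries (fun n => poch a n * poch b n / (poch c n * INR (fact n))) z.

(* For l odd, Nat.div2 l is the l' with l = 2 l' + 1. *)
Definition V1 (s : R) (l : nat) (x : R) : R :=
  let l' := INR (Nat.div2 l) in
  if Nat.even l then
    Rpower (sech x) (sqrt s)
    * hyp2F1 (- l') (sqrt s + l' + 1 / 2) (sqrt s + 1) (sech x ^ 2)
  else
    Rpower (sech x) (sqrt s) * tanh x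
    * hyp2F1 (- l') (sqrt s + l' + 3 / 2) (sqrt s + 1) (sech x ^ 2).

Definition phi11 (x : R) : R :=
  1 / 2 * sech x * (3 - cosh x ^ 2 - 3 * x * tanh x).

Definition phi12 (x : R) : R := sech x * tanh x.

Definition beta1c (s : R) (l : nat) : R :=
  (sqrt s + INR l) * (sqrt s + INR l + 1) / 2.

Definition U0 (x : R) : R := sqrt 2 * sech x.

Definition tail12 (s : R) (l : nat) (x : R) : R :=
  RInt_gen (fun y => phi12 y * V1 s l y ^ 2 * sech y)
    (at_point x) (Rbar_locally p_infty).

Definition U2 (s : R) (l : nat) (x : R) : R :=
  - sqrt 2 * beta1c s l *
  (phi11 x * tail12 s l x
   + phi12 x * RInt (fun y => phi11 y * V1 s l y ^ 2 * sech y) 0 x).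

Definition b2bar (s beta2 : R) (l : nat) : R :=
  8 * beta1c s l ^ 2
  * RInt_gen (fun x => phi11 x * V1 s l x ^ 2 * sech x * tail12 s l x)
      (Rbar_locally m_infty) (Rbar_locally p_infty)
  - beta2 * RInt_gen (fun x => V1 s l x ^ 4)
      (Rbar_locally m_infty) (Rbar_locally p_infty).

Definition cnls (beta1 beta2 : R) (u v : R -> R -> C) : Prop :=
  exists ut ux uxx vt vx vxx : R -> R -> C,
  forall t x : R,
    is_derive (V := C_R_NormedModule) (fun t' => u t' x) t (ut t x) /\
    is_derive (V := C_R_NormedModule) (u t) x (ux t x) /\
    is_derive (V := C_R_NormedModule) (ux t) x (uxx t x) /\
    is_derive (V := C_R_NormedModule) (fun t' => v t' x) t (vt t x) /\
    is_derive (V := C_R_NormedModule) (v t) x (vx t x) /\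
    is_derive (V := C_R_NormedModule) (vx t) x (vxx t x) /\
    (Ci * ut t x + uxx t x
       + RtoC (Cmod (u t x) ^ 2 + beta1 * Cmod (v t x) ^ 2) * u t x
     = RtoC 0)%C /\
    (Ci * vt t x + vxx t x
       + RtoC (beta1 * Cmod (u t x) ^ 2 + beta2 * Cmod (v t x) ^ 2) * v t x
     = RtoC 0)%C.

(* exp (i w t) f(x), for a real profile f. *)
Definition standing (w : R) (f : R -> R) (t x : R) : C :=
  (cos (w * t) * f x, sin (w * t) * f x).

Definition solitary_wave (s beta1 beta2 : R) (U V : R -> R) : Prop :=
  cnls beta1 beta2 (standing 1 U) (standing s V).

(* Derive is total, so differentiability is required separately. *)
Definition homoclinic (s beta1 beta2 : R) (U V : R -> R) : Prop :=
  (forall x,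
     ex_derive U x /\ ex_derive (Derive U) x /\
     ex_derive V x /\ ex_derive (Derive V) x /\
     - Derive_n U 2 x + U x - (U x ^ 2 + beta1 * V x ^ 2) * U x = 0 /\
     - Derive_n V 2 x + s * V x
       - (beta1 * U x ^ 2 + beta2 * V x ^ 2) * V x = 0) /\
  is_lim U p_infty 0 /\ is_lim U m_infty 0 /\
  is_lim V p_infty 0 /\ is_lim V m_infty 0.

Definition homoclinic_pair (s beta1 beta2 : R) (U V : R -> R) : Prop :=
  homoclinic s beta1 beta2 U V /\
  homoclinic s beta1 beta2 U (fun x => - V x) /\
  exists x, V x <> 0.

(* Distance to (U0, 0) is measured in the supremum norm. *)
Definition near_U0 (eta : R) (U V : R -> R) : Prop :=
  forall x, Rabs (U x - U0 x) <= eta /\ Rabs (V x) <= eta.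

(* The bifurcating pair is the curve e |-> (b e, U e, +/- V e), 0 < e < e0,
   of values of beta1 and profiles; it emanates from (U0, 0) at beta1 = bc. *)
Definition pitchfork (s beta2 bc e0 : R) (b : R -> R) (U V : R -> R -> R)
    : Prop :=
  (forall beta1, homoclinic s beta1 beta2 U0 (fun _ => 0)) /\
  (forall e, 0 < e < e0 -> homoclinic_pair s (b e) beta2 (U e) (V e)) /\
  (forall eta, 0 < eta -> exists d, 0 < d /\
     forall e, 0 < e < e0 -> e < d ->
       Rabs (b e - bc) <= eta /\ near_U0 eta (U e) (V e)).

Definition no_pair_near (s beta1 beta2 eta : R) : Prop :=
  forall U V, near_U0 eta U V -> ~ homoclinic_pair s beta1 beta2 U V.

(* The pair lives on the right of bc only: the curve stays there and covers a
   right neighbourhood of bc, and on the left of bc there is no homoclinic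
   solution near (U0, 0) with nonzero second component. *)
Definition supercritical (s beta2 bc e0 : R) (b : R -> R) : Prop :=
  (forall e, 0 < e < e0 -> bc < b e) /\
  exists d eta, 0 < d /\ 0 < eta /\
    (forall beta1, bc < beta1 < bc + d -> exists e, 0 < e < e0 /\ b e = beta1) /\
    (forall beta1, bc - d < beta1 < bc -> no_pair_near s beta1 beta2 eta).

Definition subcritical (s beta2 bc e0 : R) (b : R -> R) : Prop :=
  (forall e, 0 < e < e0 -> b e < bc) /\
  exists d eta, 0 < d /\ 0 < eta /\
    (forall beta1, bc - d < beta1 < bc -> exists e, 0 < e < e0 /\ b e = beta1) /\
    (forall beta1, bc < beta1 < bc + d -> no_pair_near s beta1 beta2 eta).

(* Main.v *)
Require Import Defs.
From Stdlib Require Import Reals Lra Lia Factorial IndefiniteDescription.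
From Coquelicot Require Import Coquelicot.
Open Scope R_scope.

(* Write U = U0 + t u and V = e (V1 + t w) with t = e^2 and beta1 = bc + t b.  Both
   linearizations are Poeschl-Teller operators with a decaying solution p and a
   growing solution q, so variation of constants inverts them on the half line up to
   the solvability condition int p g = 0.  For the first component the condition holds
   by parity; for the second one it determines b.  The resulting equation X = Phi t X
   for X = (u, w, b) has Phi 0 constant, with value (U2, b2bar / (2 J), _) where
   J = int_0^oo U0^2 V1^2, and is a contraction for small t; its fixed point is
   Lipschitz in t, which gives the expansions, the sign of beta1 - bc and, by the
   intermediate value theorem, all nearby values of beta1 on one side.

   Conversely, let (U, V) be a solution near (U0, 0), translated so that U'(0) = 0, with
   delta = beta1 - bc and a the amplitude of V along V1.  The same inverses give
   U = U0 + a^2 (U2 + O(h)) and V = a (V1 + O(h)) with h = |delta| + a^2.  Without any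
   parity the solvability integral over the half line equals a boundary term at 0, which
   changes sign when (U, V) is reflected; adding both half lines yields
   delta J - a^2 b2bar / 2 = O(h^2), impossible for small h on the wrong side. *)

(** * Improper integrals on the half line *)

(** All estimates are made on x >= 0, where decaying and growing solutions are separated by
    exponentials. The other half line follows from parity for the branch and from the reflection of
    an arbitrary solution. The branch lives in the weight exp(-k|x|) with k below both decay rates 1
    and sqrt s, because variation of constants reproduces the decay of its source only at rates
    below that of [p]. The converse takes k = 0, that is, plain supremum bounds. Translation
    invariance makes the first linearization singular: [phi12] is a multiple of the derivative of
    [U0]. Evenness removes this kernel for the branch, and the normalization U'(0) = 0 does so for
    an arbitrary solution. The kernel function [V1] is given by a hypergeometric polynomial, which
    shows neither its decay constants nor a growing partner. Both are built by a ladder starting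
    from sech^mu with mu = sqrt s, and the result is identified with [V1] because the bounded
    solutions form a line. With t = e^2 the rescaled equations are polynomial in t, so one
    bookkeeping of polynomial Lipschitz bounds serves every nonlinear term. *)

Definition cts (f : R -> R) : Prop := forall x, continuous f x.

Lemma cts_ext (f g : R -> R) : (forall x, f x = g x) -> cts f -> cts g.
Proof. intros H F x. apply continuous_ext with (1 := H). apply F. Qed.

Lemma cts_const (c : R) : cts (fun _ => c).
Proof. intros x. apply continuous_const. Qed.

Lemma cts_plus (f g : R -> R) : cts f -> cts g -> cts (fun x => f x + g x).
Proof. intros F G x. apply (continuous_plus f g); auto. Qed.

Lemma cts_opp (f : R -> R) : cts f -> cts (fun x => - f x).
Proof. intros F x. apply (continuous_opp f); auto. Qed.

Lemma cts_minus (f g : R -> R) : cts f -> cts g -> cts (fun x => f x - g x).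
Proof. intros F G x. apply (continuous_minus f g); auto. Qed.

Lemma cts_mult (f g : R -> R) : cts f -> cts g -> cts (fun x => f x * g x).
Proof. intros F G x. apply (continuous_mult f g); auto. Qed.

Lemma cts_pow (f : R -> R) (n : nat) : cts f -> cts (fun x => f x ^ n).
Proof.
  intros F; induction n as [|n IH]; simpl; [apply cts_const|].
  apply cts_mult; auto.
Qed.

Lemma cts_derive (f f' : R -> R) : (forall x, is_derive f x (f' x)) -> cts f.
Proof. intros H x. apply @ex_derive_continuous. exists (f' x). apply H. Qed.

Lemma cts_ex_RInt (f : R -> R) (a b : R) : cts f -> ex_RInt f a b.
Proof. intros F. apply @ex_RInt_continuous. auto. Qed.

Ltac cts_tac :=
  lazymatch goal with
  | |- cts (fun x => @?f x + @?g x) => apply (cts_plus f g); cts_tac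
  | |- cts (fun x => @?f x - @?g x) => apply (cts_minus f g); cts_tac
  | |- cts (fun x => @?f x * @?g x) => apply (cts_mult f g); cts_tac
  | |- cts (fun x => (@?f x) ^ ?n) => apply (cts_pow f n); cts_tac
  | |- cts (fun x => - @?f x) => apply (cts_opp f); cts_tac
  | |- cts (fun _ => ?c) => apply (cts_const c)
  | |- cts (fun x => ?f x) => change (cts f); try eassumption
  | |- _ => try eassumption
  end.

(** [auto_derive] leaves subterms [Derive (fun y => f y) x]; they are eta-reduced and replaced by
    the derivative that [D] provides. *)
Ltac dsub D :=
  lazymatch type of D with
  | is_derive ?f ?x ?l =>
      change (Derive (fun y => f y) x) with (Derive f x);
      rewrite ?(is_derive_unique f x l D)
  end.

(** Extensionality lemmas produce equations in the carrier of a normed module, which [ring] does not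
    recognize as [R]. *)
Ltac toR := match goal with |- @eq _ ?a ?b => change (@eq R a b) end.

Ltac dside :=
  repeat split; first [ eexists; eassumption | lra | apply Rgt_not_eq; assumption | exact I | idtac ].

Lemma is_derive_prim (f : R -> R) (a x : R) :
  cts f -> is_derive (RInt f a) x (f x).
Proof.
  intros F. apply (is_derive_RInt f (RInt f a) a x); [|apply F].
  exists (mkposreal 1 Rlt_0_1). intros y _.
  apply @RInt_correct, cts_ex_RInt, F.
Qed.

Lemma cts_prim (f : R -> R) (a : R) : cts f -> cts (RInt f a).
Proof. intros F. apply cts_derive with f. intros; now apply is_derive_prim. Qed.

Lemma RInt_00 (f : R -> R) : RInt f 0 0 = 0.
Proof. exact (RInt_point 0 f). Qed.

Lemma RInt_split (f : R -> R) (a b c : R) :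
  cts f -> RInt f a b + RInt f b c = RInt f a c.
Proof. intros F. apply (RInt_Chasles f); now apply cts_ex_RInt. Qed.

Lemma monotone_of_derive (f f' : R -> R) (a b : R) :
  a <= b -> (forall x, a <= x <= b -> is_derive f x (f' x)) ->
  (forall x, a <= x <= b -> 0 <= f' x) -> f a <= f b.
Proof.
  intros Hab D P.
  destruct (MVT_gen f a b f') as [c [Hc E]].
  - intros x. rewrite Rmin_left, Rmax_right by lra. intros; apply D; lra.
  - intros x. rewrite Rmin_left, Rmax_right by lra. intros Hx.
    apply continuity_pt_filterlim. apply @ex_derive_continuous.
    exists (f' x); apply D; lra.
  - rewrite Rmin_left, Rmax_right in Hc by lra.
    specialize (P c Hc). nra.
Qed.

(** Both G - int f and G + int f have nonnegative derivative. Stating the bound with an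
    antiderivative [G] of the majorant spares integrating [g]. *)
Lemma RInt_abs_le (f g G : R -> R) (a b : R) :
  a <= b -> cts f -> (forall x, a <= x <= b -> is_derive G x (g x)) ->
  (forall x, a <= x <= b -> Rabs (f x) <= g x) ->
  Rabs (RInt f a b) <= G b - G a.
Proof.
  intros Hab F DG B.
  assert (H1 : G a - RInt f a a <= G b - RInt f a b).
  { apply (monotone_of_derive (fun x => G x - RInt f a x) (fun x => g x - f x)); auto.
    - intros x Hx. apply @is_derive_minus; [now apply DG|now apply is_derive_prim].
    - intros x Hx. specialize (B x Hx). apply Rabs_le_between in B. lra. }
  assert (H2 : G a + RInt f a a <= G b + RInt f a b).
  { apply (monotone_of_derive (fun x => G x + RInt f a x) (fun x => g x + f x)); auto.
    - intros x Hx. apply @is_derive_plus; [now apply DG|now apply is_derive_prim].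
    - intros x Hx. specialize (B x Hx). apply Rabs_le_between in B. lra. }
  assert (E : RInt f a a = 0) by exact (RInt_point a f).
  rewrite E in H1, H2. apply Rabs_le. lra.
Qed.

Lemma is_derive_exp_lin (c k x : R) :
  is_derive (fun y => c * exp (k * y)) x (c * k * exp (k * x)).
Proof. auto_derive; [easy|ring]. Qed.

Lemma exp_lin_lim (c k : R) : 0 < k ->
  is_lim (fun x => c * exp (- k * x)) p_infty 0.
Proof.
  intros Hk.
  assert (H : is_lim (fun x => exp (- k * x)) p_infty 0).
  { apply is_lim_comp with m_infty.
    - apply is_lim_exp_m.
    - apply (is_lim_ext (fun x => (-k) * x)); [easy|].
      replace m_infty with (Rbar_mult (- k) p_infty).
      + apply is_lim_scal_l. apply is_lim_id.
      + simpl. destruct Rle_dec as [h|h]; [exfalso; lra|reflexivity].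
    - exists 0. intros; discriminate. }
  replace (Finite 0) with (Rbar_mult c (Finite 0)) by (simpl; f_equal; ring).
  now apply is_lim_scal_l.
Qed.

Lemma is_lim_infty_iff (f : R -> R) (l : R) :
  is_lim f p_infty l <->
  forall e, 0 < e -> exists M, forall x, M < x -> Rabs (f x - l) < e.
Proof.
  rewrite <- is_lim_spec. split.
  - intros H e He. destruct (H (mkposreal e He)) as [M HM]. now exists M.
  - intros H [e He]. destruct (H e He) as [M HM]. now exists M.
Qed.

Lemma is_lim_infty_bound (f g : R -> R) (A : R) :
  (forall x, A <= x -> Rabs (f x) <= g x) -> is_lim g p_infty 0 ->
  is_lim f p_infty 0.
Proof.
  intros B G. apply is_lim_infty_iff. intros e He.
  destruct (proj1 (is_lim_infty_iff _ _) G e He) as [M HM].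
  exists (Rmax M A). intros x Hx.
  assert (M < x) by (apply Rle_lt_trans with (2 := Hx); apply Rmax_l).
  assert (A < x) by (apply Rle_lt_trans with (2 := Hx); apply Rmax_r).
  specialize (HM x H). specialize (B x ltac:(lra)).
  rewrite Rminus_0_r in *. apply Rabs_def2 in HM. lra.
Qed.

Lemma is_lim_infty_le (f : R -> R) (l c A : R) :
  is_lim f p_infty l -> (forall x, A <= x -> f x <= c) -> l <= c.
Proof.
  intros F B. apply Rnot_lt_le; intros Hl.
  destruct (proj1 (is_lim_infty_iff _ _) F (l - c) ltac:(lra)) as [M HM].
  pose (x := Rmax M A + 1).
  assert (M < x) by (unfold x; pose proof (Rmax_l M A); lra).
  assert (A < x) by (unfold x; pose proof (Rmax_r M A); lra).
  specialize (HM x H). specialize (B x ltac:(lra)). apply Rabs_def2 in HM. lra.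
Qed.

(** Total in [f]: a divergent integral receives a default value. The predicate [conv] records that
    the value is the true finite limit. *)
Definition I0 (f : R -> R) : R := real (Lim (RInt f 0) p_infty).

Definition conv (f : R -> R) : Prop :=
  cts f /\ is_lim (RInt f 0) p_infty (I0 f).

Lemma conv_of_lim (f : R -> R) (l : R) :
  cts f -> is_lim (RInt f 0) p_infty l -> conv f /\ I0 f = l.
Proof.
  intros F H. assert (E : I0 f = l) by (unfold I0; now rewrite (is_lim_unique _ _ _ H)).
  split; [split; [easy|now rewrite E]|easy].
Qed.

Lemma conv_FTC (f F : R -> R) (l : R) :
  cts f -> (forall x, is_derive F x (f x)) -> is_lim F p_infty l ->
  conv f /\ I0 f = l - F 0.
Proof.
  intros Cf D L. apply conv_of_lim; [easy|].
  apply (is_lim_ext (fun x => F x - F 0)).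
  - intros x. symmetry. apply is_RInt_unique.
    apply (is_RInt_derive F f); intros; [apply D|apply Cf].
  - apply is_lim_minus'; [easy|apply is_lim_const].
Qed.

Lemma I0_ext (f g : R -> R) : (forall x, f x = g x) -> I0 f = I0 g.
Proof.
  intros H. unfold I0. f_equal. apply Lim_ext. intros x.
  apply RInt_ext; intros; first [apply H | symmetry; apply H].
Qed.

Lemma conv_ext (f g : R -> R) : (forall x, f x = g x) -> conv f -> conv g.
Proof.
  intros H [C L]. split; [now apply cts_ext with f|].
  rewrite <- (I0_ext f g H). apply (is_lim_ext (RInt f 0)); [|easy].
  intros x; apply RInt_ext; intros; apply H.
Qed.

Lemma conv_lin (a b : R) (f g : R -> R) : conv f -> conv g ->
  conv (fun x => a * f x + b * g x) /\
  I0 (fun x => a * f x + b * g x) = a * I0 f + b * I0 g.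
Proof.
  intros [Cf Lf] [Cg Lg]. apply conv_of_lim; [cts_tac|].
  apply (is_lim_ext (fun x => a * RInt f 0 x + b * RInt g 0 x)).
  - intros x. symmetry. apply is_RInt_unique.
    apply @is_RInt_plus; apply @is_RInt_scal; apply @RInt_correct; now apply cts_ex_RInt.
  - apply is_lim_plus'.
    + apply (is_lim_scal_l (RInt f 0) a p_infty (I0 f)); easy.
    + apply (is_lim_scal_l (RInt g 0) b p_infty (I0 g)); easy.
Qed.

Lemma I0_minus (f g : R -> R) : conv f -> conv g ->
  I0 f - I0 g = I0 (fun x => f x - g x).
Proof.
  intros F G. replace (I0 f - I0 g) with (1 * I0 f + (-1) * I0 g) by ring.
  rewrite <- (proj2 (conv_lin 1 (-1) f g F G)). apply I0_ext; intros; ring.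
Qed.

Lemma I0_scal (a : R) (f : R -> R) : conv f -> I0 (fun x => a * f x) = a * I0 f.
Proof.
  intros F. replace (a * I0 f) with (a * I0 f + 0 * I0 f) by ring.
  rewrite <- (proj2 (conv_lin a 0 f f F F)). apply I0_ext; intros; ring.
Qed.

Lemma RInt_exp_bound (f : R -> R) (K k a b : R) :
  0 < k -> a <= b -> cts f ->
  (forall x, a <= x <= b -> Rabs (f x) <= K * exp (- k * x)) ->
  Rabs (RInt f a b) <= K / k * exp (- k * a) - K / k * exp (- k * b).
Proof.
  intros Hk Hab F B.
  assert (H := RInt_abs_le f (fun x => K * exp (- k * x))
    (fun x => (- K / k) * exp (- k * x)) a b Hab F).
  simpl in H. replace (K / k * exp (- k * a) - K / k * exp (- k * b))
    with (- K / k * exp (- k * b) - - K / k * exp (- k * a)) by (field; lra).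
  apply H; [|easy]. intros x _.
  replace (K * exp (- k * x)) with ((- K / k) * - k * exp (- k * x)) by (field; lra).
  apply is_derive_exp_lin.
Qed.

(** The exponential bound makes the primitive Cauchy at infinity, and the same bound on int_x^y
    passes to the limit y -> oo as the tail estimate. *)
Lemma conv_exp (f : R -> R) (K k : R) :
  0 < k -> cts f -> (forall x, 0 <= x -> Rabs (f x) <= K * exp (- k * x)) ->
  conv f /\ forall x, 0 <= x -> Rabs (I0 f - RInt f 0 x) <= K / k * exp (- k * x).
Proof.
  intros Hk F B.
  assert (K0 : 0 <= K).
  { specialize (B 0 ltac:(lra)). rewrite Rmult_0_r, exp_0 in B.
    pose proof (Rabs_pos (f 0)). lra. }
  assert (Kk : 0 <= K / k) by (apply Rdiv_le_0_compat; lra).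
  assert (D : forall x y, 0 <= x -> x <= y ->
    Rabs (RInt f 0 y - RInt f 0 x) <= K / k * exp (- k * x)).
  { intros x y Hx Hy. assert (E := RInt_split f 0 x y F).
    assert (E' : RInt f 0 y - RInt f 0 x = RInt f x y) by lra. rewrite E'.
    eapply Rle_trans; [apply (RInt_exp_bound f K k x y); auto; intros; apply B; lra|].
    assert (0 <= K / k * exp (- k * y)) by (apply Rmult_le_pos; [easy|left; apply exp_pos]).
    lra. }
  assert (L : exists l : R, is_lim (RInt f 0) p_infty l).
  { destruct (proj1 (@filterlim_locally_cauchy _ R_CompleteSpace (Rbar_locally' p_infty) _ (RInt f 0)))
      as [l Hl]; [|now exists l].
    intros [e He]. simpl.
    destruct (proj1 (is_lim_infty_iff _ _) (exp_lin_lim (K / k) k Hk) (e / 2) ltac:(lra)) as [M HM].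
    exists (fun x => Rmax M 0 < x). split; [now exists (Rmax M 0)|].
    assert (W : forall u v, Rmax M 0 < u -> u <= v -> Rabs (RInt f 0 v - RInt f 0 u) < e).
    { intros u v Hu Hv. pose proof (Rmax_l M 0). pose proof (Rmax_r M 0).
      eapply Rle_lt_trans; [apply D; lra|]. specialize (HM u ltac:(lra)).
      apply Rabs_def2 in HM. lra. }
    intros u v Hu Hv. destruct (Rle_dec u v).
    - apply W; auto.
    - change (Rabs (RInt f 0 v - RInt f 0 u) < e).
      rewrite Rabs_minus_sym. apply W; auto; lra. }
  destruct L as [l L]. destruct (conv_of_lim f l F L) as [C E].
  split; [easy|]. rewrite E. intros x Hx.
  apply Rabs_le. split.
  - assert (- l <= K / k * exp (- k * x) - RInt f 0 x); [|lra].
    apply is_lim_infty_le with (fun y => - RInt f 0 y) x.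
    + apply (is_lim_opp (RInt f 0) p_infty l L).
    + intros y Hy. specialize (D x y Hx Hy). apply Rabs_le_between in D. lra.
  - assert (l <= K / k * exp (- k * x) + RInt f 0 x); [|lra].
    apply is_lim_infty_le with (RInt f 0) x; [easy|].
    intros y Hy. specialize (D x y Hx Hy). apply Rabs_le_between in D. lra.
Qed.

Lemma I0_bound (f : R -> R) (K k : R) :
  0 < k -> cts f -> (forall x, 0 <= x -> Rabs (f x) <= K * exp (- k * x)) ->
  Rabs (I0 f) <= K / k.
Proof.
  intros Hk F B. destruct (conv_exp f K k Hk F B) as [_ H].
  specialize (H 0 ltac:(lra)).
  rewrite RInt_00, Rmult_0_r, exp_0, Rminus_0_r, Rmult_1_r in H. easy.
Qed.

(** A real sign instead of two predicates lets the even and the odd values of [l] be treated at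
    once, with sign (-1)^l. *)
Definition parity (sg : R) (f : R -> R) : Prop := forall x, f (- x) = sg * f x.

Lemma RInt_parity (sg : R) (f : R -> R) (x : R) :
  cts f -> parity sg f -> RInt f 0 (- x) = - sg * RInt f 0 x.
Proof.
  intros F P.
  assert (H := RInt_comp_lin f (-1) 0 0 x).
  replace (-1 * 0 + 0) with 0 in H by ring.
  replace (-1 * x + 0) with (- x) in H by ring.
  rewrite <- H by now apply cts_ex_RInt.
  rewrite (RInt_ext _ (fun y => scal (- sg) (f y))).
  - apply (RInt_scal f). now apply cts_ex_RInt.
  - intros y _. replace (-1 * y + 0) with (- y) by ring. rewrite P.
    unfold scal; simpl; unfold mult; simpl. ring.
Qed.

Lemma is_RInt_gen_p (f : R -> R) (a : R) :
  conv f -> is_RInt_gen f (at_point a) (Rbar_locally p_infty) (I0 f - RInt f 0 a).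
Proof.
  intros [F L] P HP.
  assert (L' : is_lim (RInt f a) p_infty (I0 f - RInt f 0 a)).
  { apply (is_lim_ext (fun x => RInt f 0 x - RInt f 0 a)).
    - intros x. rewrite <- (RInt_split f 0 a x F). ring.
    - apply is_lim_minus'; [easy|apply is_lim_const]. }
  specialize (L' P HP). destruct L' as [M HM].
  exists (fun x => x = a) (fun y => M < y).
  - reflexivity.
  - now exists M.
  - intros x y -> Hy. exists (RInt f a y). split; [|now apply HM].
    simpl. apply @RInt_correct. now apply cts_ex_RInt.
Qed.

Lemma RInt_gen_p (f : R -> R) (a : R) :
  conv f -> RInt_gen f (at_point a) (Rbar_locally p_infty) = I0 f - RInt f 0 a.
Proof. intros C. apply @is_RInt_gen_unique; try apply _. now apply is_RInt_gen_p. Qed.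

Lemma RInt_gen_even (f : R -> R) :
  conv f -> parity 1 f ->
  RInt_gen f (Rbar_locally m_infty) (Rbar_locally p_infty) = 2 * I0 f.
Proof.
  intros C P. apply @is_RInt_gen_unique; try apply _.
  destruct C as [F L].
  replace (2 * I0 f) with (I0 f + I0 f) by ring.
  apply (@is_RInt_gen_Chasles R_NormedModule _ _ _ _ f 0 (I0 f) (I0 f)).
  - intros Q HQ. specialize (L Q HQ). destruct L as [M HM].
    exists (fun x => x < - M) (fun y => y = 0).
    + now exists (- M).
    + reflexivity.
    + intros x y Hx ->. exists (RInt f x 0). split.
      * simpl. apply @RInt_correct. now apply cts_ex_RInt.
      * replace (RInt f x 0) with (RInt f 0 (- x)); [apply HM; lra|].
        rewrite (RInt_parity 1) by easy.
        assert (H := RInt_split f 0 x 0 F). rewrite RInt_00 in H. lra.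
  - replace (I0 f) with (I0 f - RInt f 0 0) by (rewrite RInt_00; ring).
    apply is_RInt_gen_p. now split.
Qed.

(** * Variation of constants *)

Lemma is_derive_eq (f : R -> R) (x l l' : R) : is_derive f x l -> l = l' -> is_derive f x l'.
Proof. now intros H <-. Qed.

(** A fundamental system of y'' = Q y with Wronskian [w]: [p] decays and [q] grows at most at rate
    [mu] on the half line. The bound on [p'] serves to make boundary terms vanish at infinity. *)
Record fsys (Q p p' q q' : R -> R) (mu C w : R) : Prop := {
  fs_mu : 0 < mu;
  fs_C : 0 <= C;
  fs_w : w <> 0;
  fs_Q : cts Q;
  fs_p : forall x, is_derive p x (p' x);
  fs_p' : forall x, is_derive p' x (Q x * p x);
  fs_q : forall x, is_derive q x (q' x);
  fs_q' : forall x, is_derive q' x (Q x * q x);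
  fs_W : forall x, p x * q' x - p' x * q x = w;
  fs_pb : forall x, 0 <= x -> Rabs (p x) <= C * exp (- mu * x);
  fs_pb' : forall x, 0 <= x -> Rabs (p' x) <= C * exp (- mu * x);
  fs_qb : forall x, 0 <= x -> Rabs (q x) <= C * exp (mu * x)
}.
Arguments fs_mu {Q p p' q q' mu C w}.
Arguments fs_C {Q p p' q q' mu C w}.
Arguments fs_w {Q p p' q q' mu C w}.
Arguments fs_Q {Q p p' q q' mu C w}.
Arguments fs_p {Q p p' q q' mu C w}.
Arguments fs_p' {Q p p' q q' mu C w}.
Arguments fs_q {Q p p' q q' mu C w}.
Arguments fs_q' {Q p p' q q' mu C w}.
Arguments fs_W {Q p p' q q' mu C w}.
Arguments fs_pb {Q p p' q q' mu C w}.
Arguments fs_pb' {Q p p' q q' mu C w}.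
Arguments fs_qb {Q p p' q q' mu C w}.

(* The solution of [y'' = Q y - g] that is bounded on the half line. *)
Definition green (p q : R -> R) (w : R) (g : R -> R) (x : R) : R :=
  (p x * RInt (fun y => q y * g y) 0 x
   + q x * (I0 (fun y => p y * g y) - RInt (fun y => p y * g y) 0 x)) / w.

Lemma green_ext (p q : R -> R) (w : R) (g h : R -> R) (x : R) :
  (forall y, g y = h y) -> green p q w g x = green p q w h x.
Proof.
  intros H. unfold green.
  rewrite (I0_ext (fun y => p y * g y) (fun y => p y * h y)) by (intros; now rewrite H).
  rewrite (RInt_ext (fun y => p y * g y) (fun y => p y * h y)) by (intros; now rewrite H).
  rewrite (RInt_ext (fun y => q y * g y) (fun y => q y * h y)) by (intros; now rewrite H).
  reflexivity.
Qed.

Lemma RInt_minus_cts (f g : R -> R) (a b : R) : cts f -> cts g ->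
  RInt (fun x => f x - g x) a b = RInt f a b - RInt g a b.
Proof. intros F G. apply (RInt_minus f g); now apply cts_ex_RInt. Qed.

Section FundamentalSystem.
Variables (Q p p' q q' : R -> R) (mu C w : R).
Hypothesis S : fsys Q p p' q q' mu C w.

Let cp : cts p := cts_derive _ _ (fs_p S).
Let cq : cts q := cts_derive _ _ (fs_q S).
Let mu0 : 0 < mu := fs_mu S.
Let C0 : 0 <= C := fs_C S.
Let w0 : w <> 0 := fs_w S.

Lemma pg_bound (g : R -> R) (K k : R) :
  (forall x, 0 <= x -> Rabs (g x) <= K * exp (- k * x)) ->
  forall x, 0 <= x -> Rabs (p x * g x) <= C * K * exp (- (mu + k) * x).
Proof.
  intros B x Hx. rewrite Rabs_mult.
  replace (C * K * exp (- (mu + k) * x))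
    with ((C * exp (- mu * x)) * (K * exp (- k * x))).
  - apply Rmult_le_compat; auto using Rabs_pos. now apply (fs_pb S).
  - replace (- (mu + k) * x) with (- mu * x + - k * x) by ring. rewrite exp_plus. ring.
Qed.

Lemma conv_pg (g : R -> R) (K k : R) : cts g -> 0 <= k ->
  (forall x, 0 <= x -> Rabs (g x) <= K * exp (- k * x)) -> conv (fun x => p x * g x).
Proof.
  intros G Hk B. refine (proj1 (conv_exp _ (C * K) (mu + k) _ _ (pg_bound g K k B))).
  - lra.
  - cts_tac.
Qed.

Lemma I0_pg_bound (g : R -> R) (K k : R) : cts g -> 0 <= k ->
  (forall x, 0 <= x -> Rabs (g x) <= K * exp (- k * x)) ->
  Rabs (I0 (fun x => p x * g x)) <= C / mu * K.
Proof.
  intros G Hk B.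
  assert (K0 : 0 <= K).
  { specialize (B 0 ltac:(lra)). rewrite Rmult_0_r, exp_0 in B.
    pose proof (Rabs_pos (g 0)). lra. }
  replace (C / mu * K) with (C * K / mu) by (field; lra).
  apply I0_bound; [easy|cts_tac|].
  intros x Hx. eapply Rle_trans; [apply (pg_bound g K k B x Hx)|].
  apply Rmult_le_compat_l; [now apply Rmult_le_pos|].
  destruct (Req_dec (k * x) 0) as [E|E].
  - right; f_equal. lra.
  - left. apply exp_increasing. assert (0 <= k * x) by (apply Rmult_le_pos; lra). lra.
Qed.

(** The two summands come from int_0^x exp((mu - k) y) dy and int_x^oo exp(-(mu + k) y) dy; the
    first one forces k < mu. *)
Definition green_const (k : R) : R :=
  (C * C / (mu - k) + C * C / (mu + k)) / Rabs w.

Lemma green_const_pos (k : R) : 0 <= k < mu -> 0 <= green_const k.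
Proof.
  intros Hk. unfold green_const. apply Rdiv_le_0_compat; [|now apply Rabs_pos_lt].
  assert (0 <= C * C) by now apply Rmult_le_pos.
  apply Rplus_le_le_0_compat; apply Rdiv_le_0_compat; lra.
Qed.

(** The products exp(-mu x) exp((mu - k) x) and exp(mu x) exp(-(mu + k) x) both equal exp(-k x), so
    the solution decays at the rate of its source. *)
Lemma green_bound (g : R -> R) (K k : R) : cts g -> 0 <= k < mu ->
  (forall x, 0 <= x -> Rabs (g x) <= K * exp (- k * x)) ->
  forall x, 0 <= x -> Rabs (green p q w g x) <= green_const k * K * exp (- k * x).
Proof.
  intros G Hk B x Hx.
  assert (K0 : 0 <= K).
  { specialize (B 0 ltac:(lra)). rewrite Rmult_0_r, exp_0 in B.
    pose proof (Rabs_pos (g 0)). lra. }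
  assert (CK : 0 <= C * K) by now apply Rmult_le_pos.
  assert (H1 : Rabs (RInt (fun y => q y * g y) 0 x)
               <= C * K / (mu - k) * exp ((mu - k) * x)).
  { assert (H := RInt_abs_le (fun y => q y * g y)
      (fun y => C * K * exp ((mu - k) * y))
      (fun y => C * K / (mu - k) * exp ((mu - k) * y)) 0 x Hx).
    eapply Rle_trans; [apply H|].
    - cts_tac.
    - intros y _. replace (C * K * exp ((mu - k) * y))
        with (C * K / (mu - k) * (mu - k) * exp ((mu - k) * y)) by (field; lra).
      apply is_derive_exp_lin.
    - intros y Hy. rewrite Rabs_mult.
      replace (C * K * exp ((mu - k) * y))
        with ((C * exp (mu * y)) * (K * exp (- k * y))).
      + apply Rmult_le_compat; auto using Rabs_pos.
        * apply (fs_qb S); lra.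
        * apply B; lra.
      + replace ((mu - k) * y) with (mu * y + - k * y) by ring. rewrite exp_plus. ring.
    - assert (0 <= C * K / (mu - k) * exp ((mu - k) * 0)); [|lra].
      apply Rmult_le_pos; [apply Rdiv_le_0_compat; lra|left; apply exp_pos]. }
  assert (H2 : Rabs (I0 (fun y => p y * g y) - RInt (fun y => p y * g y) 0 x)
               <= C * K / (mu + k) * exp (- (mu + k) * x)).
  { apply conv_exp; [lra|cts_tac| |easy]. now apply pg_bound. }
  assert (H3 := fs_pb S x Hx).
  assert (H4 := fs_qb S x Hx).
  unfold green, green_const. unfold Rdiv at 1. rewrite Rabs_mult, Rabs_inv.
  replace ((C * C / (mu - k) + C * C / (mu + k)) / Rabs w * K * exp (- k * x))
    with ((C * exp (- mu * x) * (C * K / (mu - k) * exp ((mu - k) * x))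
          + C * exp (mu * x) * (C * K / (mu + k) * exp (- (mu + k) * x))) * / Rabs w).
  - apply Rmult_le_compat_r.
    + left. apply Rinv_0_lt_compat. now apply Rabs_pos_lt.
    + eapply Rle_trans; [apply Rabs_triang|]. rewrite !Rabs_mult.
      apply Rplus_le_compat; apply Rmult_le_compat; auto using Rabs_pos.
  - replace ((mu - k) * x) with (mu * x + - k * x) by ring.
    replace (- (mu + k) * x) with (- mu * x + - k * x) by ring. rewrite !exp_plus.
    replace (- mu * x) with (- (mu * x)) by ring. rewrite exp_Ropp.
    assert (exp (mu * x) <> 0) by (apply Rgt_not_eq, exp_pos).
    assert (Rabs w <> 0) by now apply Rabs_no_R0. field. repeat split; lra.
Qed.

Lemma green_minus (g h : R -> R) (K k K' : R) : cts g -> cts h -> 0 <= k ->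
  (forall x, 0 <= x -> Rabs (g x) <= K * exp (- k * x)) ->
  (forall x, 0 <= x -> Rabs (h x) <= K' * exp (- k * x)) ->
  forall x, green p q w g x - green p q w h x = green p q w (fun y => g y - h y) x.
Proof.
  intros G H Hk BG BH x. unfold green.
  assert (E1 : I0 (fun y => p y * (g y - h y))
               = I0 (fun y => p y * g y) - I0 (fun y => p y * h y)).
  { rewrite I0_minus by (eapply conv_pg; eauto). apply I0_ext. intros; ring. }
  assert (E2 : forall r, cts r -> RInt (fun y => r y * (g y - h y)) 0 x
     = RInt (fun y => r y * g y) 0 x - RInt (fun y => r y * h y) 0 x).
  { intros r Cr. rewrite <- RInt_minus_cts by cts_tac.
    apply RInt_ext; intros; simpl; ring. }
  rewrite E1, (E2 p cp), (E2 q cq). field. exact w0.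
Qed.

Definition green' (g : R -> R) (x : R) : R :=
  (p' x * RInt (fun y => q y * g y) 0 x
   + q' x * (I0 (fun y => p y * g y) - RInt (fun y => p y * g y) 0 x)) / w.

Lemma is_derive_green (g : R -> R) (x : R) : cts g ->
  is_derive (green p q w g) x (green' g x).
Proof.
  intros G. unfold green.
  assert (D1 := is_derive_prim (fun y => q y * g y) 0 x ltac:(cts_tac)).
  assert (D2 := is_derive_prim (fun y => p y * g y) 0 x ltac:(cts_tac)).
  assert (D3 := fs_p S x). assert (D4 := fs_q S x).
  set (F1 := RInt (fun y => q y * g y) 0 : R -> R) in *.
  set (F2 := RInt (fun y => p y * g y) 0 : R -> R) in *.
  auto_derive.
  - repeat split; eexists; eassumption.
  - dsub D1; dsub D2; dsub D3; dsub D4.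
    unfold green'. fold F1 F2. field. exact w0.
Qed.

Lemma is_derive_green' (g : R -> R) (x : R) : cts g ->
  is_derive (green' g) x (Q x * green p q w g x - g x).
Proof.
  intros G. unfold green'.
  assert (D1 := is_derive_prim (fun y => q y * g y) 0 x ltac:(cts_tac)).
  assert (D2 := is_derive_prim (fun y => p y * g y) 0 x ltac:(cts_tac)).
  assert (D3 := fs_p' S x). assert (D4 := fs_q' S x).
  assert (W := fs_W S x).
  set (F1 := RInt (fun y => q y * g y) 0 : R -> R) in *.
  set (F2 := RInt (fun y => p y * g y) 0 : R -> R) in *.
  auto_derive.
  - repeat split; eexists; eassumption.
  - dsub D1; dsub D2; dsub D3; dsub D4.
    unfold green. fold F1 F2.
    (* Differentiating the two integrals produces the Wronskian as coefficient of [g x]; writing 1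
       as Wronskian over [w] makes the goal a field identity. *)
    replace (g x) with (g x * (p x * q' x - p' x * q x) / w) at 3 by (rewrite W; field; exact w0).
    field. exact w0.
Qed.

Lemma cts_green (g : R -> R) : cts g -> cts (green p q w g).
Proof. intros G. apply cts_derive with (green' g). intros; now apply is_derive_green. Qed.

Lemma parity_mult (a b : R) (f g : R -> R) :
  parity a f -> parity b g -> parity (a * b) (fun x => f x * g x).
Proof. intros F G x. rewrite F, G. ring. Qed.

(** The only term whose parity may be wrong is [q] times the constant [I0 (p g)]. It has the parity
    -sg of [q], which is harmless if tau = -sg; if tau = sg the constant must vanish, and this is
    the solvability condition. *)
Lemma green_parity (sg tau : R) (g : R -> R) : cts g -> sg * sg = 1 ->
  parity sg p -> parity (- sg) q -> parity tau g ->
  tau = - sg \/ tau = sg /\ I0 (fun y => p y * g y) = 0 ->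
  parity tau (green p q w g).
Proof.
  intros G Hs Pp Pq Pg Ht x. unfold green.
  rewrite (RInt_parity (- sg * tau) (fun y => q y * g y)); [|cts_tac|now apply parity_mult].
  rewrite (RInt_parity (sg * tau) (fun y => p y * g y)); [|cts_tac|now apply parity_mult].
  rewrite Pp, Pq.
  destruct Ht as [->|[-> ->]].
  - replace (- (sg * - sg)) with 1 by lra. replace (- (- sg * - sg)) with (- (1)) by lra.
    field. exact w0.
  - replace (- (- sg * sg)) with 1 by lra. replace (- (sg * sg)) with (- (1)) by lra.
    field. exact w0.
Qed.

(** Lagrange's identity: p' y - p y' and q' y - q y' are antiderivatives of p g and q g. The first
    one tends to 0 because [p] decays and [y], [y'] are bounded, which gives the boundary term at 0.
    Eliminating y' between the two by means of the Wronskian gives the formula; the condition at 0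
    excludes a multiple of [p]. *)
Lemma green_repr (y y' g : R -> R) (B : R) : cts g ->
  (forall x, is_derive y x (y' x)) ->
  (forall x, is_derive y' x (Q x * y x - g x)) ->
  (forall x, 0 <= x -> Rabs (y x) <= B) -> (forall x, 0 <= x -> Rabs (y' x) <= B) ->
  I0 (fun x => p x * g x) = p 0 * y' 0 - p' 0 * y 0 /\
  (q 0 * y' 0 - q' 0 * y 0 = 0 -> forall x, y x = green p q w g x).
Proof.
  intros G D D' By By'.
  pose (F := fun x => p' x * y x - p x * y' x).
  assert (DF : forall x, is_derive F x (p x * g x)).
  { intros x. assert (D1 := fs_p S x). assert (D2 := fs_p' S x).
    assert (D3 := D x). assert (D4 := D' x). unfold F. auto_derive.
    - repeat split; eexists; eassumption.
    - dsub D1; dsub D2; dsub D3; dsub D4. ring. }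
  pose (H := fun x => q' x * y x - q x * y' x).
  assert (DH : forall x, is_derive H x (q x * g x)).
  { intros x. assert (D1 := fs_q S x). assert (D2 := fs_q' S x).
    assert (D3 := D x). assert (D4 := D' x). unfold H. auto_derive.
    - repeat split; eexists; eassumption.
    - dsub D1; dsub D2; dsub D3; dsub D4. ring. }
  assert (B0 : 0 <= B) by (specialize (By 0 ltac:(lra)); pose proof (Rabs_pos (y 0)); lra).
  assert (L : is_lim F p_infty 0).
  { apply is_lim_infty_bound with (fun x => (2 * C * B) * exp (- mu * x)) 0.
    - intros x Hx. unfold F. eapply Rle_trans; [apply Rabs_triang|].
      rewrite Rabs_Ropp, !Rabs_mult.
      assert (H1 := fs_pb S x Hx). assert (H2 := fs_pb' S x Hx).
      assert (Rabs (p' x) * Rabs (y x) <= (C * exp (- mu * x)) * B)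
        by (apply Rmult_le_compat; auto using Rabs_pos).
      assert (Rabs (p x) * Rabs (y' x) <= (C * exp (- mu * x)) * B)
        by (apply Rmult_le_compat; auto using Rabs_pos).
      lra.
    - now apply exp_lin_lim. }
  destruct (conv_FTC (fun x => p x * g x) F 0 ltac:(cts_tac) DF L) as [_ E].
  split; [rewrite E; unfold F; ring|].
  intros Hz x. unfold green.
  assert (E1 : RInt (fun y => p y * g y) 0 x = F x - F 0).
  { apply is_RInt_unique. apply (is_RInt_derive F); [intros; apply DF|].
    intros; apply (cts_mult p g cp G). }
  assert (E2 : RInt (fun y => q y * g y) 0 x = H x - H 0).
  { apply is_RInt_unique. apply (is_RInt_derive H); [intros; apply DH|].
    intros; apply (cts_mult q g cq G). }
  rewrite E, E1, E2.
  replace (H 0) with 0 by (unfold H; lra).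
  assert (W := fs_W S x).
  apply Rmult_eq_reg_r with w; [|exact w0].
  replace (y x * w) with (y x * (p x * q' x - p' x * q x)) by (rewrite W; ring).
  unfold F, H. field. exact w0.
Qed.

End FundamentalSystem.

Arguments conv_pg {Q p p' q q' mu C w}.
Arguments I0_pg_bound {Q p p' q q' mu C w}.
Arguments green_const_pos {Q p p' q q' mu C w}.
Arguments green_bound {Q p p' q q' mu C w}.
Arguments green_minus {Q p p' q q' mu C w}.
Arguments is_derive_green {Q p p' q q' mu C w}.
Arguments is_derive_green' {Q p p' q q' mu C w}.
Arguments cts_green {Q p p' q q' mu C w}.
Arguments green_parity {Q p p' q q' mu C w}.
Arguments green_repr {Q p p' q q' mu C w}.

(** On [x, x + 1] some value of y' is a difference quotient, hence at most 2B in modulus, and y''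
    moves it by at most B. *)
Lemma derive_bounded (y y' y'' : R -> R) (B : R) :
  (forall x, is_derive y x (y' x)) -> (forall x, is_derive y' x (y'' x)) ->
  (forall x, 0 <= x -> Rabs (y x) <= B) -> (forall x, 0 <= x -> Rabs (y'' x) <= B) ->
  forall x, 0 <= x -> Rabs (y' x) <= 3 * B.
Proof.
  intros D D' By By'' x Hx.
  destruct (MVT_gen y x (x + 1) y') as [c [Hc E]].
  { intros; apply D. }
  { intros; apply continuity_pt_filterlim. apply (cts_derive _ _ D). }
  rewrite Rmin_left, Rmax_right in Hc by lra.
  destruct (MVT_gen y' x c y'') as [d [Hd E']].
  { intros; apply D'. }
  { intros; apply continuity_pt_filterlim. apply (cts_derive _ _ D'). }
  rewrite Rmin_left, Rmax_right in Hd by lra.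
  assert (H1 := By x Hx). assert (H2 := By (x + 1) ltac:(lra)). assert (H3 := By'' d ltac:(lra)).
  apply Rabs_le_between in H1, H2, H3. apply Rabs_le. nra.
Qed.

(** * The two linearized operators *)

Lemma cosh_pos (x : R) : 0 < cosh x.
Proof. unfold cosh. pose proof (exp_pos x). pose proof (exp_pos (- x)). lra. Qed.

Lemma sech_pos (x : R) : 0 < sech x.
Proof. apply Rinv_0_lt_compat, cosh_pos. Qed.

Lemma cosh_sech (x : R) : cosh x = / sech x.
Proof. unfold sech. now rewrite Rinv_inv. Qed.

Lemma cosh_sq (x : R) : cosh x ^ 2 - sinh x ^ 2 = 1.
Proof.
  unfold cosh, sinh.
  assert (exp x * exp (- x) = 1) by (rewrite <- exp_plus, Rplus_opp_r; apply exp_0).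
  nra.
Qed.

Lemma tanh_sq (x : R) : tanh x ^ 2 = 1 - sech x ^ 2.
Proof.
  unfold tanh, sech. assert (H := cosh_pos x). assert (E := cosh_sq x).
  apply Rmult_eq_reg_r with (cosh x ^ 2); [|apply pow_nonzero; lra].
  field_simplify; lra.
Qed.

Lemma sech_le_1 (x : R) : sech x <= 1.
Proof.
  assert (H := tanh_sq x). assert (H1 := sech_pos x). pose proof (pow2_ge_0 (tanh x)). nra.
Qed.

Lemma tanh_abs (x : R) : Rabs (tanh x) <= 1.
Proof.
  assert (H := tanh_sq x). pose proof (pow2_ge_0 (sech x)). apply Rabs_le. nra.
Qed.

Lemma is_derive_cosh (x : R) : is_derive cosh x (sinh x).
Proof. unfold cosh, sinh. auto_derive; [easy|]. field. Qed.

Lemma is_derive_sinh (x : R) : is_derive sinh x (cosh x).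
Proof. unfold cosh, sinh. auto_derive; [easy|]. field. Qed.

Lemma is_derive_sech (x : R) : is_derive sech x (- sech x * tanh x).
Proof.
  assert (D := is_derive_cosh x). assert (H := cosh_pos x).
  apply (is_derive_ext (fun y => / cosh y)); [easy|]. auto_derive.
  - dside.
  - dsub D. unfold sech, tanh. field. lra.
Qed.

Lemma is_derive_tanh (x : R) : is_derive tanh x (sech x ^ 2).
Proof.
  assert (D := is_derive_cosh x). assert (D' := is_derive_sinh x). assert (H := cosh_pos x).
  apply (is_derive_ext (fun y => sinh y / cosh y)); [easy|]. auto_derive.
  - dside.
  - dsub D. dsub D'. unfold sech. assert (E := cosh_sq x).
    apply Rmult_eq_reg_r with (cosh x ^ 2); [|apply pow_nonzero; lra].
    field_simplify; lra.
Qed.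

Lemma cts_sech : cts sech.
Proof. exact (cts_derive _ _ is_derive_sech). Qed.

Lemma cosh_even (x : R) : cosh (- x) = cosh x.
Proof. unfold cosh. rewrite Ropp_involutive. lra. Qed.
Lemma sech_even (x : R) : sech (- x) = sech x.
Proof. unfold sech. now rewrite cosh_even. Qed.
Lemma tanh_odd (x : R) : tanh (- x) = - tanh x.
Proof.
  unfold tanh. rewrite cosh_even. unfold sinh. rewrite Ropp_involutive.
  assert (H := cosh_pos x). field. lra.
Qed.

Lemma cosh_le_exp (x : R) : 0 <= x -> cosh x <= exp x.
Proof.
  intros Hx. unfold cosh.
  assert (exp (- x) <= exp x); [|lra].
  destruct (Req_dec x 0) as [->|]; [rewrite Ropp_0; lra|].
  left. apply exp_increasing. lra.
Qed.

Lemma cosh_ge_exp (x : R) : exp x / 2 <= cosh x.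
Proof. unfold cosh. pose proof (exp_pos (- x)). lra. Qed.

Lemma sech_le_exp (x : R) : sech x <= 2 * exp (- x).
Proof.
  unfold sech. assert (H := cosh_ge_exp x). assert (P := exp_pos x).
  rewrite exp_Ropp. replace (2 * / exp x) with (/ (exp x / 2)) by (field; lra).
  apply Rinv_le_contravar; lra.
Qed.

(** * The linearization in the first component *)

Definition phi12' (x : R) : R := 2 * sech x ^ 3 - sech x.
Definition phi11' (x : R) : R :=
  - 3 * sech x * tanh x - / 2 * sinh x - 3 / 2 * x * phi12' x.

Lemma phi11_alt (x : R) :
  phi11 x = 3 / 2 * sech x - / 2 * cosh x - 3 / 2 * x * (sech x * tanh x).
Proof. unfold phi11. rewrite cosh_sech. pose proof (sech_pos x). field. lra. Qed.

Lemma is_derive_phi12 (x : R) : is_derive phi12 x (phi12' x).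
Proof.
  assert (D := is_derive_sech x). assert (D' := is_derive_tanh x).
  unfold phi12. auto_derive.
  - dside.
  - dsub D. dsub D'. unfold phi12'. assert (H := tanh_sq x).
    replace (sech x ^ 3) with (sech x * sech x ^ 2) by ring.
    replace (sech x ^ 2) with (1 - tanh x ^ 2) by lra. ring.
Qed.

Lemma is_derive_phi12' (x : R) :
  is_derive phi12' x ((1 - 6 * sech x ^ 2) * phi12 x).
Proof.
  assert (D := is_derive_sech x). unfold phi12'. auto_derive.
  - dside.
  - dsub D. unfold phi12. ring.
Qed.

Lemma is_derive_phi11 (x : R) : is_derive phi11 x (phi11' x).
Proof.
  assert (D1 := is_derive_sech x). assert (D2 := is_derive_cosh x).
  assert (D3 := is_derive_phi12 x).
  apply (is_derive_ext (fun x => 3 / 2 * sech x - / 2 * cosh x - 3 / 2 * x * phi12 x)).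
  { intros y. now rewrite phi11_alt. }
  auto_derive.
  - dside.
  - dsub D1. dsub D2. dsub D3. unfold phi11', phi12. field.
Qed.

Lemma sinh_tanh (x : R) : sinh x = tanh x / sech x.
Proof. unfold tanh, sech. pose proof (cosh_pos x). field. lra. Qed.

Lemma is_derive_phi11' (x : R) :
  is_derive phi11' x ((1 - 6 * sech x ^ 2) * phi11 x).
Proof.
  assert (D1 := is_derive_sech x). assert (D2 := is_derive_sinh x).
  assert (D3 := is_derive_phi12' x). assert (D4 := is_derive_tanh x).
  unfold phi11'. auto_derive.
  - dside.
  - dsub D1. dsub D2. dsub D3. dsub D4. rewrite phi11_alt. unfold phi12, phi12'.
    assert (H := tanh_sq x). assert (P := sech_pos x). rewrite cosh_sech.
    apply Rminus_diag_uniq.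
    transitivity (3 * sech x * (tanh x ^ 2 - (1 - sech x ^ 2))); [field; lra|].
    rewrite H. ring.
Qed.

Lemma exp_le_compat (x y : R) : x <= y -> exp x <= exp y.
Proof.
  intros [H|H]; [left; now apply exp_increasing|right; now f_equal].
Qed.

(** The potential is 1 - 3 U0^2. The decaying solution [phi12] is -U0' / sqrt 2, the translation
    mode; the constant 6 is a crude common bound. *)
Lemma fsys_U : fsys (fun x => 1 - 6 * sech x ^ 2) phi12 phi12' phi11 phi11' 1 6 (-1).
Proof.
  split; try lra.
  - pose proof cts_sech. cts_tac.
  - apply is_derive_phi12.
  - apply is_derive_phi12'.
  - apply is_derive_phi11.
  - apply is_derive_phi11'.
  - intros x. rewrite phi11_alt. unfold phi11', phi12, phi12'.
    rewrite sinh_tanh, cosh_sech. assert (P := sech_pos x). assert (H := tanh_sq x).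
    transitivity (- tanh x ^ 2 * (3 * sech x ^ 2 + / 2) - (2 * sech x ^ 3 - sech x) * (3 / 2 * sech x - / 2 * / sech x)); [field; lra|].
    rewrite H. field. lra.
  - intros x Hx. unfold phi12. rewrite Rabs_mult, (Rabs_pos_eq (sech x)) by (left; apply sech_pos).
    pose proof (sech_le_exp x). pose proof (tanh_abs x). pose proof (sech_pos x).
    pose proof (Rabs_pos (tanh x)). replace (- (1) * x) with (- x) by ring.
    pose proof (exp_pos (- x)). nra.
  - intros x Hx. unfold phi12'.
    pose proof (sech_le_exp x). pose proof (sech_le_1 x). pose proof (sech_pos x).
    replace (- (1) * x) with (- x) by ring. pose proof (exp_pos (- x)).
    assert (0 <= sech x ^ 2 <= 1) by nra.
    apply Rabs_le. split; nra.
  - intros x Hx. rewrite phi11_alt. rewrite Rmult_1_l.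
    pose proof (cosh_le_exp x Hx). pose proof (cosh_pos x). pose proof (sech_le_1 x).
    pose proof (sech_pos x). pose proof (exp_ineq1_le x).
    assert (Rabs (sech x * tanh x) <= 1).
    { rewrite Rabs_mult, (Rabs_pos_eq (sech x)) by lra.
      pose proof (tanh_abs x). pose proof (Rabs_pos (tanh x)). nra. }
    apply Rabs_le_between in H4. apply Rabs_le. split; nra.
Qed.

Lemma parity_phi12 : parity (-1) phi12.
Proof. intros x. unfold phi12. rewrite sech_even, tanh_odd. ring. Qed.

Lemma parity_phi11 : parity 1 phi11.
Proof. intros x. rewrite !phi11_alt, sech_even, tanh_odd, cosh_even. ring. Qed.

(** * The Poeschl-Teller operators of the second component *)

Definition QV (mu nu x : R) : R := mu ^ 2 - nu * (nu + 1) * sech x ^ 2.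

Lemma cts_QV (mu nu : R) : cts (QV mu nu).
Proof. unfold QV. pose proof cts_sech. cts_tac. Qed.

(* The ladder [f |-> (nu + 1) tanh f - f'] intertwines the Poeschl-Teller operators
   with parameters nu and nu + 1; the second component is the derivative. *)
Fixpoint ladder (mu : R) (n : nat) (f : (R -> R) * (R -> R)) : (R -> R) * (R -> R) :=
  match n with
  | O => f
  | S m =>
      let g := ladder mu m f in
      let k := mu + INR m + 1 in
      (fun x => k * tanh x * fst g x - snd g x,
       fun x => (k ^ 2 - mu ^ 2) * fst g x - k * tanh x * (k * tanh x * fst g x - snd g x))
  end.

Definition sol (mu nu : R) (f : (R -> R) * (R -> R)) : Prop :=
  (forall x, is_derive (fst f) x (snd f x)) /\
  (forall x, is_derive (snd f) x (QV mu nu x * fst f x)).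

(** Write D for d/dx. Composing k tanh + D after k tanh - D gives -D^2 + k^2 - k (k - 1) sech^2, and
    the reverse order gives the same with k (k + 1). With k = nu + 1 these are the operators of
    parameters nu and nu + 1, up to constants; the first product also yields the derivative stored
    in [ladder]. *)
Lemma ladder_sol (mu : R) (n : nat) (f : (R -> R) * (R -> R)) :
  sol mu mu f -> sol mu (mu + INR n) (ladder mu n f).
Proof.
  intros H. induction n as [|n IH].
  - simpl INR. now rewrite Rplus_0_r.
  - rewrite S_INR. cbn [ladder]. destruct IH as [D D'].
    destruct (ladder mu n f) as [g g']. cbn [fst snd] in *.
    set (k := mu + INR n + 1).
    replace (mu + (INR n + 1)) with k by (unfold k; ring).
    assert (D1 : forall x, is_derive (fun x => k * tanh x * g x - g' x) x
      ((k ^ 2 - mu ^ 2) * g x - k * tanh x * (k * tanh x * g x - g' x))).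
    { intros x. specialize (D x). specialize (D' x). assert (Dt := is_derive_tanh x).
      auto_derive.
      - dside.
      - dsub D. dsub D'. dsub Dt. unfold QV.
        replace (mu + INR n) with (k - 1) by (unfold k; ring).
        assert (H2 := tanh_sq x).
        replace (sech x ^ 2) with (1 - tanh x ^ 2) by lra. ring. }
    split; cbn [fst snd]; [exact D1|].
    intros x. specialize (D1 x). specialize (D x). assert (Dt := is_derive_tanh x).
    pose (h := fun x => k * tanh x * g x - g' x).
    change (is_derive h x ((k ^ 2 - mu ^ 2) * g x - k * tanh x * h x)) in D1.
    change (is_derive (fun x => (k ^ 2 - mu ^ 2) * g x - k * tanh x * h x) x (QV mu k x * h x)).
    auto_derive.
    + dside.
    + dsub D. dsub D1. dsub Dt. unfold QV.
      assert (H2 := tanh_sq x).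
      replace (g' x) with (k * tanh x * g x - h x) by (unfold h; ring).
      replace (sech x ^ 2) with (1 - tanh x ^ 2) by lra. ring.
Qed.

Definition wronsk (f g : (R -> R) * (R -> R)) (x : R) : R :=
  fst f x * snd g x - snd f x * fst g x.

(** Each rung multiplies the Wronskian by k^2 - mu^2, which is positive since k > mu; independent
    solutions stay independent. *)
Lemma ladder_wronsk (mu : R) (n : nat) : 0 < mu ->
  exists c, c <> 0 /\ forall f g x,
    wronsk (ladder mu n f) (ladder mu n g) x = c * wronsk f g x.
Proof.
  intros Hm. induction n as [|n [c [Hc IH]]].
  - exists 1. split; [lra|]. intros; simpl; ring.
  - exists (((mu + INR n + 1) ^ 2 - mu ^ 2) * c). split.
    + apply Rmult_integral_contrapositive_currified; [|easy].
      pose proof (pos_INR n). nra.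
    + intros f g x. rewrite Rmult_assoc, <- IH. unfold wronsk. cbn [ladder fst snd]. ring.
Qed.

(** As |tanh| <= 1, a rung only changes the constant. The rate [k] may have either sign, so the
    lemma serves the decaying and the growing solution. *)
Lemma ladder_bound (mu k : R) (n : nat) (f : (R -> R) * (R -> R)) (C : R) :
  0 < mu ->
  (forall x, 0 <= x -> Rabs (fst f x) <= C * exp (k * x) /\ Rabs (snd f x) <= C * exp (k * x)) ->
  exists C', forall x, 0 <= x ->
    Rabs (fst (ladder mu n f) x) <= C' * exp (k * x) /\
    Rabs (snd (ladder mu n f) x) <= C' * exp (k * x).
Proof.
  intros Hm H. induction n as [|n [C1 IH]].
  - now exists C.
  - set (a := mu + INR n + 1).
    assert (Ha : 1 < a) by (unfold a; pose proof (pos_INR n); lra).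
    assert (Hma : 0 <= a ^ 2 - mu ^ 2 <= a ^ 2) by (unfold a; pose proof (pos_INR n); split; nra).
    exists ((a ^ 2 + a * (a + 1) + (a + 1)) * C1). intros x Hx.
    destruct (IH x Hx) as [H1 H2]. cbn [ladder fst snd]. fold a.
    set (g := fst (ladder mu n f) x) in *. set (g' := snd (ladder mu n f) x) in *.
    set (E := exp (k * x)) in *.
    assert (T := tanh_abs x).
    assert (P1 := Rabs_pos g).
    assert (P2 := Rabs_pos (tanh x)).
    assert (H3 : Rabs (a * tanh x * g - g') <= (a + 1) * (C1 * E)).
    { eapply Rle_trans; [apply Rabs_triang|]. rewrite Rabs_Ropp, !Rabs_mult, (Rabs_pos_eq a) by lra.
      assert (Rabs (tanh x) * Rabs g <= 1 * (C1 * E)) by (apply Rmult_le_compat; lra).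
      nra. }
    assert (H4 : Rabs (a * tanh x * (a * tanh x * g - g')) <= a * (a + 1) * (C1 * E)).
    { rewrite Rabs_mult, Rabs_mult, (Rabs_pos_eq a) by lra.
      assert (P3 := Rabs_pos (a * tanh x * g - g')).
      assert (Rabs (tanh x) * Rabs (a * tanh x * g - g') <= 1 * ((a + 1) * (C1 * E)))
        by (apply Rmult_le_compat; lra).
      nra. }
    assert (P4 : 0 <= C1 * E) by lra.
    split.
    + nra.
    + eapply Rle_trans; [apply Rabs_triang|]. rewrite Rabs_Ropp, (Rabs_mult _ g), (Rabs_pos_eq (a^2 - mu^2)) by lra.
      assert ((a ^ 2 - mu ^ 2) * Rabs g <= a ^ 2 * (C1 * E)) by (apply Rmult_le_compat; lra).
      nra.
Qed.

Lemma ladder_parity (mu sg : R) (n : nat) (f : (R -> R) * (R -> R)) :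
  parity sg (fst f) -> parity (- sg) (snd f) ->
  parity (sg * (-1) ^ n) (fst (ladder mu n f)) /\
  parity (- (sg * (-1) ^ n)) (snd (ladder mu n f)).
Proof.
  intros H H'. induction n as [|n [IH IH']].
  - simpl. rewrite Rmult_1_r. now split.
  - split; intros x; cbn [ladder fst snd]; rewrite IH, IH', tanh_odd; simpl pow; ring.
Qed.

(** The power sech^k for a real exponent. *)
Definition sp (k x : R) : R := exp (- k * ln (cosh x)).

Lemma is_derive_sp (k x : R) : is_derive (sp k) x (- k * tanh x * sp k x).
Proof.
  assert (D := is_derive_cosh x). assert (P := cosh_pos x). unfold sp. auto_derive.
  - dside.
  - dsub D. unfold tanh. field. lra.
Qed.

Lemma sp_pos (k x : R) : 0 < sp k x.
Proof. apply exp_pos. Qed.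

Lemma sp_even (k : R) : parity 1 (sp k).
Proof. intros x. unfold sp. rewrite cosh_even. ring. Qed.

Lemma sp_add2 (k x : R) : sp (k + 2) x = sech x ^ 2 * sp k x.
Proof.
  unfold sp. replace (- (k + 2) * ln (cosh x)) with (- k * ln (cosh x) + - ln (cosh x) + - ln (cosh x)) by ring.
  rewrite !exp_plus, exp_Ropp, exp_ln by apply cosh_pos. unfold sech. ring.
Qed.

Lemma sp_bound (k x : R) : 0 <= k -> sp k x <= exp (k * ln 2) * exp (- k * x).
Proof.
  intros Hk. unfold sp. rewrite <- exp_plus. apply exp_le_compat.
  assert (x - ln 2 <= ln (cosh x)); [|nra].
  replace (x - ln 2) with (ln (exp x / 2)).
  - destruct (cosh_ge_exp x) as [H|H]; [|rewrite H; lra].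
    left. apply ln_increasing; [pose proof (exp_pos x); lra|easy].
  - unfold Rdiv. rewrite ln_mult, ln_exp, ln_Rinv by (try apply exp_pos; lra). ring.
Qed.

Lemma sp_inv_bound (k x : R) : 0 <= k -> 0 <= x -> / sp k x <= exp (k * x).
Proof.
  intros Hk Hx. unfold sp. rewrite <- exp_Ropp. apply exp_le_compat.
  assert (ln (cosh x) <= x); [|nra].
  rewrite <- (ln_exp x) at 2.
  destruct (cosh_le_exp x Hx) as [H|H]; [|rewrite H; lra].
  left. apply ln_increasing; [apply cosh_pos|easy].
Qed.

(** The foot of the ladder, nu = mu, where sech^mu solves the equation. *)
Definition seed_p (mu : R) : (R -> R) * (R -> R) :=
  (sp mu, fun x => - mu * tanh x * sp mu x).

Definition cint (mu : R) : R -> R := RInt (fun y => / sp mu y * / sp mu y) 0.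

(** Reduction of order: sech^mu times the primitive of its inverse square. Integrating from 0 makes
    this solution odd, and the Wronskian with [seed_p] is 1. *)
Definition seed_q (mu : R) : (R -> R) * (R -> R) :=
  (fun x => sp mu x * cint mu x, fun x => - mu * tanh x * (sp mu x * cint mu x) + / sp mu x).

Lemma is_derive_sp_inv (k x : R) : is_derive (fun y => / sp k y) x (k * tanh x * / sp k x).
Proof.
  assert (D := is_derive_sp k x). assert (P := sp_pos k x). auto_derive.
  - dside.
  - dsub D. field. lra.
Qed.

Lemma cts_sp_inv (k : R) : cts (fun y => / sp k y).
Proof. exact (cts_derive _ _ (is_derive_sp_inv k)). Qed.

Lemma is_derive_cint (mu x : R) : is_derive (cint mu) x (/ sp mu x * / sp mu x).
Proof.
  apply (is_derive_prim (fun y => / sp mu y * / sp mu y)).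
  pose proof (cts_sp_inv mu). cts_tac.
Qed.

Lemma sol_seed_p (mu : R) : sol mu mu (seed_p mu).
Proof.
  split; cbn [fst snd seed_p].
  - apply is_derive_sp.
  - intros x. assert (D := is_derive_sp mu x). assert (Dt := is_derive_tanh x). auto_derive.
    + dside.
    + dsub D. dsub Dt. unfold QV. assert (H2 := tanh_sq x).
      replace (sech x ^ 2) with (1 - tanh x ^ 2) by lra. ring.
Qed.

Lemma sol_seed_q (mu : R) : sol mu mu (seed_q mu).
Proof.
  split; cbn [fst snd seed_q]; intros x; assert (D := is_derive_sp mu x);
    assert (Dt := is_derive_tanh x); assert (Dc := is_derive_cint mu x);
    assert (Di := is_derive_sp_inv mu x); assert (P := sp_pos mu x).
  - auto_derive.
    + dside.
    + dsub D. dsub Dc. field. lra.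
  - auto_derive.
    + dside.
    + dsub D. dsub Dt. dsub Dc. unfold QV. assert (H2 := tanh_sq x).
      replace (sech x ^ 2) with (1 - tanh x ^ 2) by lra. field. lra.
Qed.

Lemma seed_wronsk (mu x : R) : wronsk (seed_p mu) (seed_q mu) x = 1.
Proof. unfold wronsk; cbn [fst snd seed_p seed_q]. pose proof (sp_pos mu x). field. lra. Qed.

Lemma seed_p_bound (mu x : R) : 0 < mu -> 0 <= x ->
  Rabs (fst (seed_p mu) x) <= (1 + mu) * exp (mu * ln 2) * exp (- mu * x) /\
  Rabs (snd (seed_p mu) x) <= (1 + mu) * exp (mu * ln 2) * exp (- mu * x).
Proof.
  intros Hm Hx. cbn [fst snd seed_p].
  assert (P := sp_pos mu x). assert (B := sp_bound mu x ltac:(lra)). assert (T := tanh_abs x).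
  pose proof (Rabs_pos (tanh x)).
  rewrite !Rabs_mult, Rabs_Ropp, (Rabs_pos_eq mu), (Rabs_pos_eq (sp mu x)) by lra.
  rewrite Rmult_assoc. set (E := exp (mu * ln 2) * exp (- mu * x)) in *.
  split; [nra|].
  assert (mu * Rabs (tanh x) * sp mu x <= mu * 1 * E) by
    (repeat apply Rmult_le_compat; try lra; apply Rmult_le_pos; lra).
  nra.
Qed.

Lemma seed_q_bound (mu : R) : 0 < mu ->
  exists C, forall x, 0 <= x ->
  Rabs (fst (seed_q mu) x) <= C * exp (mu * x) /\ Rabs (snd (seed_q mu) x) <= C * exp (mu * x).
Proof.
  (* [A] is the product of the constant in sech^mu <= 2^mu exp(-mu x) with the factor 1 / (2 mu)
     from integrating exp(2 mu y). *)
  intros Hm. set (A := exp (mu * ln 2) * / (2 * mu)).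
  assert (HA : 0 < A).
  { unfold A. apply Rmult_lt_0_compat; [apply exp_pos|apply Rinv_0_lt_compat; lra]. }
  exists ((1 + mu) * A + 1). intros x Hx.
  assert (Hc : Rabs (cint mu x) <= / (2 * mu) * exp (2 * mu * x)).
  { unfold cint. eapply Rle_trans.
    - apply (RInt_abs_le _ (fun y => exp (2 * mu * y)) (fun y => / (2 * mu) * exp (2 * mu * y)) 0 x Hx).
      + pose proof (cts_sp_inv mu). cts_tac.
      + intros y _. replace (exp (2 * mu * y)) with (/ (2 * mu) * (2 * mu) * exp (2 * mu * y)) by (field; lra).
        apply is_derive_exp_lin.
      + intros y Hy. assert (H := sp_inv_bound mu y ltac:(lra) ltac:(lra)).
        assert (H' : 0 < / sp mu y) by apply Rinv_0_lt_compat, sp_pos.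
        rewrite Rabs_pos_eq by nra. replace (2 * mu * y) with (mu * y + mu * y) by ring.
        rewrite exp_plus. apply Rmult_le_compat; lra.
    - assert (0 <= / (2 * mu) * exp (2 * mu * 0)); [|lra].
      apply Rmult_le_pos; [left; apply Rinv_0_lt_compat; lra|left; apply exp_pos]. }
  assert (P := sp_pos mu x). assert (B := sp_bound mu x ltac:(lra)). assert (T := tanh_abs x).
  assert (Hq : Rabs (sp mu x * cint mu x) <= A * exp (mu * x)).
  { rewrite Rabs_mult, (Rabs_pos_eq (sp mu x)) by lra.
    replace (A * exp (mu * x)) with ((exp (mu * ln 2) * exp (- mu * x)) * (/ (2 * mu) * exp (2 * mu * x))).
    - apply Rmult_le_compat; auto using Rabs_pos; lra.
    - unfold A. replace (2 * mu * x) with (mu * x + mu * x) by ring.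
      replace (- mu * x) with (- (mu * x)) by ring. rewrite exp_plus, exp_Ropp.
      pose proof (exp_pos (mu * x)). field. lra. }
  assert (Hi := sp_inv_bound mu x ltac:(lra) Hx).
  assert (0 < / sp mu x) by now apply Rinv_0_lt_compat.
  pose proof (exp_pos (mu * x)).
  assert (0 < mu * A * exp (mu * x)) by
    (apply Rmult_lt_0_compat; [apply Rmult_lt_0_compat|]; lra).
  assert (0 < A * exp (mu * x)) by (apply Rmult_lt_0_compat; lra).
  cbn [fst snd seed_q]. split.
  - eapply Rle_trans; [exact Hq|]. nra.
  - eapply Rle_trans; [apply Rabs_triang|].
    rewrite (Rabs_pos_eq (/ sp mu x)) by lra.
    rewrite (Rabs_mult (- mu * tanh x)), (Rabs_mult (- mu)), Rabs_Ropp, (Rabs_pos_eq mu) by lra.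
    pose proof (Rabs_pos (tanh x)). pose proof (Rabs_pos (sp mu x * cint mu x)).
    assert (mu * Rabs (tanh x) * Rabs (sp mu x * cint mu x) <= mu * 1 * (A * exp (mu * x))) by
      (repeat apply Rmult_le_compat; try lra; apply Rmult_le_pos; lra).
    nra.
Qed.

Lemma seed_parity (mu : R) :
  parity 1 (fst (seed_p mu)) /\ parity (- (1)) (snd (seed_p mu)) /\
  parity (-1) (fst (seed_q mu)) /\ parity (- -1) (snd (seed_q mu)).
Proof.
  assert (E : forall x, cint mu (- x) = - (1) * cint mu x).
  { intros x. apply RInt_parity; [pose proof (cts_sp_inv mu); cts_tac|].
    intros y. rewrite (sp_even mu y), Rmult_1_l. ring. }
  repeat split; intros x; cbn [fst snd seed_p seed_q];
    rewrite ?E, ?tanh_odd, (sp_even mu x), ?Rmult_1_l; ring.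
Qed.

(** * The hypergeometric solution *)

(** The terms of index below [N], so a polynomial of degree L corresponds to [S L]. The empty sum at
    N = 0 is where the induction on truncations starts. *)
Fixpoint psum (f : nat -> R) (N : nat) : R :=
  match N with
  | O => 0
  | S n => psum f n + f n
  end.

Lemma psum_ext (f g : nat -> R) (N : nat) : (forall n, f n = g n) -> psum f N = psum g N.
Proof. intros H; induction N; simpl; [easy|]. now rewrite IHN, H. Qed.

Lemma psum_scal (c : R) (f : nat -> R) (N : nat) : psum (fun n => c * f n) N = c * psum f N.
Proof. induction N; simpl; [ring|]. rewrite IHN. ring. Qed.

Lemma PSeries_finite (a : nat -> R) (N : nat) (x : R) :
  (forall n, (N < n)%nat -> a n = 0) -> PSeries a x = psum (fun n => a n * x ^ n) (S N).
Proof.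
  intros H. unfold PSeries. apply is_series_unique.
  assert (E : forall n, (N <= n)%nat ->
    sum_n (fun k => a k * x ^ k) n = psum (fun n => a n * x ^ n) (S N)).
  { intros n Hn. induction Hn as [|n Hn IH].
    - induction N as [|N IH]; [rewrite sum_O; simpl; ring|].
      clear H. rewrite sum_Sn.
      assert (G : forall M, sum_n (fun k => a k * x ^ k) M = psum (fun n => a n * x ^ n) (S M)).
      { induction M as [|M IM]; [rewrite sum_O; simpl; ring|].
        rewrite sum_Sn, IM. reflexivity. }
      rewrite G. reflexivity.
    - rewrite sum_Sn, IH. rewrite (H (S n)) by lia. unfold plus; simpl. ring. }
  apply (filterlim_ext_loc (fun _ => psum (fun n => a n * x ^ n) (S N))).
  - exists N. intros n Hn. symmetry. now apply E.
  - apply filterlim_const.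
Qed.

Lemma poch_neg (L n : nat) : (L < n)%nat -> poch (- INR L) n = 0.
Proof.
  intros H. induction H as [|n Hn IH]; simpl poch; [ring|].
  rewrite IH. ring.
Qed.

Lemma poch_pos (c : R) (n : nat) : 0 < c -> 0 < poch c n.
Proof.
  intros Hc. induction n; simpl; [lra|]. apply Rmult_lt_0_compat; [easy|].
  pose proof (pos_INR n). lra.
Qed.

Definition odd_factor (d : bool) (x : R) : R := if d then tanh x else 1.
(** The functions sech^k and sech^k tanh; [V1] is a finite combination of those with exponents sqrt
    s + 2n. *)
Definition ek (d : bool) (k x : R) : R := sp k x * odd_factor d x.

(** The second derivative of a building block involves only itself and the block of exponent k + 2;
    a series in these blocks therefore obeys a two-term recurrence. *)
Lemma ek_sol (d : bool) (k : R) :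
  exists e', (forall x, is_derive (ek d k) x (e' x)) /\
  forall x, is_derive e' x (k ^ 2 * ek d k x - (k + INR (Nat.b2n d)) * (k + INR (Nat.b2n d) + 1) * ek d (k + 2) x).
Proof.
  unfold ek, odd_factor. destruct d; simpl INR.
  - exists (fun x => (k + 1) * (sech x ^ 2 * sp k x) - k * sp k x). split; intros x.
    + assert (D := is_derive_sp k x). assert (Dt := is_derive_tanh x). auto_derive.
      * dside.
      * dsub D. dsub Dt. assert (H2 := tanh_sq x).
        replace (sech x ^ 2) with (1 - tanh x ^ 2) by lra. ring.
    + assert (D := is_derive_sp k x). assert (Dt := is_derive_sech x). auto_derive.
      * dside.
      * dsub D. dsub Dt. rewrite sp_add2. ring.
  - exists (fun x => - k * tanh x * sp k x). split; intros x.
    + apply (is_derive_ext (sp k)); [intros; symmetry; apply Rmult_1_r|]. apply is_derive_sp.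
    + assert (D := is_derive_sp k x). assert (Dt := is_derive_tanh x). auto_derive.
      * dside.
      * dsub D. dsub Dt. rewrite sp_add2. assert (H2 := tanh_sq x).
        replace (sech x ^ 2) with (1 - tanh x ^ 2) by lra. ring.
Qed.

Section Hypergeometric.
Variables (mu : R) (d : bool) (L : nat) (a : nat -> R).
Let dd := INR (Nat.b2n d).
(** Comparison of coefficients at exponent mu + 2n + 2. The left factor is (mu + 2n + 2)^2 - mu^2;
    the right one is nu (nu + 1) - m (m + 1) with nu = mu + 2L + dd and m = mu + 2n + dd,
    factored. *)
Hypothesis rec : forall n, a (S n) * (4 * (INR n + 1) * (mu + INR n + 1)) =
  - a n * ((2 * INR L - 2 * INR n) * (2 * mu + 2 * INR L + 2 * INR n + 2 * dd + 1)).

Let F (N : nat) (x : R) : R := psum (fun n => a n * ek d (mu + 2 * INR n) x) N.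

(* By [rec] the residual of the truncated series telescopes. *)
Lemma truncated_series_sol (N : nat) :
  exists F', (forall x, is_derive (F N) x (F' x)) /\
  forall x, is_derive F' x
    (QV mu (mu + 2 * INR L + dd) x * F N x
     - a N * (4 * INR N * (mu + INR N)) * ek d (mu + 2 * INR N) x).
Proof.
  induction N as [|N [F' [D D']]].
  - exists (fun _ => 0). split; intros x; unfold F; simpl.
    + apply @is_derive_const.
    + eapply is_derive_eq; [apply @is_derive_const|]. unfold zero; simpl; ring.
  - destruct (ek_sol d (mu + 2 * INR N)) as [e' [E E']].
    exists (fun x => F' x + a N * e' x). split; intros x.
    + apply (is_derive_ext (fun x => F N x + a N * ek d (mu + 2 * INR N) x)); [easy|].
      specialize (D x). specialize (E x). auto_derive; [dside|]. dsub D. dsub E. ring.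
    + specialize (D' x). specialize (E' x). auto_derive; [dside|]. dsub D'. dsub E'.
      change (F (S N) x) with (F N x + a N * ek d (mu + 2 * INR N) x). rewrite S_INR.
      replace (mu + 2 * (INR N + 1)) with (mu + 2 * INR N + 2) by ring.
      replace (a (S N) * (4 * (INR N + 1) * (mu + (INR N + 1)))) with
        (a (S N) * (4 * (INR N + 1) * (mu + INR N + 1))) by ring.
      rewrite rec. fold dd. unfold QV.
      assert (S2 : ek d (mu + 2 * INR N + 2) x = sech x ^ 2 * ek d (mu + 2 * INR N) x)
        by (unfold ek; rewrite sp_add2; ring).
      rewrite S2. ring.
Qed.

End Hypergeometric.

(** The shift 1/2 + d merges the second parameters of the two hypergeometric formulas, 1/2 for even
    [l] and 3/2 for odd [l]. *)
Definition hyp_coef (mu : R) (d : bool) (L n : nat) : R :=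
  poch (- INR L) n * poch (mu + INR L + (1 / 2 + INR (Nat.b2n d))) n
  / (poch (mu + 1) n * INR (fact n)).

Lemma hyp_coef_rec (mu : R) (d : bool) (L n : nat) : 0 < mu ->
  hyp_coef mu d L (S n) * (4 * (INR n + 1) * (mu + INR n + 1)) =
  - hyp_coef mu d L n * ((2 * INR L - 2 * INR n) *
     (2 * mu + 2 * INR L + 2 * INR n + 2 * INR (Nat.b2n d) + 1)).
Proof.
  intros Hm. unfold hyp_coef. cbn [poch]. rewrite fact_simpl, mult_INR, S_INR.
  assert (P1 := poch_pos (mu + 1) n ltac:(lra)). assert (P2 := INR_fact_lt_0 n).
  assert (P3 := pos_INR n). field. repeat split; lra.
Qed.

Lemma ek_pow (mu : R) (d : bool) (n : nat) (x : R) :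
  ek d (mu + 2 * INR n) x = sp mu x * odd_factor d x * (sech x ^ 2) ^ n.
Proof.
  unfold ek. assert (H : sp (mu + 2 * INR n) x = sp mu x * (sech x ^ 2) ^ n).
  { induction n as [|n IH].
    - simpl. rewrite Rmult_0_r, Rplus_0_r. ring.
    - rewrite S_INR. replace (mu + 2 * (INR n + 1)) with (mu + 2 * INR n + 2) by ring.
      rewrite sp_add2, IH. simpl. ring. }
  rewrite H. ring.
Qed.

Lemma V1_sum (s : R) (l : nat) (x : R) :
  V1 s l x = psum (fun n => hyp_coef (sqrt s) (Nat.odd l) (Nat.div2 l) n
                     * ek (Nat.odd l) (sqrt s + 2 * INR n) x) (S (Nat.div2 l)).
Proof.
  assert (Hr : Rpower (sech x) (sqrt s) = sp (sqrt s) x).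
  { unfold Rpower, sp, sech. rewrite ln_Rinv by apply cosh_pos. f_equal. ring. }
  rewrite (psum_ext _ (fun n => (sp (sqrt s) x * odd_factor (Nat.odd l) x) *
    (hyp_coef (sqrt s) (Nat.odd l) (Nat.div2 l) n * (sech x ^ 2) ^ n))).
  2:{ intros n. rewrite ek_pow. ring. }
  rewrite psum_scal.
  rewrite <- (PSeries_finite _ (Nat.div2 l)).
  2:{ intros n Hn. unfold hyp_coef. rewrite poch_neg by easy. unfold Rdiv. ring. }
  unfold V1. rewrite Hr. rewrite <- Nat.negb_odd. unfold odd_factor, hyp2F1, hyp_coef.
  destruct (Nat.odd l); cbn [negb Nat.b2n].
  - f_equal. apply PSeries_ext. intros n. do 3 f_equal. simpl. field.
  - rewrite Rmult_1_r. f_equal. apply PSeries_ext. intros n. do 3 f_equal. simpl. field.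
Qed.

Lemma V1_sol (s : R) (l : nat) : 0 < s ->
  exists F', sol (sqrt s) (sqrt s + INR l) (V1 s l, F').
Proof.
  intros Hs. assert (Hm := sqrt_lt_R0 s Hs).
  destruct (truncated_series_sol (sqrt s) (Nat.odd l) (Nat.div2 l)
    (hyp_coef (sqrt s) (Nat.odd l) (Nat.div2 l))
    (fun n => hyp_coef_rec _ _ _ n Hm) (S (Nat.div2 l))) as [F' [D D']].
  exists F'. split; cbn [fst snd]; intros x.
  - eapply is_derive_ext; [|apply D]. intros y. symmetry. apply V1_sum.
  - rewrite V1_sum. specialize (D' x).
    (* The residual of the truncated series carries the first omitted coefficient, and the series
       terminates exactly there. *)
    replace (hyp_coef (sqrt s) (Nat.odd l) (Nat.div2 l) (S (Nat.div2 l))) with 0 in D'.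
    2:{ unfold hyp_coef. rewrite poch_neg by lia. unfold Rdiv. ring. }
    replace (sqrt s + INR l) with (sqrt s + 2 * INR (Nat.div2 l) + INR (Nat.b2n (Nat.odd l))).
    + eapply is_derive_eq; [exact D'|]. ring.
    + rewrite (Nat.div2_odd l) at 3. rewrite plus_INR, mult_INR. simpl (INR 2). ring.
Qed.

Lemma psum_bound (a : nat -> R) (f : nat -> R -> R) (N : nat) :
  (forall n x, Rabs (f n x) <= 1) ->
  exists B, forall x, Rabs (psum (fun n => a n * f n x) N) <= B.
Proof.
  intros H. induction N as [|N [B IH]]; simpl.
  - exists 0. intros; rewrite Rabs_R0; lra.
  - exists (B + Rabs (a N)). intros x. eapply Rle_trans; [apply Rabs_triang|].
    apply Rplus_le_compat; [apply IH|]. rewrite Rabs_mult.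
    pose proof (H N x). pose proof (Rabs_pos (a N)). nra.
Qed.

Lemma sp_le_1 (k x : R) : 0 <= k -> sp k x <= 1.
Proof.
  intros Hk. unfold sp. rewrite <- exp_0. apply exp_le_compat.
  assert (0 <= ln (cosh x)); [|nra]. rewrite <- ln_1.
  assert (H := sech_le_1 x). assert (P := cosh_pos x). rewrite cosh_sech.
  assert (P' := sech_pos x).
  destruct H as [H|H]; [|rewrite H, Rinv_1; lra].
  left. apply ln_increasing; [lra|]. rewrite <- Rinv_1. apply Rinv_lt_contravar; lra.
Qed.

Lemma V1_bounded (s : R) (l : nat) : 0 < s -> exists B, forall x, Rabs (V1 s l x) <= B.
Proof.
  intros Hs. assert (Hm := sqrt_lt_R0 s Hs).
  destruct (psum_bound (hyp_coef (sqrt s) (Nat.odd l) (Nat.div2 l))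
    (fun n => ek (Nat.odd l) (sqrt s + 2 * INR n)) (S (Nat.div2 l))) as [B HB].
  - intros n x. unfold ek. rewrite Rabs_mult.
    assert (H1 := sp_le_1 (sqrt s + 2 * INR n) x). assert (H2 := sp_pos (sqrt s + 2 * INR n) x).
    pose proof (pos_INR n). specialize (H1 ltac:(lra)).
    assert (Rabs (odd_factor (Nat.odd l) x) <= 1).
    { unfold odd_factor. destruct (Nat.odd l); [apply tanh_abs|rewrite Rabs_R1; lra]. }
    rewrite (Rabs_pos_eq (sp _ _)) by lra. pose proof (Rabs_pos (odd_factor (Nat.odd l) x)). nra.
  - exists B. intros x. rewrite V1_sum. apply HB.
Qed.

(** The polynomial factor has constant term 1, so it stays positive once z = sech^2 x is small; the
    prefactor has no zero at a positive x. *)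
Lemma V1_nonzero (s : R) (l : nat) : 0 < s -> exists x, V1 s l x <> 0.
Proof.
  intros Hs. set (a := hyp_coef (sqrt s) (Nat.odd l) (Nat.div2 l)).
  assert (H : forall N, exists B, 0 <= B /\ forall z, 0 <= z <= 1 ->
    Rabs (psum (fun n => a n * z ^ n) (S N) - 1) <= B * z).
  { induction N as [|N [B [B0 IH]]].
    - exists 0. split; [lra|]. intros z Hz. simpl. unfold a, hyp_coef. simpl.
      replace (0 + 1 * 1 / (1 * 1) * 1 - 1) with 0 by field. rewrite Rabs_R0. lra.
    - exists (B + Rabs (a (S N))). pose proof (Rabs_pos (a (S N))). split; [lra|].
      intros z Hz. specialize (IH z Hz).
      change (psum (fun n => a n * z ^ n) (S (S N))) with
        (psum (fun n => a n * z ^ n) (S N) + a (S N) * z ^ S N).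
      replace (_ - 1) with ((psum (fun n => a n * z ^ n) (S N) - 1) + a (S N) * z ^ S N) by ring.
      eapply Rle_trans; [apply Rabs_triang|]. rewrite Rabs_mult.
      assert (0 <= z ^ N <= 1).
      { split; [apply pow_le; lra|]. rewrite <- (pow1 N). apply pow_incr. lra. }
      assert (Rabs (z ^ S N) <= z).
      { simpl. rewrite Rabs_pos_eq by nra. nra. }
      pose proof (Rabs_pos (z ^ S N)). nra. }
  destruct (H (Nat.div2 l)) as [B [B0 HB]].
  (* From x sech x < 2 one gets (B + 1) sech^2 x = (x sech x / 2) sech x < 1, which keeps the
     polynomial above 0. *)
  pose (x := 2 * (B + 1)).
  exists x. rewrite V1_sum. fold a.
  rewrite (psum_ext _ (fun n => (sp (sqrt s) x * odd_factor (Nat.odd l) x) *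
    (a n * (sech x ^ 2) ^ n))) by (intros n; rewrite ek_pow; ring).
  rewrite psum_scal.
  assert (Hx : 0 < x) by (unfold x; lra).
  assert (S1 : sech x * x < 2).
  { assert (H1 := sech_le_exp x). assert (H2 := exp_ineq1 x ltac:(lra)).
    rewrite exp_Ropp in H1. assert (H3 := exp_pos x). assert (P := sech_pos x).
    assert (sech x * exp x <= 2).
    { apply Rmult_le_reg_r with (/ exp x); [now apply Rinv_0_lt_compat|].
      rewrite Rmult_assoc, Rinv_r by lra. lra. }
    nra. }
  assert (P := sech_pos x). assert (Q := sech_le_1 x).
  assert (Sz : (B + 1) * sech x ^ 2 < 1).
  { replace ((B + 1) * sech x ^ 2) with (sech x * x / 2 * sech x) by (unfold x at 2; field). nra. }
  specialize (HB (sech x ^ 2) ltac:(nra)). apply Rabs_le_between in HB.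
  assert (0 < psum (fun n => a n * (sech x ^ 2) ^ n) (S (Nat.div2 l))) by nra.
  assert (odd_factor (Nat.odd l) x <> 0).
  { unfold odd_factor. destruct (Nat.odd l); [|lra]. intros E.
    assert (T := tanh_sq x). rewrite E in T. nra. }
  pose proof (sp_pos (sqrt s) x).
  repeat apply Rmult_integral_contrapositive_currified; lra.
Qed.

Definition psign (l : nat) : R := (-1) ^ l.

Lemma psign_sq (l : nat) : psign l * psign l = 1.
Proof. unfold psign. rewrite <- Rpow_mult_distr. replace (-1 * -1) with 1 by ring. apply pow1. Qed.

(** The ladder provides a decaying [P] and a growing [q] of opposite parities. As [V1] solves the
    same equation and is bounded, it is a nonzero multiple of [P], from which it inherits decay,
    parity and a nonzero Wronskian with [q]. *)
Lemma fsys_V (s : R) (l : nat) : 0 < s ->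
  exists V1' q q' C w,
    fsys (QV (sqrt s) (sqrt s + INR l)) (V1 s l) V1' q q' (sqrt s) C w /\
    parity (psign l) (V1 s l) /\ parity (- psign l) q.
Proof.
  intros Hs. set (mu := sqrt s). assert (Hm : 0 < mu) by now apply sqrt_lt_R0.
  set (P := ladder mu l (seed_p mu)). set (q := ladder mu l (seed_q mu)).
  assert (SP : sol mu (mu + INR l) P) by apply ladder_sol, sol_seed_p.
  assert (Sq : sol mu (mu + INR l) q) by apply ladder_sol, sol_seed_q.
  destruct (ladder_wronsk mu l Hm) as [w [Hw W]].
  destruct (ladder_bound mu (- mu) l (seed_p mu) _ Hm (fun x => seed_p_bound mu x Hm)) as [C1 B1].
  destruct (seed_q_bound mu Hm) as [C2' B2'].
  destruct (ladder_bound mu mu l (seed_q mu) C2' Hm B2') as [C2 B2].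
  fold P in B1. fold q in B2.
  destruct (ladder_parity mu 1 l (seed_p mu)) as [PP _]; [apply seed_parity..|].
  destruct (ladder_parity mu (-1) l (seed_q mu)) as [Pq _]; [apply seed_parity..|].
  fold P in PP. fold q in Pq.
  assert (C1p : 0 <= C1).
  { destruct (B1 0 ltac:(lra)) as [H _]. rewrite Rmult_0_r, exp_0 in H. pose proof (Rabs_pos (fst P 0)). lra. }
  assert (C2p : 0 <= C2).
  { destruct (B2 0 ltac:(lra)) as [H _]. rewrite Rmult_0_r, exp_0 in H. pose proof (Rabs_pos (fst q 0)). lra. }
  assert (FS : fsys (QV mu (mu + INR l)) (fst P) (snd P) (fst q) (snd q) mu (C1 + C2) w).
  { split; try (apply SP || apply Sq); try easy.
    - lra.
    - apply cts_QV.
    - intros x. replace w with (w * 1) by ring. rewrite <- (seed_wronsk mu x). apply W.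
    - intros x Hx. destruct (B1 x Hx). pose proof (exp_pos (- mu * x)). nra.
    - intros x Hx. destruct (B1 x Hx). pose proof (exp_pos (- mu * x)). nra.
    - intros x Hx. destruct (B2 x Hx). pose proof (exp_pos (mu * x)). nra. }
  destruct (V1_sol s l Hs) as [F' [D D']]. cbn [fst snd] in D, D'. fold mu in D'.
  destruct (V1_bounded s l Hs) as [B HB].
  assert (QB : forall x, Rabs (QV mu (mu + INR l) x) <= mu ^ 2 + (mu + INR l) * (mu + INR l + 1)).
  { intros x. unfold QV. pose proof (sech_pos x). pose proof (sech_le_1 x). pose proof (pos_INR l).
    assert (0 <= sech x ^ 2 <= 1) by nra.
    assert (0 <= (mu + INR l) * (mu + INR l + 1)) by nra.
    pose proof (pow2_ge_0 mu). apply Rabs_le. split; nra. }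
  set (M := mu ^ 2 + (mu + INR l) * (mu + INR l + 1)) in QB.
  assert (M0 : 0 <= M) by (eapply Rle_trans; [apply Rabs_pos|apply (QB 0)]).
  assert (B0 : 0 <= B) by (eapply Rle_trans; [apply Rabs_pos|apply (HB 0)]).
  assert (BF : forall x, 0 <= x -> Rabs (F' x) <= 3 * (B + M * B)).
  { apply (derive_bounded (V1 s l) F' (fun x => QV mu (mu + INR l) x * V1 s l x)).
    - apply D.
    - apply D'.
    - intros x _. specialize (HB x). nra.
    - intros x _. rewrite Rabs_mult. assert (Rabs (QV mu (mu + INR l) x) * Rabs (V1 s l x) <= M * B)
        by (apply Rmult_le_compat; auto using Rabs_pos). lra. }
  (* The coefficient for which V1 - lam P satisfies the condition at 0 in [green_repr]; with zero
     source this difference must then vanish. *)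
  set (lam := - (fst q 0 * F' 0 - snd q 0 * V1 s l 0) / w).
  assert (W0 := fs_W FS 0).
  assert (EV : forall x, V1 s l x - lam * fst P x = green (fst P) (fst q) w (fun _ => 0) x).
  { refine (proj2 (green_repr FS (fun x => V1 s l x - lam * fst P x)
      (fun x => F' x - lam * snd P x) (fun _ => 0)
      (3 * (B + M * B) + Rabs lam * C1) (cts_const 0) _ _ _ _) _).
    - intros x. assert (D1 := D x). assert (D2 := proj1 SP x). auto_derive; [dside|].
      dsub D1. dsub D2. ring.
    - intros x. assert (D1 := D' x). assert (D2 := proj2 SP x). auto_derive; [dside|].
      dsub D1. dsub D2. ring.
    - intros x Hx. eapply Rle_trans; [apply Rabs_triang|]. rewrite Rabs_Ropp, Rabs_mult.
      destruct (B1 x Hx) as [H1 _].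
      assert (exp (- mu * x) <= 1) by (rewrite <- exp_0; apply exp_le_compat; nra).
      assert (Rabs lam * Rabs (fst P x) <= Rabs lam * C1).
      { apply Rmult_le_compat_l; [apply Rabs_pos|]. nra. }
      specialize (HB x). nra.
    - intros x Hx. eapply Rle_trans; [apply Rabs_triang|]. rewrite Rabs_Ropp, Rabs_mult.
      destruct (B1 x Hx) as [_ H1].
      assert (exp (- mu * x) <= 1) by (rewrite <- exp_0; apply exp_le_compat; nra).
      assert (Rabs lam * Rabs (snd P x) <= Rabs lam * C1).
      { apply Rmult_le_compat_l; [apply Rabs_pos|]. nra. }
      specialize (BF x Hx). lra.
    - cbv beta. transitivity ((fst q 0 * F' 0 - snd q 0 * V1 s l 0)
        + lam * (fst P 0 * snd q 0 - snd P 0 * fst q 0)); [ring|].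
      rewrite W0. unfold lam. field. exact Hw. }
  assert (EV' : forall x, V1 s l x = lam * fst P x).
  { intros x. specialize (EV x). unfold green in EV.
    rewrite (I0_ext _ (fun _ => 0)) in EV by (intros; ring).
    rewrite (RInt_ext (fun y => fst P y * 0) (fun _ => 0)) in EV by (intros; simpl; ring).
    rewrite (RInt_ext (fun y => fst q y * 0) (fun _ => 0)) in EV by (intros; simpl; ring).
    assert (Z : conv (fun _ => 0) /\ I0 (fun _ => 0) = 0 - 0).
    { apply (conv_FTC (fun _ => 0) (fun _ => 0) 0 (cts_const 0)).
      - intros; apply @is_derive_const.
      - apply is_lim_const. }
    rewrite (proj2 Z) in EV. rewrite !RInt_const in EV.
    unfold scal in EV; simpl in EV; unfold mult in EV; simpl in EV.
    replace (lam * fst P x) with (V1 s l x - (V1 s l x - lam * fst P x)) by ring.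
    rewrite EV. field. exact Hw. }
  assert (Hl : lam <> 0).
  { intros E. destruct (V1_nonzero s l Hs) as [x Hx]. apply Hx. rewrite EV', E. ring. }
  exists (fun x => lam * snd P x), (fst q), (snd q), ((C1 + C2) * (1 + Rabs lam)), (lam * w).
  pose proof (Rabs_pos lam).
  split; [|split].
  - assert (X : forall u e, 0 <= e -> Rabs u <= (C1 + C2) * e -> Rabs (lam * u) <= (C1 + C2) * (1 + Rabs lam) * e).
    { intros u e He Hu. rewrite Rabs_mult. pose proof (Rabs_pos u).
      assert (Rabs lam * Rabs u <= Rabs lam * ((C1 + C2) * e)) by (apply Rmult_le_compat_l; lra).
      assert (0 <= (C1 + C2) * e) by lra. lra. }
    destruct FS as [F1 F2 F3 F4 F5 F6 F7 F8 F9 F10 F11 F12].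
    split; try easy.
    + apply Rmult_le_pos; lra.
    + now apply Rmult_integral_contrapositive_currified.
    + intros x. apply (is_derive_ext (fun x => lam * fst P x)); [intros; now rewrite EV'|].
      apply (is_derive_scal (fst P)). apply F5.
    + intros x. rewrite EV'. replace (QV mu (mu + INR l) x * (lam * fst P x))
        with (lam * (QV mu (mu + INR l) x * fst P x)) by ring.
      apply (is_derive_scal (snd P)). apply F6.
    + intros x. rewrite EV', <- (F9 x). ring.
    + intros x Hx. rewrite EV'. apply X; [left; apply exp_pos|auto].
    + intros x Hx. apply X; [left; apply exp_pos|auto].
    + intros x Hx. specialize (F12 x Hx). pose proof (exp_pos (mu * x)).
      assert (0 <= Rabs lam * ((C1 + C2) * exp (mu * x))).
      { apply Rmult_le_pos; [easy|]. apply Rmult_le_pos; lra. }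
      lra.
  - intros x. rewrite !EV', PP. unfold psign. ring.
  - intros x. rewrite Pq. unfold psign. ring.
Qed.

(** * Polynomial estimates and the contraction principle *)

Definition wt (r : R) (b : bool) : R := if b then r else 1.

Definition near_env (D r : R) (e e' : nat -> R) : Prop :=
  forall i, Rabs (e i - e' i) <= D * wt r (2 <=? i)%nat.

Definition bounded_env (K r : R) (e : nat -> R) : Prop :=
  forall i, Rabs (e i) <= K * wt r (2 <=? i)%nat.

(* Variables 0 and 1 are scalars; the others are values of functions that are
   small of order r.  The flag b records whether F inherits the factor r. *)
Definition tame (b : bool) (F : (nat -> R) -> R) : Prop :=
  forall K, 0 <= K -> exists L, 0 <= L /\ forall r D e e',
    0 <= r <= 1 -> 0 <= D -> bounded_env K r e -> bounded_env K r e' -> near_env D r e e' ->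
    Rabs (F e) <= L * wt r b /\ Rabs (F e - F e') <= L * D * wt r b.

Lemma wt_pos (r : R) (b : bool) : 0 <= r <= 1 -> 0 <= wt r b <= 1.
Proof. destruct b; simpl; lra. Qed.

Lemma tame_var (i : nat) : tame (2 <=? i)%nat (fun e => e i).
Proof.
  intros K HK. exists (K + 1). split; [lra|]. intros r D e e' Hr HD He He' Hn.
  assert (W := wt_pos r (2 <=? i)%nat Hr). specialize (He i). specialize (Hn i).
  split; [nra|]. assert (0 <= K * (D * wt r (2 <=? i)%nat)) by (apply Rmult_le_pos; [lra|nra]).
  lra.
Qed.

Lemma tame_const (c : R) : tame false (fun _ => c).
Proof.
  intros K HK. exists (Rabs c). split; [apply Rabs_pos|]. intros r D e e' Hr HD _ _ _.
  simpl. rewrite Rminus_diag, Rabs_R0. pose proof (Rabs_pos c). split; [lra|].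
  rewrite Rmult_1_r. now apply Rmult_le_pos.
Qed.

Lemma tame_plus (b : bool) (F G : (nat -> R) -> R) :
  tame b F -> tame b G -> tame b (fun e => F e + G e).
Proof.
  intros HF HG K HK. destruct (HF K HK) as [L1 [P1 B1]]. destruct (HG K HK) as [L2 [P2 B2]].
  exists (L1 + L2). split; [lra|]. intros r D e e' Hr HD He He' Hn.
  destruct (B1 r D e e' Hr HD He He' Hn) as [A1 A2].
  destruct (B2 r D e e' Hr HD He He' Hn) as [A3 A4]. split.
  - eapply Rle_trans; [apply Rabs_triang|]. lra.
  - replace (F e + G e - (F e' + G e')) with ((F e - F e') + (G e - G e')) by ring.
    eapply Rle_trans; [apply Rabs_triang|]. lra.
Qed.

(** Flags combine by disjunction because r <= 1: two factors r are bounded by one. The difference is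
    split as (F - F') G + F' (G - G'). *)
Lemma tame_mult (b c : bool) (F G : (nat -> R) -> R) :
  tame b F -> tame c G -> tame (b || c) (fun e => F e * G e).
Proof.
  intros HF HG K HK. destruct (HF K HK) as [L1 [P1 B1]]. destruct (HG K HK) as [L2 [P2 B2]].
  assert (P12 : 0 <= L1 * L2) by now apply Rmult_le_pos.
  exists (2 * (L1 * L2)). split; [lra|]. intros r D e e' Hr HD He He' Hn.
  destruct (B1 r D e e' Hr HD He He' Hn) as [A1 A2].
  destruct (B2 r D e e' Hr HD He He' Hn) as [A3 A4].
  destruct (B1 r D e' e Hr HD He' He) as [A1' _].
  { intros i. rewrite Rabs_minus_sym. apply Hn. }
  assert (Wb := wt_pos r b Hr). assert (Wc := wt_pos r c Hr).
  assert (W : wt r b * wt r c <= wt r (b || c)) by (destruct b, c; simpl; nra).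
  assert (Wp : 0 <= wt r b * wt r c) by nra.
  assert (W' := wt_pos r (b || c) Hr). split.
  - rewrite Rabs_mult.
    assert (Rabs (F e) * Rabs (G e) <= (L1 * wt r b) * (L2 * wt r c))
      by (apply Rmult_le_compat; auto using Rabs_pos).
    assert (L1 * L2 * (wt r b * wt r c) <= L1 * L2 * wt r (b || c)) by (apply Rmult_le_compat_l; lra).
    assert (0 <= L1 * L2 * wt r (b || c)) by (apply Rmult_le_pos; lra). lra.
  - replace (F e * G e - F e' * G e') with ((F e - F e') * G e + F e' * (G e - G e')) by ring.
    eapply Rle_trans; [apply Rabs_triang|]. rewrite !Rabs_mult.
    assert (Rabs (F e - F e') * Rabs (G e) <= (L1 * D * wt r b) * (L2 * wt r c))
      by (apply Rmult_le_compat; auto using Rabs_pos).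
    assert (Rabs (F e') * Rabs (G e - G e') <= (L1 * wt r b) * (L2 * D * wt r c))
      by (apply Rmult_le_compat; auto using Rabs_pos).
    assert (L1 * L2 * D * (wt r b * wt r c) <= L1 * L2 * D * wt r (b || c)).
    { apply Rmult_le_compat_l; [|lra]. apply Rmult_le_pos; lra. }
    lra.
Qed.

(** The flag of a product does not determine those of its factors, so the three possibilities are
    tried. The trailing [fail] acts only on remaining goals and so accepts an alternative only if it
    closes everything. *)
Ltac tame_tac :=
  lazymatch goal with
  | |- tame _ (fun e => @?f e + @?g e) => apply (tame_plus _ f g); tame_tac
  | |- tame true (fun e => @?f e * @?g e) =>
      first [ apply (tame_mult false true f g); tame_tac; fail
            | apply (tame_mult true false f g); tame_tac; fail
            | apply (tame_mult true true f g); tame_tac; fail ]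
  | |- tame false (fun e => @?f e * @?g e) => apply (tame_mult false false f g); tame_tac
  | |- tame _ (fun e => e ?i) => exact (tame_var i)
  | |- tame false (fun _ => ?c) => exact (tame_const c)
  end.

(** Slots 0 and 1 hold scalars; then come the values at a point of the two corrections, of [V1] and
    of [U0]. All indices from 5 on repeat the last slot, so conditions over all [i] reduce to
    six. *)
Definition env (t b u w v y : R) (i : nat) : R :=
  match i with 0%nat => t | 1%nat => b | 2%nat => u | 3%nat => w | 4%nat => v | _ => y end.

Lemma bounded_env_intro (K r t b u w v y : R) :
  Rabs t <= K -> Rabs b <= K -> Rabs u <= K * r -> Rabs w <= K * r -> Rabs v <= K * r ->
  Rabs y <= K * r -> bounded_env K r (env t b u w v y).
Proof. intros H0 H1 H2 H3 H4 H5 [|[|[|[|[|i]]]]]; simpl; lra. Qed.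

Lemma near_env_intro (D r t b u w v y t' b' u' w' : R) : 0 <= D -> 0 <= r ->
  Rabs (t - t') <= D -> Rabs (b - b') <= D -> Rabs (u - u') <= D * r -> Rabs (w - w') <= D * r ->
  near_env D r (env t b u w v y) (env t' b' u' w' v y).
Proof.
  intros HD Hr H0 H1 H2 H3. assert (0 <= D * r) by now apply Rmult_le_pos.
  intros [|[|[|[|[|i]]]]]; simpl; rewrite ?Rminus_diag, ?Rabs_R0; lra.
Qed.

(** Weighted supremum distance at most [D], as a relation: no supremum has to exist and no metric
    space is built. *)
Definition wdist {I : Type} (om : I -> R) (D : R) (X Y : I -> R) : Prop :=
  forall i, Rabs (X i - Y i) <= D * om i.

(** Banach's principle with ratio 1/2. Limits are taken coordinatewise; the geometric bound is
    uniform in the weighted distance, so the closedness of [A] applies to the limit. *)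
Lemma contraction (I : Type) (om : I -> R) (A : (I -> R) -> Prop)
  (Phi : (I -> R) -> I -> R) (X0 : I -> R) (d0 : R) :
  (forall i, 0 <= om i) -> A X0 -> (forall X, A X -> A (Phi X)) ->
  (forall X Y d, 0 <= d -> A X -> A Y -> wdist om d X Y -> wdist om (d / 2) (Phi X) (Phi Y)) ->
  (forall (Xn : nat -> I -> R) X, (forall n, A (Xn n)) ->
     (forall e, 0 < e -> exists n, wdist om e (Xn n) X) -> A X) ->
  0 <= d0 -> wdist om d0 X0 (Phi X0) ->
  exists X, A X /\ forall i, Phi X i = X i.
Proof.
  intros Hom A0 AP C Cl Hd0 D0.
  set (Xn := fun n : nat => Nat.iter n Phi X0).
  assert (An : forall n, A (Xn n)) by (induction n; simpl; auto).
  assert (P2 : forall n, 0 < (/ 2) ^ n) by (intros; apply pow_lt; lra).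
  assert (D1 : forall n, wdist om (d0 * (/ 2) ^ n) (Xn n) (Xn (S n))).
  { induction n as [|n IH].
    - simpl. now rewrite Rmult_1_r.
    - replace (d0 * (/ 2) ^ S n) with (d0 * (/ 2) ^ n / 2) by (simpl; field).
      apply C; auto. specialize (P2 n). nra. }
  assert (D2 : forall k n, wdist om (2 * d0 * (/ 2) ^ n - 2 * d0 * (/ 2) ^ (k + n)) (Xn n) (Xn (k + n)%nat)).
  { induction k as [|k IH]; intros n i.
    - simpl. rewrite !Rminus_diag, Rabs_R0. lra.
    - replace (Xn n i - Xn (S k + n)%nat i) with ((Xn n i - Xn (k + n)%nat i) + (Xn (k + n)%nat i - Xn (S (k + n)) i)) by (simpl; ring).
      eapply Rle_trans; [apply Rabs_triang|]. specialize (IH n i). specialize (D1 (k + n)%nat i).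
      simpl pow. lra. }
  assert (D3 : forall n m, (n <= m)%nat -> wdist om (2 * d0 * (/ 2) ^ n) (Xn n) (Xn m)).
  { intros n m H i. specialize (D2 (m - n)%nat n i). replace (m - n + n)%nat with m in D2 by lia.
    specialize (P2 m). assert (0 <= 2 * d0 * (/ 2) ^ m * om i); [|lra].
    apply Rmult_le_pos; [|apply Hom]. apply Rmult_le_pos; lra. }
  assert (small : forall c e, 0 < e -> exists n, c * (/ 2) ^ n < e).
  { intros c e He. destruct (pow_lt_1_zero (/ 2) ltac:(rewrite Rabs_pos_eq; lra) (e / (Rabs c + 1))) as [n Hn].
    - apply Rdiv_lt_0_compat; [easy|]. pose proof (Rabs_pos c). lra.
    - exists n. specialize (Hn n ltac:(lia)). rewrite Rabs_pos_eq in Hn by (left; apply P2).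
      specialize (P2 n). pose proof (Rle_abs c). pose proof (Rabs_pos c).
      apply Rle_lt_trans with ((Rabs c + 1) * (/ 2) ^ n); [nra|].
      apply Rmult_lt_reg_r with (/ (Rabs c + 1)); [apply Rinv_0_lt_compat; lra|].
      replace ((Rabs c + 1) * (/ 2) ^ n * / (Rabs c + 1)) with ((/ 2) ^ n) by (field; lra). exact Hn. }
  assert (Lim : forall i, exists l : R, is_lim_seq (fun n => Xn n i) l).
  { intros i. apply ex_lim_seq_cauchy_corr. intros [e He]. simpl.
    destruct (small (4 * d0 * om i) e He) as [N HN]. exists N.
    assert (W : forall n, (N <= n)%nat -> Rabs (Xn N i - Xn n i) <= 2 * d0 * (/ 2) ^ N * om i)
      by (intros n Hn; now apply D3).
    intros n m Hn Hm. assert (W1 := W n Hn). assert (W2 := W m Hm).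
    apply Rabs_le_between in W1, W2. apply Rabs_def1; lra. }
  set (X := fun i => real (Lim_seq (fun n => Xn n i))).
  assert (LX : forall i, is_lim_seq (fun n => Xn n i) (X i)).
  { intros i. unfold X. destruct (Lim i) as [l Hl]. now rewrite (is_lim_seq_unique _ _ Hl). }
  assert (D4 : forall n, wdist om (2 * d0 * (/ 2) ^ n) (Xn n) X).
  { intros n i. rewrite Rabs_minus_sym.
    assert (H : is_lim_seq (fun m => Rabs (Xn m i - Xn n i)) (Rabs (X i - Xn n i))).
    { apply (is_lim_seq_abs _ (X i - Xn n i)). apply is_lim_seq_minus'; [apply LX|apply is_lim_seq_const]. }
    refine (is_lim_seq_le_loc _ _ _ (2 * d0 * (/ 2) ^ n * om i) _ H (is_lim_seq_const _)).
    exists n. intros m Hm. rewrite Rabs_minus_sym. now apply D3. }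
  assert (AX : A X).
  { apply (Cl Xn X An). intros e He. destruct (small (2 * d0) e He) as [n Hn]. exists n.
    intros i. specialize (D4 n i). specialize (Hom i). nra. }
  exists X. split; [exact AX|]. intros i.
  apply Rminus_diag_uniq. destruct (Req_dec (Phi X i - X i) 0) as [|Hne]; [easy|exfalso].
  destruct (small (3 * d0 * om i) (Rabs (Phi X i - X i))) as [n Hn]; [now apply Rabs_pos_lt|].
  assert (E1 := C (Xn n) X (2 * d0 * (/ 2) ^ n) ltac:(specialize (P2 n); nra) (An n) AX (D4 n) i).
  assert (E2 := D4 (S n) i). change (Phi (Xn n) i) with (Xn (S n) i) in E1. simpl pow in E2.
  apply Rabs_le_between in E1, E2.
  assert (Rabs (Phi X i - X i) <= 3 * d0 * om i * (/ 2) ^ n); [|lra].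
  specialize (P2 n). specialize (Hom i).
  assert (0 <= d0 * (/ 2) ^ n * om i) by (apply Rmult_le_pos; [nra|easy]).
  apply Rabs_le. lra.
Qed.

Lemma split_tame (F0 F : (nat -> R) -> R) (K : R) : 0 <= K -> tame true F0 -> tame true F ->
  exists L, 0 <= L /\
  forall r d dz t b u w t' b' u' w' z z' v y, 0 <= r <= 1 -> 0 <= d -> 0 <= dz -> 0 <= t <= 1 -> 0 <= t' <= 1 ->
  Rabs b <= K -> Rabs b' <= K -> Rabs u <= K * r -> Rabs u' <= K * r ->
  Rabs w <= K * r -> Rabs w' <= K * r -> Rabs z <= K * r -> Rabs z' <= K * r ->
  Rabs v <= K * r -> Rabs y <= K * r ->
  Rabs (b - b') <= d -> Rabs (u - u') <= d * r -> Rabs (w - w') <= d * r -> Rabs (z - z') <= dz * r ->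
  let G t b u w z := F0 (env 0 0 z 0 v y) + t * F (env t b u w v y) in
  Rabs (G t b u w z) <= L * r /\
  Rabs (G t b u w z - G t' b' u' w' z') <= L * (dz + t * d + Rabs (t - t')) * r.
Proof.
  intros HK T0 T. destruct (T (K + 1) ltac:(lra)) as [L [PL HL]].
  destruct (T0 (K + 1) ltac:(lra)) as [L0 [PL0 HL0]].
  exists (2 * L + L0). split; [lra|].
  intros r d dz t b u w t' b' u' w' z z' v y Hr Hd Hdz Ht Ht' Hb Hb' Hu Hu' Hw Hw' Hz Hz' Hv Hy Db Du Dw Dz G.
  set (D := d + Rabs (t - t')).
  assert (Pt := Rabs_pos (t - t')). assert (PD : 0 <= D) by (unfold D; lra).
  (* The constant K + 1 is taken so that it also bounds t, which occupies slot 0 and is at most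
     1. *)
  assert (Kr : 0 <= K * r <= (K + 1) * r) by nra.
  assert (Dr : d * r <= D * r) by (unfold D; nra).
  assert (B : bounded_env (K + 1) r (env t b u w v y))
    by (apply bounded_env_intro; try rewrite (Rabs_pos_eq t); lra).
  assert (B' : bounded_env (K + 1) r (env t' b' u' w' v y))
    by (apply bounded_env_intro; try rewrite (Rabs_pos_eq t'); lra).
  assert (Hn : near_env D r (env t b u w v y) (env t' b' u' w' v y))
    by (apply near_env_intro; unfold D in *; lra).
  assert (Hn' : near_env D r (env t' b' u' w' v y) (env t b u w v y))
    by (intros i; rewrite Rabs_minus_sym; apply Hn).
  destruct (HL r D _ _ Hr PD B B' Hn) as [A1 A2]. destruct (HL r D _ _ Hr PD B' B Hn') as [A1' _].
  destruct (HL0 r dz (env 0 0 z 0 v y) (env 0 0 z' 0 v y) Hr Hdz) as [A3 A4].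
  1, 2: apply bounded_env_intro; rewrite ?Rabs_R0; lra.
  { assert (0 <= dz * r) by (apply Rmult_le_pos; lra).
    apply near_env_intro; rewrite ?Rminus_diag, ?Rabs_R0; lra. }
  unfold G. cbn [wt] in *. split.
  - eapply Rle_trans; [apply Rabs_triang|]. rewrite Rabs_mult, (Rabs_pos_eq t) by lra.
    pose proof (Rabs_pos (F (env t b u w v y))).
    assert (t * Rabs (F (env t b u w v y)) <= 1 * (L * r)) by (apply Rmult_le_compat; lra). lra.
  - replace (_ - _) with ((F0 (env 0 0 z 0 v y) - F0 (env 0 0 z' 0 v y))
      + t * (F (env t b u w v y) - F (env t' b' u' w' v y)) + (t - t') * F (env t' b' u' w' v y)) by ring.
    eapply Rle_trans; [apply Rabs_triang|]. eapply Rle_trans; [apply Rplus_le_compat_r, Rabs_triang|].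
    rewrite !Rabs_mult, (Rabs_pos_eq t) by lra.
    set (a := Rabs (F _ - F _)) in *. set (a' := Rabs (F (env t' _ _ _ _ _))) in *.
    assert (Lr : 0 <= L * r) by (apply Rmult_le_pos; lra). assert (L0r : 0 <= L0 * r) by (apply Rmult_le_pos; lra).
    assert (X1 : t * a <= t * (L * D * r)) by (apply Rmult_le_compat_l; lra).
    assert (X2 : Rabs (t - t') * a' <= Rabs (t - t') * (L * r)) by (apply Rmult_le_compat_l; lra).
    assert (X3 : L * r * (t * Rabs (t - t')) <= L * r * (1 * Rabs (t - t'))).
    { apply Rmult_le_compat_l; [easy|]. apply Rmult_le_compat_r; lra. }
    assert (Y : 0 <= t * d) by (apply Rmult_le_pos; lra).
    assert (X4 : 0 <= L * r * (2 * dz + t * d)) by (apply Rmult_le_pos; lra).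
    assert (X5 : 0 <= L0 * r * (t * d + Rabs (t - t'))) by (apply Rmult_le_pos; lra).
    unfold D in X1. lra.
Qed.

(** * The rescaled nonlinear terms *)

Section Polynomials.
Variables (bc beta2 : R).

Definition beta_ (t b : R) : R := bc + t * b.
(** Inserting U0 + t u and e (v + t w) into the first equation and dividing by t gives u'' = (1 - 3
    y^2) u - N, with y the value of [U0]. *)
Definition Npoly (t b u w v y : R) : R :=
  beta_ t b * (v + t * w) ^ 2 * y
  + t * (3 * y * u ^ 2 + t * u ^ 3 + beta_ t b * (v + t * w) ^ 2 * u).
(** The second equation divided by e t reads w'' = QV w - (b y^2 v + H). The term b y^2 v is kept
    apart because it is the one used to meet the solvability condition. *)
Definition Hpoly (t b u w v y : R) : R :=
  2 * beta_ t b * y * u * (v + t * w) + t * beta_ t b * u ^ 2 * (v + t * w)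
  + beta2 * (v + t * w) ^ 3 + t * b * y ^ 2 * w.

(** The polynomials are split as value at t = 0 plus t times a rest, expanded into sums and products
    of slots so that [tame_tac] can read off the factor r. *)
Let N1 (e : nat -> R) : R :=
  (e 1%nat * e 4%nat * e 4%nat + (bc + e 0%nat * e 1%nat) * (2 * e 4%nat * e 3%nat + e 0%nat * e 3%nat * e 3%nat)) * e 5%nat
  + (3 * e 5%nat * e 2%nat * e 2%nat + e 0%nat * e 2%nat * e 2%nat * e 2%nat
  + (bc + e 0%nat * e 1%nat) * ((e 4%nat + e 0%nat * e 3%nat) * ((e 4%nat + e 0%nat * e 3%nat) * e 2%nat))).

Let H1 (e : nat -> R) : R :=
  2 * e 1%nat * e 5%nat * e 2%nat * e 4%nat + 2 * (bc + e 0%nat * e 1%nat) * e 5%nat * e 2%nat * e 3%nat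
  + (bc + e 0%nat * e 1%nat) * (e 2%nat * e 2%nat * (e 4%nat + e 0%nat * e 3%nat))
  + beta2 * (3 * e 4%nat * e 4%nat * e 3%nat + 3 * e 0%nat * e 4%nat * e 3%nat * e 3%nat + e 0%nat * e 0%nat * e 3%nat * e 3%nat * e 3%nat)
  + e 1%nat * e 5%nat * e 5%nat * e 3%nat.

Let N0 (e : nat -> R) : R := bc * (e 4%nat * e 4%nat * e 5%nat).
Let H0 (e : nat -> R) : R :=
  2 * bc * (e 5%nat * e 4%nat * e 2%nat) + beta2 * (e 4%nat * e 4%nat * e 4%nat).

Lemma Npoly_tame (K : R) : 0 <= K -> exists L, 0 <= L /\
  forall r d t b u w t' b' u' w' v y, 0 <= r <= 1 -> 0 <= d -> 0 <= t <= 1 -> 0 <= t' <= 1 ->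
  Rabs b <= K -> Rabs b' <= K -> Rabs u <= K * r -> Rabs u' <= K * r ->
  Rabs w <= K * r -> Rabs w' <= K * r -> Rabs v <= K * r -> Rabs y <= K * r ->
  Rabs (b - b') <= d -> Rabs (u - u') <= d * r -> Rabs (w - w') <= d * r ->
  Rabs (Npoly t b u w v y) <= L * r /\
  Rabs (Npoly t b u w v y - Npoly t' b' u' w' v y) <= L * (t * d + Rabs (t - t')) * r.
Proof.
  intros HK. destruct (split_tame N0 N1 K) as [L [PL HL]]; [easy|unfold N0; tame_tac|unfold N1; tame_tac|].
  exists L. split; [easy|].
  intros r d t b u w t' b' u' w' v y Hr Hd Ht Ht' Hb Hb' Hu Hu' Hw Hw' Hv Hy Db Du Dw.
  assert (E : forall t b u w, Npoly t b u w v y = N0 (env 0 0 0 0 v y) + t * N1 (env t b u w v y)).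
  { intros. unfold Npoly, beta_, N0, N1; cbn [env]. ring. }
  assert (Z : Rabs 0 <= K * r) by (rewrite Rabs_R0; apply Rmult_le_pos; lra).
  rewrite !E. replace (t * d + Rabs (t - t')) with (0 + t * d + Rabs (t - t')) by ring.
  apply HL; auto; try lra. rewrite Rminus_diag, Rabs_R0; lra.
Qed.

(** The variable [u] has a separate distance [du], since H depends on it already at t = 0. *)
Lemma Hpoly_tame (K : R) : 0 <= K -> exists L, 0 <= L /\
  forall r d du t b u w t' b' u' w' v y, 0 <= r <= 1 -> 0 <= d -> 0 <= du -> 0 <= t <= 1 -> 0 <= t' <= 1 ->
  Rabs b <= K -> Rabs b' <= K -> Rabs u <= K * r -> Rabs u' <= K * r ->
  Rabs w <= K * r -> Rabs w' <= K * r -> Rabs v <= K * r -> Rabs y <= K * r ->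
  Rabs (b - b') <= d -> Rabs (u - u') <= du * r -> Rabs (w - w') <= d * r ->
  Rabs (Hpoly t b u w v y) <= L * r /\
  Rabs (Hpoly t b u w v y - Hpoly t' b' u' w' v y) <= L * (du + t * d + Rabs (t - t')) * r.
Proof.
  intros HK. destruct (split_tame H0 H1 K) as [L [PL HL]]; [easy|unfold H0; tame_tac|unfold H1; tame_tac|].
  exists (2 * L). split; [lra|].
  intros r d du t b u w t' b' u' w' v y Hr Hd Hdu Ht Ht' Hb Hb' Hu Hu' Hw Hw' Hv Hy Db Du Dw.
  assert (E : forall t b u w, Hpoly t b u w v y = H0 (env 0 0 u 0 v y) + t * H1 (env t b u w v y)).
  { intros. unfold Hpoly, beta_, H0, H1; cbn [env]. ring. }
  assert (P1 : 0 <= du * r) by (apply Rmult_le_pos; lra).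
  assert (P2 : 0 <= d * r) by (apply Rmult_le_pos; lra).
  destruct (HL r (d + du) du t b u w t' b' u' w' u u' v y) as [A1 A2]; auto; try lra.
  rewrite !E. assert (Pr : 0 <= L * r) by (apply Rmult_le_pos; lra). split; [lra|].
  eapply Rle_trans; [apply A2|].
  assert (0 <= t * d) by (apply Rmult_le_pos; lra). pose proof (Rabs_pos (t - t')).
  assert (t * du <= 1 * du) by (apply Rmult_le_compat_r; lra).
  replace (2 * L * (du + t * d + Rabs (t - t')) * r) with (L * r * (2 * (du + t * d + Rabs (t - t')))) by ring.
  replace (L * (du + t * (d + du) + Rabs (t - t')) * r) with (L * r * (du + t * (d + du) + Rabs (t - t'))) by ring.
  apply Rmult_le_compat_l; lra.
Qed.

End Polynomials.

(** * The bifurcating branch *)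

Lemma cts_Npoly (bc t b : R) (u w v y : R -> R) : cts u -> cts w -> cts v -> cts y ->
  cts (fun x => Npoly bc t b (u x) (w x) (v x) (y x)).
Proof. intros. unfold Npoly, beta_. cts_tac. Qed.

Lemma cts_Hpoly (bc b2 t b : R) (u w v y : R -> R) : cts u -> cts w -> cts v -> cts y ->
  cts (fun x => Hpoly bc b2 t b (u x) (w x) (v x) (y x)).
Proof. intros. unfold Hpoly, beta_. cts_tac. Qed.

Lemma cts_U0 : cts U0.
Proof. unfold U0. pose proof cts_sech. cts_tac. Qed.

Lemma U0_even (x : R) : U0 (- x) = U0 x.
Proof. unfold U0. now rewrite sech_even. Qed.

Lemma U0_pos (x : R) : 0 < U0 x.
Proof. apply Rmult_lt_0_compat; [apply sqrt_lt_R0; lra|apply sech_pos]. Qed.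

Lemma abs_sign (sg : R) : sg * sg = 1 -> Rabs sg = 1.
Proof.
  intros Hs. assert (E : Rabs sg * Rabs sg = 1) by (rewrite <- Rabs_mult, Hs; apply Rabs_R1).
  pose proof (Rabs_pos sg). nra.
Qed.

Lemma abs_parity (sg : R) (f : R -> R) (x : R) : sg * sg = 1 -> parity sg f ->
  Rabs (f (- x)) = Rabs (f x).
Proof. intros Hs P. rewrite P, Rabs_mult, abs_sign by easy. ring. Qed.

Definition rho (k x : R) : R := exp (- k * Rabs x).

Lemma rho_right (k x : R) : 0 <= x -> rho k x = exp (- k * x).
Proof. intros H. unfold rho. now rewrite Rabs_pos_eq. Qed.

Lemma rho_bounds (k x : R) : 0 <= k -> 0 < rho k x <= 1.
Proof.
  intros H. unfold rho. split; [apply exp_pos|]. rewrite <- exp_0. apply exp_le_compat.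
  pose proof (Rabs_pos x). nra.
Qed.

Lemma rho_even (k x : R) : rho k (- x) = rho k x.
Proof. unfold rho. now rewrite Rabs_Ropp. Qed.

Lemma extend_by_parity (sg k C : R) (f : R -> R) : sg * sg = 1 -> parity sg f ->
  (forall x, 0 <= x -> Rabs (f x) <= C * exp (- k * x)) ->
  forall x, Rabs (f x) <= C * rho k x.
Proof.
  intros Hs P H x. destruct (Rle_dec 0 x) as [Hx|Hx].
  - rewrite rho_right by easy. now apply H.
  - rewrite <- rho_even, <- (abs_parity sg f x Hs P), rho_right by lra. apply H. lra.
Qed.

Lemma parity_minus (sg : R) (f g : R -> R) : parity sg f -> parity sg g ->
  parity sg (fun x => f x - g x).
Proof. intros F G x. rewrite F, G. ring. Qed.

(** The primitive increases towards the integral. If that limit were 0, the primitive would vanish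
    for x >= 0, by parity everywhere, and so would its derivative [f]. *)
Lemma I0_pos (f : R -> R) (x0 : R) : conv f -> parity 1 f -> (forall x, 0 <= f x) ->
  f x0 <> 0 -> 0 < I0 f.
Proof.
  intros [F L] P Pos Hx. set (G := RInt f 0 : R -> R).
  assert (D : forall x, is_derive G x (f x)) by (intros; now apply is_derive_prim).
  assert (Mono : forall a b, a <= b -> G a <= G b).
  { intros a b Hab. apply (monotone_of_derive G f); auto. }
  assert (G0 : G 0 = 0) by apply RInt_00.
  assert (LB : forall x, 0 <= x -> G x <= I0 f).
  { intros x H. assert (- I0 f <= - G x); [|lra].
    apply (is_lim_infty_le (fun y => - G y) (- I0 f) (- G x) x).
    - apply (is_lim_opp (RInt f 0) p_infty (I0 f) L).
    - intros y Hy. specialize (Mono x y Hy). lra. }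
  destruct (Rle_lt_or_eq_dec 0 (I0 f)) as [H|H]; [|easy|exfalso].
  { specialize (LB 0 ltac:(lra)). lra. }
  assert (Z : forall x, G x = 0).
  { assert (Z0 : forall x, 0 <= x -> G x = 0).
    { intros x Hx'. specialize (LB x Hx'). specialize (Mono 0 x Hx'). lra. }
    intros x. destruct (Rle_dec 0 x) as [Hx'|Hx']; [now apply Z0|].
    assert (E := RInt_parity 1 f x F P). fold G in E. specialize (Z0 (- x) ltac:(lra)).
    change (G (- x) = - (1) * G x) in E. lra. }
  apply Hx. rewrite <- (is_derive_unique _ _ _ (D x0)).
  rewrite (Derive_ext G (fun _ => 0)) by apply Z. apply Derive_const.
Qed.

(** * Variation of constants on functions of given parity *)

Section GreenParity.
Variables (Q p p' q q' : R -> R) (mu C w sg tau k : R).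
Hypothesis S : fsys Q p p' q q' mu C w.
Hypothesis Hs : sg * sg = 1.
Hypothesis Pp : parity sg p.
Hypothesis Pq : parity (- sg) q.
Hypothesis Hk : 0 <= k < mu.

Definition good_source (g : R -> R) : Prop :=
  cts g /\ parity tau g /\ (tau = - sg \/ tau = sg /\ I0 (fun y => p y * g y) = 0).

Lemma green_good (g : R -> R) (K : R) : good_source g ->
  (forall x, Rabs (g x) <= K * rho k x) ->
  cts (green p q w g) /\ parity tau (green p q w g) /\
  forall x, Rabs (green p q w g x) <= green_const mu C w k * K * rho k x.
Proof.
  intros [G [Pg Ht]] B.
  assert (Pt : parity tau (green p q w g)) by (eapply green_parity; eauto).
  split; [|split; [exact Pt|]].
  - eapply cts_green; eauto.
  - apply (extend_by_parity tau); [|exact Pt|].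
    + destruct Ht as [->|[-> _]]; lra.
    + intros x Hx. eapply green_bound; eauto.
      intros y Hy. rewrite <- rho_right by easy. apply B.
Qed.

Lemma green_dist (g h : R -> R) (K E : R) : good_source g -> good_source h ->
  (forall x, Rabs (g x) <= K * rho k x) -> (forall x, Rabs (h x) <= K * rho k x) ->
  (forall x, Rabs (g x - h x) <= E * rho k x) ->
  forall x, Rabs (green p q w g x - green p q w h x) <= green_const mu C w k * E * rho k x.
Proof.
  intros Gg Gh Bg Bh BE.
  destruct (green_good g K Gg Bg) as [_ [Pg _]]. destruct (green_good h K Gh Bh) as [_ [Ph _]].
  destruct Gg as [Cg [_ Ht]]. destruct Gh as [Ch _].
  apply (extend_by_parity tau); [|now apply parity_minus|].
  - destruct Ht as [->|[-> _]]; lra.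
  - assert (Bg' : forall x, 0 <= x -> Rabs (g x) <= K * exp (- k * x))
      by (intros y Hy; rewrite <- rho_right by easy; apply Bg).
    assert (Bh' : forall x, 0 <= x -> Rabs (h x) <= K * exp (- k * x))
      by (intros y Hy; rewrite <- rho_right by easy; apply Bh).
    intros x Hx.
    rewrite (green_minus S g h K k K Cg Ch (proj1 Hk) Bg' Bh').
    apply (green_bound S (fun y => g y - h y) E k); [cts_tac|easy| |easy].
    intros y Hy; rewrite <- rho_right by easy; apply BE.
Qed.

End GreenParity.

Arguments green_good {Q p p' q q' mu C w}.
Arguments green_dist {Q p p' q q' mu C w}.

Lemma cts_uniform_limit (f : R -> R) :
  (forall e, 0 < e -> exists g, cts g /\ forall x, Rabs (g x - f x) <= e) -> cts f.
Proof.
  intros H x P [[e He] HP]. destruct (H (e / 3) ltac:(lra)) as [g [Cg Hg]].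
  assert (L := Cg x (ball (g x) (e / 3)) (locally_ball (g x) (mkposreal (e / 3) ltac:(lra)))).
  unfold filtermap in *. revert L. apply filter_imp. intros y Hy. apply HP. change (Rabs (f y - f x) < e).
  change (Rabs (g y - g x) < e / 3) in Hy.
  assert (H1 := Hg x). assert (H2 := Hg y). apply Rabs_le_between in H1, H2.
  apply Rabs_def2 in Hy. apply Rabs_def1; lra.
Qed.

Section Branch.
Variables (s beta2 : R) (l : nat) (V1' q q' : R -> R) (CV w0 : R).
Hypothesis hs : 0 < s.
Let mu := sqrt s.
Let v := V1 s l.
Let bc := beta1c s l.
Let sg := psign l.
Hypothesis SV : fsys (QV mu (mu + INR l)) v V1' q q' mu CV w0.
Hypothesis Pv : parity sg v.
Hypothesis Pq : parity (- sg) q.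

(** A common weight rate, strictly below the rates 1 and sqrt s of both fundamental systems. *)
Definition kap : R := Rmin 1 (sqrt s) / 2.
Let k := kap.

Lemma kap_bounds : 0 < k /\ k < 1 /\ k < mu.
Proof.
  unfold k, kap. fold mu. assert (0 < mu) by now apply sqrt_lt_R0.
  unfold Rmin. destruct Rle_dec; lra.
Qed.

Let k_pos : 0 <= k.
Proof. pose proof kap_bounds. lra. Qed.
Let k1 : 0 <= k < 1.
Proof. pose proof kap_bounds. lra. Qed.
Let kmu : 0 <= k < mu.
Proof. pose proof kap_bounds. lra. Qed.
Let sg2 : sg * sg = 1 := psign_sq l.
Let cv : cts v := cts_derive _ _ (fs_p SV).

Lemma U0_rho (x : R) : Rabs (U0 x) <= 4 * rho k x.
Proof.
  apply (extend_by_parity 1 k 4 U0); [ring|intros y; rewrite U0_even; ring|].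
  intros y Hy. rewrite Rabs_pos_eq by (left; apply U0_pos). unfold U0.
  assert (H := sech_le_exp y). assert (H' := sech_pos y).
  assert (sqrt 2 <= 2).
  { rewrite <- (sqrt_Rsqr 2) at 2 by lra. apply sqrt_le_1; unfold Rsqr; lra. }
  assert (exp (- y) <= exp (- k * y)) by (apply exp_le_compat; pose proof kap_bounds; nra).
  pose proof (sqrt_pos 2). nra.
Qed.

Lemma V1_rho (x : R) : Rabs (v x) <= CV * rho k x.
Proof.
  apply (extend_by_parity sg k CV v sg2 Pv).
  intros y Hy. eapply Rle_trans; [apply (fs_pb SV y Hy)|].
  apply Rmult_le_compat_l; [apply (fs_C SV)|].
  apply exp_le_compat. pose proof kap_bounds. nra.
Qed.

Definition Jint : R := I0 (fun x => V1 s l x * (U0 x ^ 2 * V1 s l x)).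

Lemma conv_vg (g : R -> R) (K : R) : cts g -> (forall x, Rabs (g x) <= K * rho k x) ->
  conv (fun x => v x * g x).
Proof.
  intros G B. apply (conv_pg SV g K k G k_pos).
  intros x Hx. rewrite <- rho_right by easy. apply B.
Qed.

Lemma UUv_rho : exists K, 0 <= K /\ forall x, Rabs (U0 x ^ 2 * v x) <= K * rho k x.
Proof.
  assert (C0 := fs_C SV).
  exists (16 * CV). split; [lra|]. intros x.
  rewrite Rabs_mult, <- RPow_abs.
  assert (H1 := U0_rho x). assert (H2 := V1_rho x). assert (R := rho_bounds k x k_pos).
  assert (Rabs (U0 x) ^ 2 <= 4 ^ 2) by (apply pow_incr; split; [apply Rabs_pos|lra]).
  replace (16 * CV * rho k x) with (4 ^ 2 * (CV * rho k x)) by ring.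
  apply Rmult_le_compat; auto using Rabs_pos. apply pow_le, Rabs_pos.
Qed.

Lemma J_pos : 0 < Jint.
Proof.
  destruct UUv_rho as [K [_ HK]]. destruct (V1_nonzero s l hs) as [x0 Hx0].
  unfold Jint. fold v in Hx0. fold v. apply I0_pos with x0.
  - apply conv_vg with K; [|exact HK]. pose proof cts_U0. cts_tac.
  - intros x. rewrite U0_even, Pv. transitivity ((sg * sg) * (v x * (U0 x ^ 2 * v x))); [ring|].
    rewrite sg2. ring.
  - intros x. replace (v x * (U0 x ^ 2 * v x)) with ((U0 x * v x) ^ 2) by ring. apply pow2_ge_0.
  - pose proof (U0_pos x0).
    assert (0 < (U0 x0 * v x0) ^ 2).
    { apply pow2_gt_0. apply Rmult_integral_contrapositive_currified; lra. }
    nra.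
Qed.

(* The unknown (u, w, b) is coded as one real function: None carries b,
   Some (true, x) carries u x and Some (false, x) carries w x. *)
Definition idx : Type := option (bool * R).
Definition om (i : idx) : R := match i with None => 1 | Some (_, x) => rho kap x end.
Definition uo (X : idx -> R) (x : R) : R := X (Some (true, x)).
Definition wo (X : idx -> R) (x : R) : R := X (Some (false, x)).
Definition bo (X : idx -> R) : R := X None.
Definition mkX (u w : R -> R) (b : R) (i : idx) : R :=
  match i with None => b | Some (true, x) => u x | Some (false, x) => w x end.

(** The closed set for the contraction. The parities are part of it because they give the
    solvability of the first equation and carry half-line bounds to the line. *)
Definition reg (K : R) (X : idx -> R) : Prop :=
  cts (uo X) /\ cts (wo X) /\ parity 1 (uo X) /\ parity (psign l) (wo X) /\
  forall i, Rabs (X i) <= K * om i.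

Definition Nsrc (t : R) (X : idx -> R) (x : R) : R :=
  Npoly (beta1c s l) t (bo X) (uo X x) (wo X x) (V1 s l x) (U0 x).
Definition Hsrc (t : R) (X : idx -> R) (x : R) : R :=
  Hpoly (beta1c s l) beta2 t (bo X) (uo X x) (wo X x) (V1 s l x) (U0 x).

Definition u_op (t : R) (X : idx -> R) : R -> R := green phi12 phi11 (-1) (Nsrc t X).
(** The value of b for which b U0^2 V1 + H is orthogonal to [V1] on the half line. *)
Definition b_op (t : R) (X : idx -> R) : R := - I0 (fun x => V1 s l x * Hsrc t X x) / Jint.
Definition w_op (t : R) (X : idx -> R) (b : R) : R -> R :=
  green (V1 s l) q w0 (fun x => b * (U0 x ^ 2 * V1 s l x) + Hsrc t X x).

(* The new u enters b and w, so that all other dependence on X carries a factor t. *)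
Definition Phi (t : R) (X : idx -> R) : idx -> R :=
  let u1 := u_op t X in
  let Y := mkX u1 (wo X) (bo X) in
  let b1 := b_op t Y in
  mkX u1 (w_op t Y b1) b1.

Lemma reg_mono (K K' : R) (X : idx -> R) : K <= K' -> reg K X -> reg K' X.
Proof.
  intros H [A [B [C [D E]]]]. repeat split; auto. intros i. eapply Rle_trans; [apply E|].
  apply Rmult_le_compat_r; [|easy]. destruct i as [[? x]|]; simpl; [|lra].
  pose proof (rho_bounds k x k_pos). fold k. lra.
Qed.

Lemma parity_Nsrc (t K : R) (X : idx -> R) : reg K X -> parity 1 (Nsrc t X).
Proof.
  intros [_ [_ [Pu [Pw _]]]] x. unfold Nsrc, Npoly. fold v. rewrite U0_even, Pu, Pw, Pv. fold sg.
  replace ((sg * v x + t * (sg * wo X x)) ^ 2) with ((sg * sg) * (v x + t * wo X x) ^ 2) by ring.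
  rewrite sg2. ring.
Qed.

Lemma parity_Hsrc (t K : R) (X : idx -> R) : reg K X -> parity sg (Hsrc t X).
Proof.
  intros [_ [_ [Pu [Pw _]]]] x. unfold Hsrc, Hpoly. fold v. rewrite U0_even, Pu, Pw, Pv. fold sg.
  replace ((sg * v x + t * (sg * wo X x)) ^ 3) with ((sg * sg) * sg * (v x + t * wo X x) ^ 3) by ring.
  rewrite sg2. ring.
Qed.

Lemma cts_Nsrc (t K : R) (X : idx -> R) : reg K X -> cts (Nsrc t X).
Proof. intros [A [B _]]. apply cts_Npoly; auto. apply cts_U0. Qed.

Lemma cts_Hsrc (t K : R) (X : idx -> R) : reg K X -> cts (Hsrc t X).
Proof. intros [A [B _]]. apply cts_Hpoly; auto. apply cts_U0. Qed.

Lemma uv_bounds (K : R) (x : R) : 4 + CV <= K ->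
  Rabs (V1 s l x) <= K * rho kap x /\ Rabs (U0 x) <= K * rho kap x.
Proof.
  intros H. assert (H1 := U0_rho x). assert (H2 := V1_rho x). assert (R := rho_bounds k x k_pos).
  assert (C0 := fs_C SV).
  unfold v, k in *. split; nra.
Qed.

(** The source is even and [phi12] is odd, so no solvability condition arises. At t = 0 the source
    is bc V1^2 U0, free of the unknowns, whence the factor t in front of d. *)
Lemma u_step (K : R) : 0 <= K -> exists L, 0 <= L /\
  forall t t' d X X', 0 <= t <= 1 -> 0 <= t' <= 1 -> 0 <= d -> reg K X -> reg K X' -> wdist om d X X' ->
  cts (u_op t X) /\ parity 1 (u_op t X) /\ (forall x, Rabs (u_op t X x) <= L * rho kap x) /\
  forall x, Rabs (u_op t X x - u_op t' X' x) <= L * (t * d + Rabs (t - t')) * rho kap x.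
Proof.
  (* Adding the bounds 4 of [U0] and [CV] of [V1] to K gives one constant valid for all slots. *)
  intros HK. destruct (Npoly_tame (beta1c s l) (K + (4 + CV))) as [L [PL HL]].
  { pose proof (fs_C SV). lra. }
  assert (PG := green_const_pos fsys_U k k1).
  exists (green_const 1 6 (-1) k * L). split; [now apply Rmult_le_pos|].
  intros t t' d X X' Ht Ht' Hd RX RX' HD.
  assert (C0 := fs_C SV).
  assert (RX2 : reg (K + (4 + CV)) X) by (apply (reg_mono K); [lra|easy]).
  assert (RX2' : reg (K + (4 + CV)) X') by (apply (reg_mono K); [lra|easy]).
  assert (H : forall t t' X X', 0 <= t <= 1 -> 0 <= t' <= 1 -> reg (K + (4 + CV)) X ->
     reg (K + (4 + CV)) X' -> wdist om d X X' -> forall x,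
    Rabs (Nsrc t X x) <= L * rho k x /\
    Rabs (Nsrc t X x - Nsrc t' X' x) <= L * (t * d + Rabs (t - t')) * rho k x).
  { clear t t' X X' Ht Ht' RX RX' HD RX2 RX2'. intros t t' X X' Ht Ht' RX RX' HD x.
    destruct RX as [_ [_ [_ [_ B]]]]. destruct RX' as [_ [_ [_ [_ B']]]].
    destruct (uv_bounds (K + (4 + CV)) x ltac:(lra)) as [E1 E2].
    assert (R := rho_bounds k x k_pos). fold k in E1, E2.
    assert (G1 := B None). assert (G2 := B' None). assert (G3 := HD None). simpl in G1, G2, G3.
    apply HL; try easy; try lra; try (unfold bo; lra);
     try apply (B (Some (true, x))); try apply (B (Some (false, x)));
     try apply (B' (Some (true, x))); try apply (B' (Some (false, x)));
     try apply (HD (Some (true, x))); try apply (HD (Some (false, x))). }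
  assert (HD' : wdist om d X' X) by (intros i; rewrite Rabs_minus_sym; apply HD).
  assert (GS : forall t X, reg (K + (4 + CV)) X -> good_source phi12 (-1) 1 (Nsrc t X)).
  { intros t0 Y RY. split; [eapply cts_Nsrc; eauto|split; [eapply parity_Nsrc; eauto|left; ring]]. }
  assert (P11 : parity (- -1) phi11) by (replace (- -1) with 1 by ring; apply parity_phi11).
  destruct (green_good (-1) 1 k fsys_U ltac:(ring) parity_phi12 P11 k1
    (Nsrc t X) L (GS t X RX2) (fun x => proj1 (H t t' X X' Ht Ht' RX2 RX2' HD x))) as [A1 [A2 A3]].
  split; [exact A1|split; [exact A2|split; [exact A3|]]].
  intros x. rewrite (Rmult_assoc _ L).
  apply (green_dist (-1) 1 k fsys_U ltac:(ring) parity_phi12 P11 k1 _ _ L); auto.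
  - intros y. apply (H t t' X X'); auto.
  - intros y. apply (H t' t X' X); auto.
  - intros y. apply (H t t' X X'); auto.
Qed.

Lemma wb_step (K : R) : 0 <= K -> exists L, 0 <= L /\
  forall t t' d du X X', 0 <= t <= 1 -> 0 <= t' <= 1 -> 0 <= d -> 0 <= du -> reg K X -> reg K X' ->
  Rabs (bo X - bo X') <= d -> (forall x, Rabs (uo X x - uo X' x) <= du * rho kap x) ->
  (forall x, Rabs (wo X x - wo X' x) <= d * rho kap x) ->
  let b := b_op t X in let b' := b_op t' X' in
  let E := L * (du + t * d + Rabs (t - t')) in
  Rabs b <= L /\ Rabs (b - b') <= E /\
  cts (w_op t X b) /\ parity (psign l) (w_op t X b) /\
  (forall x, Rabs (w_op t X b x) <= L * rho kap x) /\
  forall x, Rabs (w_op t X b x - w_op t' X' b' x) <= E * rho kap x.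
Proof.
  intros HK. assert (C0 := fs_C SV).
  destruct (Hpoly_tame (beta1c s l) beta2 (K + (4 + CV)) ltac:(lra)) as [L [PL HL]].
  destruct UUv_rho as [M [PM HM]].
  assert (JP := J_pos). assert (M0 := fs_mu SV).
  assert (PG := green_const_pos SV k kmu).
  set (G := green_const mu CV w0 k) in *.
  (* [c] bounds the map from H to b: the projection on [V1] costs CV / mu, then comes the division
     by J. *)
  set (c := CV / mu / Jint).
  assert (Pc : 0 <= c) by (unfold c; apply Rdiv_le_0_compat; [apply Rdiv_le_0_compat|]; lra).
  assert (Z1 : 0 <= c * L * M) by (apply Rmult_le_pos; [now apply Rmult_le_pos|easy]).
  assert (Z2 : 0 <= c * L) by now apply Rmult_le_pos.
  assert (Z3 : 0 <= G * (c * L * M + L)) by (apply Rmult_le_pos; lra).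
  exists (c * L + G * (c * L * M + L)). split; [lra|].
  intros t t' d du X X' Ht Ht' Hd Hdu RX RX' Db Du Dw b b' E.
  assert (RX2 : reg (K + (4 + CV)) X) by (apply (reg_mono K); [lra|easy]).
  assert (RX2' : reg (K + (4 + CV)) X') by (apply (reg_mono K); [lra|easy]).
  set (e := du + t * d + Rabs (t - t')) in *.
  assert (Pe : 0 <= e).
  { unfold e. pose proof (Rabs_pos (t - t')). assert (0 <= t * d) by (apply Rmult_le_pos; lra). lra. }
  assert (H : forall t t' X X', 0 <= t <= 1 -> 0 <= t' <= 1 -> reg (K + (4 + CV)) X ->
     reg (K + (4 + CV)) X' -> Rabs (bo X - bo X') <= d -> (forall x, Rabs (uo X x - uo X' x) <= du * rho kap x) ->
    (forall x, Rabs (wo X x - wo X' x) <= d * rho kap x) -> forall x,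
    Rabs (Hsrc t X x) <= L * rho k x /\
    Rabs (Hsrc t X x - Hsrc t' X' x) <= L * (du + t * d + Rabs (t - t')) * rho k x).
  { clear b b' E RX2 RX2' Pe; clear e; clear t t' X X' Ht Ht' RX RX' Db Du Dw. intros t t' X X' Ht Ht' RX RX' Db Du Dw x.
    destruct RX as [_ [_ [_ [_ B]]]]. destruct RX' as [_ [_ [_ [_ B']]]].
    destruct (uv_bounds (K + (4 + CV)) x ltac:(lra)) as [E1 E2].
    assert (R := rho_bounds k x k_pos). fold k in E1, E2.
    assert (G1 := B None). assert (G2 := B' None). simpl in G1, G2.
    apply HL; try easy; try lra; try (unfold bo in *; lra);
     try apply (B (Some (true, x))); try apply (B (Some (false, x)));
     try apply (B' (Some (true, x))); try apply (B' (Some (false, x)));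
     try apply Du; try apply Dw. }
  assert (H1 := H t t' X X' Ht Ht' RX2 RX2' Db Du Dw).
  assert (H2 := H t' t X' X Ht' Ht RX2' RX2 ltac:(rewrite Rabs_minus_sym; auto)
    ltac:(intros; rewrite Rabs_minus_sym; auto) ltac:(intros; rewrite Rabs_minus_sym; auto)).
  fold e in H1. clear H.
  assert (CH : forall t X, reg K X -> cts (Hsrc t X)) by (intros; eapply cts_Hsrc; eauto).
  assert (cU := cts_U0).
  assert (Cs : forall t X b, reg K X -> cts (fun x => b * (U0 x ^ 2 * V1 s l x) + Hsrc t X x)).
  { intros t0 Y b0 RY. specialize (CH t0 Y RY). fold v. cts_tac. }
  assert (Bb : forall t X e, reg K X -> (forall x, Rabs (Hsrc t X x) <= e * rho k x) ->
     Rabs (b_op t X) <= c * e).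
  { intros t0 Y e0 RY HB. unfold b_op, Rdiv. rewrite Rabs_mult, Rabs_Ropp.
    rewrite (Rabs_pos_eq (/ Jint)) by (left; now apply Rinv_0_lt_compat).
    replace (c * e0) with (CV / mu * e0 * / Jint) by (unfold c; field; lra).
    apply Rmult_le_compat_r; [left; now apply Rinv_0_lt_compat|].
    apply (I0_pg_bound SV _ e0 k (CH _ _ RY) k_pos).
    intros x Hx. rewrite <- rho_right by easy. apply HB. }
  assert (Orth : forall t X, reg K X -> (forall x, Rabs (Hsrc t X x) <= L * rho k x) ->
     I0 (fun x => v x * (b_op t X * (U0 x ^ 2 * v x) + Hsrc t X x)) = 0).
  { intros t0 Y RY HB.
    assert (C1 : conv (fun x => v x * (U0 x ^ 2 * v x))).
    { apply conv_vg with M; [cts_tac|easy]. }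
    assert (C2 : conv (fun x => v x * Hsrc t0 Y x)) by (apply conv_vg with L; auto).
    rewrite (I0_ext _ (fun x => b_op t0 Y * (v x * (U0 x ^ 2 * v x)) + 1 * (v x * Hsrc t0 Y x))) by (intros; ring).
    rewrite (proj2 (conv_lin _ _ _ _ C1 C2)). unfold b_op. fold v. change (I0 (fun x => v x * (U0 x ^ 2 * v x))) with Jint.
    field. lra. }
  assert (GS : forall t X, reg K X -> (forall x, Rabs (Hsrc t X x) <= L * rho k x) ->
     good_source v sg sg (fun x => b_op t X * (U0 x ^ 2 * V1 s l x) + Hsrc t X x)).
  { intros t0 Y RY HB. split; [now apply Cs|split; [|right; split; [easy|now apply Orth]]].
    intros x. fold v. rewrite U0_even, Pv, (parity_Hsrc t0 K Y RY). ring. }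
  assert (B1 := Bb t X L RX (fun x => proj1 (H1 x))).
  assert (B2 := Bb t' X' L RX' (fun x => proj1 (H2 x))). fold b in B1. fold b' in B2.
  assert (B3 : Rabs (b - b') <= c * (L * e)).
  { unfold b, b', b_op. fold v.
    assert (C2 : conv (fun x => v x * Hsrc t X x)) by (apply conv_vg with L; [auto|apply H1]).
    assert (C2' : conv (fun x => v x * Hsrc t' X' x)) by (apply conv_vg with L; [auto|apply H2]).
    replace (_ - _) with (- (I0 (fun x => v x * Hsrc t X x) - I0 (fun x => v x * Hsrc t' X' x)) / Jint) by (field; lra).
    rewrite I0_minus by easy. unfold Rdiv. rewrite Rabs_mult, Rabs_Ropp.
    rewrite (Rabs_pos_eq (/ Jint)) by (left; now apply Rinv_0_lt_compat).
    replace (c * (L * e)) with (CV / mu * (L * e) * / Jint) by (unfold c; field; lra).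
    apply Rmult_le_compat_r; [left; now apply Rinv_0_lt_compat|].
    rewrite (I0_ext _ (fun x => v x * (Hsrc t X x - Hsrc t' X' x))) by (intros; ring).
    assert (CC : cts (fun x => Hsrc t X x - Hsrc t' X' x)).
    { assert (X1 := CH t X RX). assert (X2 := CH t' X' RX'). cts_tac. }
    apply (I0_pg_bound SV _ (L * e) k CC k_pos).
    intros x Hx. rewrite <- rho_right by easy. apply H1. }
  assert (Src : forall b0 h x B e0, Rabs b0 <= B -> Rabs h <= e0 * rho k x ->
     Rabs (b0 * (U0 x ^ 2 * V1 s l x) + h) <= (B * M + e0) * rho k x).
  { intros b0 h x B e0 Hb Hh. eapply Rle_trans; [apply Rabs_triang|]. rewrite Rabs_mult.
    assert (Rabs b0 * Rabs (U0 x ^ 2 * V1 s l x) <= B * (M * rho k x)); [|lra].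
    apply Rmult_le_compat; auto using Rabs_pos. }
  assert (S1 : forall x, Rabs (b * (U0 x ^ 2 * V1 s l x) + Hsrc t X x) <= (c * L * M + L) * rho k x)
    by (intros x; apply Src; [easy|apply H1]).
  assert (S2 : forall x, Rabs (b' * (U0 x ^ 2 * V1 s l x) + Hsrc t' X' x) <= (c * L * M + L) * rho k x)
    by (intros x; apply Src; [easy|apply H2]).
  destruct (green_good sg sg k SV sg2 Pv Pq kmu _ _
     (GS t X RX (fun x => proj1 (H1 x))) S1) as [A1 [A2 A3]].
  assert (G0 : 0 <= G * (c * L * M + L) * e) by (apply Rmult_le_pos; lra).
  assert (cLe : 0 <= c * L * e) by (apply Rmult_le_pos; lra).
  split; [|split; [|split; [exact A1|split; [exact A2|split]]]].
  - lra.
  - unfold E. lra.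
  - intros x. eapply Rle_trans; [apply A3|]. fold G k.
    apply Rmult_le_compat_r; [|lra]. left; apply rho_bounds; easy.
  - intros x.
    assert (X3 : Rabs (w_op t X b x - w_op t' X' b' x) <= G * ((c * (L * e)) * M + L * e) * rho k x).
    { apply (green_dist sg sg k SV sg2 Pv Pq kmu _ _ (c * L * M + L)); auto.
      - apply GS; [easy|apply H1].
      - apply GS; [easy|apply H2].
      - intros y. replace (_ - _) with ((b - b') * (U0 y ^ 2 * V1 s l y) + (Hsrc t X y - Hsrc t' X' y)) by ring.
        apply Src; [easy|apply H1]. }
    eapply Rle_trans; [apply X3|]. fold k.
    apply Rmult_le_compat_r; [left; apply rho_bounds; easy|]. unfold E. lra.
Qed.

Lemma om_bounds (i : idx) : 0 < om i <= 1.
Proof. destruct i as [[? x]|]; simpl; [apply rho_bounds, k_pos|lra]. Qed.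

(** The change L1 e of the updated [u], with e = t d + |t - t'|, enters [wb_step] as [du]; the total
    is a multiple of e again, so Phi has Lipschitz constant O(t) in X and O(1) in t. *)
Lemma Phi_est (K : R) : 0 <= K -> exists L, 0 <= L /\
  forall t t' d X X', 0 <= t <= 1 -> 0 <= t' <= 1 -> 0 <= d -> reg K X -> reg K X' -> wdist om d X X' ->
  reg L (Phi t X) /\ wdist om (L * (t * d + Rabs (t - t'))) (Phi t X) (Phi t' X').
Proof.
  intros HK. destruct (u_step K HK) as [L1 [P1 H1]].
  destruct (wb_step (K + L1) ltac:(lra)) as [L2 [P2 H2]].
  assert (P3 : 0 <= L2 * (L1 + 1)) by (apply Rmult_le_pos; lra).
  exists (L1 + L2 + L2 * (L1 + 1)). split; [lra|].
  intros t t' d X X' Ht Ht' Hd RX RX' HD.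
  assert (HD' : wdist om d X' X) by (intros i; rewrite Rabs_minus_sym; apply HD).
  destruct (H1 t t' d X X' Ht Ht' Hd RX RX' HD) as [A1 [A2 [A3 A4]]].
  destruct (H1 t' t d X' X Ht' Ht Hd RX' RX HD') as [B1 [B2 [B3 _]]].
  assert (E0 : 0 <= t * d + Rabs (t - t')).
  { assert (0 <= t * d) by (apply Rmult_le_pos; lra). pose proof (Rabs_pos (t - t')). lra. }
  set (e := t * d + Rabs (t - t')) in *.
  assert (RY : forall X u, reg K X -> cts u -> parity 1 u -> (forall x, Rabs (u x) <= L1 * rho kap x) ->
     reg (K + L1) (mkX u (wo X) (bo X))).
  { intros Z u [Z1 [Z2 [Z3 [Z4 Z5]]]] U1 U2 U3. repeat split; auto.
    intros i. assert (O := om_bounds i). assert (Zi := Z5 i).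
    destruct i as [[[|] x]|]; simpl in *; unfold wo, bo; try specialize (U3 x); nra. }
  destruct (H2 t t' d (L1 * e) (mkX (u_op t X) (wo X) (bo X)) (mkX (u_op t' X') (wo X') (bo X')))
    as [C1 [C2 [C3 [C4 [C5 C6]]]]]; auto.
  - now apply Rmult_le_pos.
  - assert (HN := HD None). simpl in HN. rewrite Rmult_1_r in HN. exact HN.
  - intros x. apply (HD (Some (false, x))).
  - replace (L2 * (L1 * e + t * d + Rabs (t - t'))) with (L2 * (L1 + 1) * e) in C2, C6 by (unfold e; ring).
    assert (L1e : 0 <= L1 * e) by now apply Rmult_le_pos.
    assert (L2e : 0 <= L2 * e) by now apply Rmult_le_pos.
    assert (L3e : 0 <= L2 * (L1 + 1) * e) by now apply Rmult_le_pos.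
    split.
    + repeat split; auto. intros i. assert (O := om_bounds i).
      destruct i as [[[|] x]|]; simpl in *.
      * eapply Rle_trans; [apply A3|]. apply Rmult_le_compat_r; lra.
      * eapply Rle_trans; [apply C5|]. apply Rmult_le_compat_r; lra.
      * rewrite Rmult_1_r. lra.
    + intros i. assert (O := om_bounds i). destruct i as [[[|] x]|]; simpl in *.
      * eapply Rle_trans; [apply A4|]. apply Rmult_le_compat_r; lra.
      * eapply Rle_trans; [apply C6|]. apply Rmult_le_compat_r; lra.
      * rewrite Rmult_1_r. lra.
Qed.

Lemma reg_closed (K : R) (Xn : nat -> idx -> R) (X : idx -> R) : (forall n, reg K (Xn n)) ->
  (forall e, 0 < e -> exists n, wdist om e (Xn n) X) -> reg K X.
Proof.
  intros RX HX.
  assert (Lim : forall i a, (forall n, Rabs (Xn n i) <= a) -> Rabs (X i) <= a).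
  { intros i a Ha. apply le_epsilon. intros e He. destruct (HX e He) as [n Hn].
    specialize (Hn i). specialize (Ha n). assert (O := om_bounds i).
    assert (Rabs (Xn n i - X i) <= e) by nra. apply Rabs_le_between in H, Ha. apply Rabs_le. lra. }
  assert (Par : forall sgn i j, (forall n, Xn n i = sgn * Xn n j) -> X i = sgn * X j).
  { intros sgn i j H. apply Rminus_diag_uniq. destruct (Req_dec (X i - sgn * X j) 0) as [|Hne]; [easy|exfalso].
    apply Rabs_pos_lt in Hne. set (a := Rabs _) in Hne.
    assert (Ps := Rabs_pos sgn).
    destruct (HX (a / (2 * (1 + Rabs sgn)))) as [n Hn]; [apply Rdiv_lt_0_compat; lra|].
    set (e := a / (2 * (1 + Rabs sgn))) in *.
    assert (e * (1 + Rabs sgn) = a / 2) by (unfold e; field; lra).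
    assert (H1 := Hn i). assert (H2 := Hn j). assert (O1 := om_bounds i). assert (O2 := om_bounds j).
    assert (Pe : 0 < e) by nra.
    assert (a <= e + Rabs sgn * e); [|lra].
    unfold a. replace (X i - sgn * X j) with (- (Xn n i - X i) + sgn * (Xn n j - X j)) by (rewrite H; ring).
    eapply Rle_trans; [apply Rabs_triang|]. rewrite Rabs_Ropp, Rabs_mult.
    apply Rplus_le_compat; [nra|]. apply Rmult_le_compat_l; nra. }
  assert (Ct : forall c, (forall n, cts (fun x => Xn n (Some (c, x)))) -> cts (fun x => X (Some (c, x)))).
  { intros c H. apply cts_uniform_limit. intros e He. destruct (HX e He) as [n Hn].
    exists (fun x => Xn n (Some (c, x))). split; [apply H|]. intros x.
    specialize (Hn (Some (c, x))). assert (O := om_bounds (Some (c, x))). nra. }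
  repeat split.
  - apply Ct. intros n. apply (RX n).
  - apply Ct. intros n. apply (RX n).
  - intros x. apply Par. intros n. destruct (RX n) as [_ [_ [H _]]]. apply H.
  - intros x. apply Par. intros n. destruct (RX n) as [_ [_ [_ [H _]]]]. apply H.
  - intros i. apply Lim. intros n. apply (RX n).
Qed.

Definition leading : idx -> R := Phi 0 (fun _ => 0).

Lemma fixed_points : exists t0 K L X,
  0 < t0 <= 1 /\ 0 <= K /\ 0 <= L /\
  (forall t, 0 <= t <= t0 -> reg K (X t) /\ (forall i, Phi t (X t) i = X t i) /\
     wdist om (L * t) (X t) leading) /\
  (forall t t', 0 <= t <= t0 -> 0 <= t' <= t0 -> Rabs (bo (X t) - bo (X t')) <= L * Rabs (t - t')).
Proof.
  assert (R0 : forall K, 0 <= K -> reg K (fun _ : idx => 0)).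
  { intros K HK. repeat split; try apply cts_const; try (intros x; unfold uo, wo; ring).
    intros i. rewrite Rabs_R0. assert (O := om_bounds i). apply Rmult_le_pos; lra. }
  assert (D0 : forall d X, 0 <= d -> wdist om d X X).
  { intros d X Hd i. rewrite Rminus_diag, Rabs_R0. assert (O := om_bounds i). apply Rmult_le_pos; lra. }
  destruct (Phi_est 0 ltac:(lra)) as [K0 [PK0 H0]].
  destruct (H0 0 0 0 (fun _ => 0) (fun _ => 0) ltac:(lra) ltac:(lra) ltac:(lra) (R0 0 ltac:(lra)) (R0 0 ltac:(lra)) (D0 0 _ ltac:(lra))) as [RL _].
  fold leading in RL. clear H0.
  (* [K0] bounds [leading], and the images Phi t X lie within L t <= 1/2 of it, so the ball of
     radius K0 + 1 is mapped into itself. *)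
  set (K := K0 + 1). assert (PK : 0 <= K) by (unfold K; lra).
  destruct (Phi_est K PK) as [L [PL HL]].
  (* For t = t' = 0 the estimate t d + |t - t'| is 0 whatever the distance d. *)
  assert (Z : forall X, reg K X -> forall i, Phi 0 X i = leading i).
  { intros X RX i.
    assert (DX : wdist om K X (fun _ => 0)).
    { intros j. rewrite Rminus_0_r. apply RX. }
    destruct (HL 0 0 K X (fun _ => 0) ltac:(lra) ltac:(lra) PK RX (R0 K PK) DX) as [_ D].
    specialize (D i). rewrite Rminus_diag, Rabs_R0 in D.
    replace (L * (0 * K + 0) * om i) with 0 in D by ring.
    apply Rminus_diag_uniq. unfold leading.
    destruct (Req_dec (Phi 0 X i - Phi 0 (fun _ => 0) i) 0) as [|Hne]; [easy|].
    apply Rabs_pos_lt in Hne. lra. }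
  assert (ZL : forall t X, 0 <= t <= 1 -> reg K X -> wdist om (L * t) (Phi t X) leading).
  { intros t X Ht RX i.
    destruct (HL t 0 0 X X Ht ltac:(lra) ltac:(lra) RX RX (D0 0 X ltac:(lra))) as [_ D].
    specialize (D i). rewrite (Z X RX), Rminus_0_r, (Rabs_pos_eq t) in D by lra.
    replace (L * (t * 0 + t)) with (L * t) in D by ring. exact D. }
  (* Makes L t <= 1/2, the contraction ratio. *)
  set (t0 := / (2 * L + 2)).
  assert (Pt0 : 0 < t0) by (apply Rinv_0_lt_compat; lra).
  assert (Et0 : t0 * (2 * L + 2) = 1) by (unfold t0; field; lra).
  assert (Lt0 : 0 <= L * t0) by (apply Rmult_le_pos; lra).
  assert (Ht01 : t0 <= 1) by lra.
  assert (Small : forall t, 0 <= t <= t0 -> 0 <= L * t <= / 2).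
  { intros t Ht. split; [apply Rmult_le_pos; lra|]. assert (L * t <= L * t0) by (apply Rmult_le_compat_l; lra). lra. }
  assert (Ex : forall t, exists X, 0 <= t <= t0 -> reg K X /\ forall i, Phi t X i = X i).
  { intros t. destruct (Rle_dec 0 t) as [Ht0|]; [|exists (fun _ => 0); lra].
    destruct (Rle_dec t t0) as [Ht1|]; [|exists (fun _ => 0); lra].
    assert (Sm := Small t ltac:(lra)).
    destruct (contraction idx om (reg K) (Phi t) (fun _ => 0) (K + L)) as [X [RX FX]].
    - intros i. left. apply om_bounds.
    - now apply R0.
    - intros X RX.
      destruct (HL t t 0 X X ltac:(lra) ltac:(lra) ltac:(lra) RX RX (D0 0 X ltac:(lra))) as [[Q1 [Q2 [Q3 [Q4 _]]]] _].
      repeat split; auto. intros i. assert (B := ZL t X ltac:(lra) RX i).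
      destruct RL as [_ [_ [_ [_ BL]]]]. specialize (BL i). assert (O := om_bounds i).
      replace (Phi t X i) with ((Phi t X i - leading i) + leading i) by ring.
      eapply Rle_trans; [apply Rabs_triang|]. unfold K. nra.
    - intros X Y d Hd RX RY D.
      destruct (HL t t d X Y ltac:(lra) ltac:(lra) Hd RX RY D) as [_ D'].
      rewrite Rminus_diag, Rabs_R0 in D'. intros i. specialize (D' i). assert (O := om_bounds i).
      eapply Rle_trans; [apply D'|]. apply Rmult_le_compat_r; [lra|].
      replace (L * (t * d + 0)) with ((L * t) * d) by ring. nra.
    - apply reg_closed.
    - lra.
    - intros i. assert (B := ZL t (fun _ => 0) ltac:(lra) (R0 K PK) i).
      destruct RL as [_ [_ [_ [_ BL]]]]. specialize (BL i). assert (O := om_bounds i).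
      replace (0 - Phi t (fun _ => 0) i) with (- ((Phi t (fun _ => 0) i - leading i) + leading i)) by ring.
      rewrite Rabs_Ropp.
      eapply Rle_trans; [apply Rabs_triang|]. unfold K. nra.
    - exists X. intros _. split; assumption. }
  destruct (functional_choice _ Ex) as [X HX].
  exists t0, K, (2 * L), X. split; [lra|split; [easy|split; [lra|split]]].
  - intros t Ht. destruct (HX t Ht) as [RX FX]. split; [easy|split; [easy|]].
    intros i. rewrite <- FX. assert (B := ZL t (X t) ltac:(lra) RX i). assert (O := om_bounds i).
    assert (Sm := Small t Ht). eapply Rle_trans; [apply B|]. apply Rmult_le_compat_r; lra.
  - intros t t' Ht Ht'. destruct (HX t Ht) as [RX FX]. destruct (HX t' Ht') as [RX' FX'].
    assert (Pd := Rabs_pos (t - t')). set (dt := Rabs (t - t')) in *.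
    assert (Ldt : 0 <= L * dt) by now apply Rmult_le_pos.
    (* Applying the estimate for Phi to two fixed points turns a distance D into at most D/2 + L dt.
       Starting from the trivial 2K, the iteration leaves 2 L dt in the limit. *)
    assert (It : forall n, wdist om (2 * K * (/ 2) ^ n + 2 * L * dt) (X t) (X t')).
    { induction n as [|n IH].
      - intros i. destruct RX as [_ [_ [_ [_ B]]]]. destruct RX' as [_ [_ [_ [_ B']]]].
        specialize (B i). specialize (B' i). assert (O := om_bounds i). simpl.
        eapply Rle_trans; [apply Rabs_triang|]. rewrite Rabs_Ropp.
        assert (0 <= L * dt * om i) by (apply Rmult_le_pos; lra). lra.
      - assert (P2 : 0 < (/ 2) ^ n) by (apply pow_lt; lra).
        assert (P3 : 0 <= K * (/ 2) ^ n) by (apply Rmult_le_pos; lra).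
        destruct (HL t t' (2 * K * (/ 2) ^ n + 2 * L * dt) (X t) (X t') ltac:(lra) ltac:(lra) ltac:(lra) RX RX' IH) as [_ D].
        intros i. rewrite <- FX, <- FX'. eapply Rle_trans; [apply D|].
        assert (O := om_bounds i). apply Rmult_le_compat_r; [lra|]. fold dt.
        assert (Sm := Small t Ht).
        replace (L * (t * (2 * K * (/ 2) ^ n + 2 * L * dt) + dt)) with
          ((L * t) * (2 * (K * (/ 2) ^ n) + 2 * (L * dt)) + L * dt) by ring.
        simpl. nra. }
    apply le_epsilon. intros e He.
    destruct (pow_lt_1_zero (/ 2) ltac:(rewrite Rabs_pos_eq; lra) (e / (2 * K + 1))) as [n Hn].
    { apply Rdiv_lt_0_compat; lra. }
    specialize (Hn n ltac:(lia)). assert (P2 : 0 < (/ 2) ^ n) by (apply pow_lt; lra).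
    rewrite Rabs_pos_eq in Hn by lra.
    specialize (It n None). simpl in It. unfold bo.
    assert ((2 * K + 1) * (/ 2) ^ n < e).
    { replace e with ((2 * K + 1) * (e / (2 * K + 1))) by (field; lra). apply Rmult_lt_compat_l; lra. }
    lra.
Qed.

End Branch.

(** * Expansion and profile equations of the branch *)

Lemma lim_of_rho (f : R -> R) (C k : R) : 0 < k -> (forall x, Rabs (f x) <= C * rho k x) ->
  is_lim f p_infty 0 /\ is_lim f m_infty 0.
Proof.
  intros Hk H.
  assert (P : forall g : R -> R, (forall x, Rabs (g x) <= C * rho k x) -> is_lim g p_infty 0).
  { intros g Hg. apply is_lim_infty_bound with (fun x => C * exp (- k * x)) 0.
    - intros x Hx. rewrite <- rho_right by easy. apply Hg.
    - now apply exp_lin_lim. }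
  split; [now apply P|].
  assert (L : is_lim (fun x => f (- x)) p_infty 0) by (apply P; intros; rewrite <- rho_even; apply H).
  apply (is_lim_ext (fun x => f (- - x))); [intros; now rewrite Ropp_involutive|].
  apply (is_lim_comp (fun x => f (- x)) Ropp m_infty 0 p_infty L).
  - apply (is_lim_opp (fun x => x) m_infty m_infty). apply is_lim_id.
  - exists 0. intros; discriminate.
Qed.

Lemma homoclinic_intro (s b b2 : R) (U U' V V' : R -> R) :
  (forall x, is_derive U x (U' x)) ->
  (forall x, is_derive U' x (U x - (U x ^ 2 + b * V x ^ 2) * U x)) ->
  (forall x, is_derive V x (V' x)) ->
  (forall x, is_derive V' x (s * V x - (b * U x ^ 2 + b2 * V x ^ 2) * V x)) ->
  is_lim U p_infty 0 -> is_lim U m_infty 0 -> is_lim V p_infty 0 -> is_lim V m_infty 0 ->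
  homoclinic s b b2 U V.
Proof.
  intros DU DU' DV DV' L1 L2 L3 L4. split; [|auto].
  assert (EU : forall x, is_derive (Derive U) x (U x - (U x ^ 2 + b * V x ^ 2) * U x)).
  { intros x. apply (is_derive_ext U'); [|apply DU'].
    intros y. symmetry. apply is_derive_unique, DU. }
  assert (EV : forall x, is_derive (Derive V) x (s * V x - (b * U x ^ 2 + b2 * V x ^ 2) * V x)).
  { intros x. apply (is_derive_ext V'); [|apply DV'].
    intros y. symmetry. apply is_derive_unique, DV. }
  intros x. repeat split; try (eexists; auto).
  - simpl. change (Derive (fun x0 => Derive (fun x1 => U x1) x0) x) with (Derive (Derive U) x).
    rewrite (is_derive_unique _ _ _ (EU x)). simpl. ring.
  - simpl. change (Derive (fun x0 => Derive (fun x1 => V x1) x0) x) with (Derive (Derive V) x).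
    rewrite (is_derive_unique _ _ _ (EV x)). simpl. ring.
Qed.

Lemma homoclinic_ode (s b b2 : R) (U V : R -> R) : homoclinic s b b2 U V ->
  (forall x, is_derive U x (Derive U x)) /\
  (forall x, is_derive (Derive U) x (U x - (U x ^ 2 + b * V x ^ 2) * U x)) /\
  (forall x, is_derive V x (Derive V x)) /\
  (forall x, is_derive (Derive V) x (s * V x - (b * U x ^ 2 + b2 * V x ^ 2) * V x)).
Proof.
  intros [H _]. split; [|split; [|split]]; intros x; destruct (H x) as [A [B [C [D [E F]]]]].
  - now apply Derive_correct.
  - eapply is_derive_eq; [now apply Derive_correct|]. simpl in E.
    change (Derive (fun x0 => Derive (fun x1 => U x1) x0) x) with (Derive (Derive U) x) in E. simpl. lra.
  - now apply Derive_correct.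
  - eapply is_derive_eq; [now apply Derive_correct|]. simpl in F.
    change (Derive (fun x0 => Derive (fun x1 => V x1) x0) x) with (Derive (Derive V) x) in F. simpl. lra.
Qed.

Lemma homoclinic_opp (s b b2 : R) (U V : R -> R) :
  homoclinic s b b2 U V -> homoclinic s b b2 U (fun x => - V x).
Proof.
  intros H. destruct (homoclinic_ode _ _ _ _ _ H) as [D1 [D2 [D3 D4]]].
  destruct H as [_ [L1 [L2 [L3 L4]]]].
  apply homoclinic_intro with (Derive U) (fun x => - Derive V x); auto.
  - intros x. eapply is_derive_eq; [apply D2|]. ring.
  - intros x. apply (is_derive_opp V). apply D3.
  - intros x. eapply is_derive_eq; [apply (is_derive_opp (Derive V)); apply D4|].
    unfold opp; simpl. ring.
  - replace (Finite 0) with (Rbar_opp 0) by (simpl; f_equal; ring). now apply is_lim_opp.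
  - replace (Finite 0) with (Rbar_opp 0) by (simpl; f_equal; ring). now apply is_lim_opp.
Qed.

Definition U0' (x : R) : R := - sqrt 2 * sech x * tanh x.

Lemma is_derive_U0 (x : R) : is_derive U0 x (U0' x).
Proof.
  unfold U0'. eapply is_derive_eq; [apply (is_derive_scal sech x (sqrt 2)); apply is_derive_sech|].
  simpl; ring.
Qed.

Lemma is_derive_U0' (x : R) : is_derive U0' x (U0 x - U0 x ^ 3).
Proof.
  assert (D := is_derive_sech x). assert (D' := is_derive_tanh x). unfold U0', U0.
  auto_derive; [dside|]. dsub D. dsub D'.
  assert (S2 : sqrt 2 ^ 2 = 2) by (apply pow2_sqrt; lra). assert (T := tanh_sq x).
  replace ((sqrt 2 * sech x) ^ 3) with (sqrt 2 ^ 2 * sqrt 2 * sech x ^ 3) by ring. rewrite S2.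
  transitivity (sqrt 2 * sech x * (tanh x ^ 2 - sech x ^ 2)); [ring|]. rewrite T. ring.
Qed.

Lemma U0_sq (x : R) : U0 x ^ 2 = 2 * sech x ^ 2.
Proof.
  unfold U0. rewrite Rpow_mult_distr. f_equal. apply pow2_sqrt. lra.
Qed.

Lemma homoclinic_U0 (s b b2 : R) : homoclinic s b b2 U0 (fun _ => 0).
Proof.
  assert (L := lim_of_rho U0 4 (kap 1) (proj1 (kap_bounds 1 Rlt_0_1)) (U0_rho 1 Rlt_0_1)).
  apply homoclinic_intro with U0' (fun _ => 0).
  - apply is_derive_U0.
  - intros x. eapply is_derive_eq; [apply is_derive_U0'|]. ring.
  - intros x. apply @is_derive_const.
  - intros x. eapply is_derive_eq; [apply @is_derive_const|]. unfold zero; simpl. ring.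
  - apply L.
  - apply L.
  - apply is_lim_const.
  - apply is_lim_const.
Qed.

(** The origin of the critical values: since U0^2 = 2 sech^2, the coupling beta1 yields a
    Poeschl-Teller potential with nu (nu + 1) = 2 beta1, and [beta1c] is the case nu = sqrt s +
    l. *)
Lemma QV_beta (s : R) (l : nat) (x : R) : 0 < s ->
  QV (sqrt s) (sqrt s + INR l) x = s - beta1c s l * U0 x ^ 2.
Proof.
  intros Hs. unfold QV, beta1c. rewrite U0_sq, pow2_sqrt by lra. field.
Qed.

Section Expansion.
Variables (s beta2 : R) (l : nat) (V1' q q' : R -> R) (CV w0 : R).
Hypothesis hs : 0 < s.
Let mu := sqrt s.
Let v := V1 s l.
Let bc := beta1c s l.
Hypothesis SV : fsys (QV mu (mu + INR l)) v V1' q q' mu CV w0.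
Hypothesis Pv : parity (psign l) v.
Hypothesis Pq : parity (- psign l) q.

Let cv : cts v := cts_derive _ _ (fs_p SV).
Let c11 : cts phi11 := cts_derive _ _ is_derive_phi11.
Let c12 : cts phi12 := cts_derive _ _ is_derive_phi12.
Let mu0 : 0 < mu := fs_mu SV.

Let a11 (x : R) : R := phi11 x * V1 s l x ^ 2 * sech x.
Let a12 (x : R) : R := phi12 x * V1 s l x ^ 2 * sech x.

Let ca11 : cts a11.
Proof. unfold a11. pose proof cts_sech. fold v. cts_tac. Qed.
Let ca12 : cts a12.
Proof. unfold a12. pose proof cts_sech. fold v. cts_tac. Qed.

Lemma v_sq_even (x : R) : V1 s l (- x) ^ 2 = V1 s l x ^ 2.
Proof.
  fold v. rewrite Pv. rewrite Rpow_mult_distr. replace (psign l ^ 2) with (psign l * psign l) by ring.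
  rewrite psign_sq. ring.
Qed.

(** The factor sech compensates the growth of [phi11]; the rate 2 mu comes from V1^2. *)
Lemma a_bounds : exists A, 0 <= A /\ forall x, 0 <= x ->
  Rabs (a11 x) <= A * exp (- (2 * mu) * x) /\ Rabs (a12 x) <= A * exp (- (2 * mu) * x).
Proof.
  assert (C0 := fs_C SV).
  exists (12 * CV ^ 2). split; [pose proof (pow2_ge_0 CV); lra|]. intros x Hx.
  assert (H1 := fs_pb SV x Hx).
  assert (H2 := fs_pb fsys_U x Hx). assert (H3 := fs_qb fsys_U x Hx).
  assert (H4 := sech_le_exp x). assert (H5 := sech_pos x).
  assert (E2 : Rabs (v x ^ 2) <= CV ^ 2 * exp (- (2 * mu) * x)).
  { rewrite <- RPow_abs. replace (CV ^ 2 * exp (- (2 * mu) * x)) with ((CV * exp (- mu * x)) ^ 2).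
    - apply pow_incr. split; [apply Rabs_pos|easy].
    - rewrite Rpow_mult_distr. f_equal. replace (- (2 * mu) * x) with (- mu * x + - mu * x) by ring.
      rewrite exp_plus. ring. }
  unfold a11, a12. fold v. rewrite !Rabs_mult, (Rabs_pos_eq (sech x)) by lra.
  set (E := exp (- (2 * mu) * x)) in *.
  assert (Pe := exp_pos (- x)). assert (Pe' := exp_pos x).
  assert (X : exp (1 * x) * exp (- x) = 1) by (rewrite <- exp_plus; replace (1 * x + - x) with 0 by ring; apply exp_0).
  split.
  - replace (12 * CV ^ 2 * E) with (6 * exp (1 * x) * (CV ^ 2 * E) * (2 * exp (- x))).
    2:{ replace (6 * exp (1 * x) * (CV ^ 2 * E) * (2 * exp (- x))) with (12 * CV ^ 2 * E * (exp (1 * x) * exp (- x))) by ring. rewrite X. ring. }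
    apply Rmult_le_compat; [|lra| |lra].
    + apply Rmult_le_pos; apply Rabs_pos.
    + apply Rmult_le_compat; auto using Rabs_pos.
  - replace (12 * CV ^ 2 * E) with (6 * (CV ^ 2 * E) * 2) by ring.
    assert (Y : exp (- (1) * x) <= 1) by (apply Rle_trans with (exp 0); [apply exp_le_compat; lra|rewrite exp_0; lra]).
    assert (sech x <= 2) by (pose proof (sech_le_1 x); lra).
    apply Rmult_le_compat; [|lra| |lra].
    + apply Rmult_le_pos; apply Rabs_pos.
    + apply Rmult_le_compat; auto using Rabs_pos. lra.
Qed.

Let conv_a12 : conv a12.
Proof. destruct a_bounds as [A [PA B]]. apply (conv_exp a12 A (2 * mu)); [lra|auto|apply B]. Qed.

Let T (x : R) : R := I0 a12 - RInt a12 0 x.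
Let Sx (x : R) : R := RInt a11 0 x.

Lemma tail12_T (x : R) : tail12 s l x = T x.
Proof. unfold tail12, T. now rewrite <- (RInt_gen_p a12 x conv_a12). Qed.

(** The Wronskian -1 gives the minus sign in [U2], and the factor sqrt 2 is that of [U0]. *)
Lemma U2_green (x : R) :
  U2 s l x = green phi12 phi11 (-1) (fun y => beta1c s l * V1 s l y ^ 2 * U0 y) x.
Proof.
  unfold U2. rewrite tail12_T. unfold green, T. fold bc.
  set (c := bc * sqrt 2).
  rewrite (I0_ext (fun y => phi12 y * (bc * V1 s l y ^ 2 * U0 y)) (fun y => c * a12 y))
    by (intros y; unfold a12, c, U0; ring).
  rewrite (I0_scal c a12 conv_a12).
  assert (Sc : forall a, cts a -> RInt (fun y => c * a y) 0 x = c * RInt a 0 x).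
  { intros a Ca. apply (RInt_scal a). now apply cts_ex_RInt. }
  rewrite (RInt_ext (fun y => phi12 y * (bc * V1 s l y ^ 2 * U0 y)) (fun y => c * a12 y))
    by (intros y _; toR; unfold a12, c, U0; ring).
  rewrite (RInt_ext (fun y => phi11 y * (bc * V1 s l y ^ 2 * U0 y)) (fun y => c * a11 y))
    by (intros y _; toR; unfold a11, c, U0; ring).
  rewrite (Sc a12 ca12), (Sc a11 ca11). unfold c. change (fun y : R => phi11 y * V1 s l y ^ 2 * sech y) with a11.
  field.
Qed.

Lemma leading_u (x : R) : uo (leading s beta2 l q w0) x = U2 s l x.
Proof.
  rewrite U2_green. change (uo (leading s beta2 l q w0) x) with (u_op s l 0 (fun _ => 0) x).
  unfold u_op. apply green_ext. intros y. unfold Nsrc, Npoly, beta_, uo, wo, bo. ring.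
Qed.

Let T_bound : exists A, 0 <= A /\ forall x, 0 <= x ->
  Rabs (T x) <= A * exp (- (2 * mu) * x) /\ Rabs (Sx x) <= A.
Proof.
  destruct a_bounds as [A [PA B]]. exists (A / (2 * mu)).
  assert (PA' : 0 <= A / (2 * mu)) by (apply Rdiv_le_0_compat; lra).
  split; [easy|]. intros x Hx. split.
  - apply (conv_exp a12 A (2 * mu)); [lra|auto|apply B|easy].
  - unfold Sx. eapply Rle_trans; [apply (RInt_exp_bound a11 A (2 * mu) 0 x); auto; [lra|]|].
    + intros y Hy. apply B. lra.
    + rewrite Rmult_0_r, exp_0. pose proof (exp_pos (- (2 * mu) * x)).
      assert (0 <= A / (2 * mu) * exp (- (2 * mu) * x)) by (apply Rmult_le_pos; lra). lra.
Qed.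

Let cT : cts T.
Proof. unfold T. apply cts_minus; [apply cts_const|now apply cts_prim]. Qed.
Let cS : cts Sx.
Proof. unfold Sx. now apply cts_prim. Qed.

Let conv_a11T : conv (fun x => a11 x * T x).
Proof.
  destruct a_bounds as [A [PA B]]. destruct T_bound as [A' [PA' B']].
  apply (conv_exp _ (A * A') (2 * mu)); [lra|cts_tac|].
  intros x Hx. rewrite Rabs_mult. destruct (B x Hx) as [H1 _]. destruct (B' x Hx) as [H2 _].
  assert (Y : exp (- (2 * mu) * x) <= 1) by (rewrite <- exp_0; apply exp_le_compat; nra).
  replace (A * A' * exp (- (2 * mu) * x)) with ((A * exp (- (2 * mu) * x)) * A') by ring.
  apply Rmult_le_compat; auto using Rabs_pos. nra.
Qed.

Let conv_a12S : conv (fun x => a12 x * Sx x).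
Proof.
  destruct a_bounds as [A [PA B]]. destruct T_bound as [A' [PA' B']].
  apply (conv_exp _ (A * A') (2 * mu)); [lra|cts_tac|].
  intros x Hx. rewrite Rabs_mult. destruct (B x Hx) as [_ H1]. destruct (B' x Hx) as [_ H2].
  replace (A * A' * exp (- (2 * mu) * x)) with ((A * exp (- (2 * mu) * x)) * A') by ring.
  apply Rmult_le_compat; auto using Rabs_pos.
Qed.

(* Integration by parts for the product T S, which vanishes at 0 and at infinity. *)
Let parts : I0 (fun x => a12 x * Sx x) = I0 (fun x => a11 x * T x).
Proof.
  assert (DT : forall x, is_derive (fun x => T x * Sx x) x (a11 x * T x - a12 x * Sx x)).
  { intros x. assert (D1 : is_derive T x (- a12 x)).
    { unfold T. eapply is_derive_eq; [apply @is_derive_minus; [apply @is_derive_const|now apply is_derive_prim]|].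
      unfold minus, plus, opp, zero; simpl. ring. }
    assert (D2 : is_derive Sx x (a11 x)) by now apply is_derive_prim.
    auto_derive; [dside|]. dsub D1. dsub D2. ring. }
  destruct T_bound as [A [PA B]].
  assert (L : is_lim (fun x => T x * Sx x) p_infty 0).
  { apply is_lim_infty_bound with (fun x => A * A * exp (- (2 * mu) * x)) 0.
    - intros x Hx. rewrite Rabs_mult. destruct (B x Hx).
      replace (A * A * exp (- (2 * mu) * x)) with ((A * exp (- (2 * mu) * x)) * A) by ring.
      apply Rmult_le_compat; auto using Rabs_pos.
    - apply exp_lin_lim. lra. }
  destruct (conv_FTC (fun x => a11 x * T x - a12 x * Sx x) (fun x => T x * Sx x) 0 ltac:(cts_tac) DT L) as [_ E].
  rewrite <- I0_minus in E by easy. unfold Sx in E at 2. rewrite RInt_00 in E. lra.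
Qed.

Let conv_v4 : conv (fun x => V1 s l x ^ 4).
Proof.
  assert (C0 := fs_C SV).
  apply (conv_exp _ (CV ^ 4) mu); [easy|fold v; cts_tac|].
  intros x Hx. assert (H := fs_pb SV x Hx). fold v.
  assert (Y : exp (- mu * x) <= 1) by (rewrite <- exp_0; apply exp_le_compat; nra).
  assert (Pe := exp_pos (- mu * x)). set (E := exp (- mu * x)) in *.
  rewrite <- RPow_abs. apply Rle_trans with ((CV * E) ^ 4).
  - apply pow_incr. split; [apply Rabs_pos|easy].
  - rewrite Rpow_mult_distr. apply Rmult_le_compat_l; [now apply pow_le|].
    replace (E ^ 4) with (E ^ 3 * E) by ring.
    assert (E ^ 3 <= 1) by (rewrite <- (pow1 3); apply pow_incr; lra). nra.
Qed.

(** Inserting [U2] gives -4 bc^2 times the sum of int a11 T and int a12 S, which are equal by parts;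
    passing to the whole line by evenness doubles integrals. This explains the coefficient 8 in
    [b2bar]. *)
Lemma b2bar_half : b2bar s beta2 l =
  - 2 * I0 (fun x => V1 s l x * (2 * beta1c s l * U0 x * U2 s l x * V1 s l x + beta2 * V1 s l x ^ 3)).
Proof.
  assert (C1 : conv (fun x => 1 * (a11 x * T x) + 1 * (a12 x * Sx x))) by now apply conv_lin.
  rewrite (I0_ext _ (fun x => (- 4 * bc ^ 2) * (1 * (a11 x * T x) + 1 * (a12 x * Sx x)) + beta2 * V1 s l x ^ 4)).
  2:{ intros x. unfold U2. rewrite tail12_T. fold bc. unfold a11, a12, Sx, U0.
      change (fun y : R => phi11 y * V1 s l y ^ 2 * sech y) with a11.
      replace (beta2 * V1 s l x ^ 4) with (V1 s l x * (beta2 * V1 s l x ^ 3)) by ring.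
      assert (S2 : sqrt 2 ^ 2 = 2) by (apply pow2_sqrt; lra).
      transitivity (- 2 * bc ^ 2 * sqrt 2 ^ 2 * sech x * V1 s l x ^ 2 * (phi11 x * T x + phi12 x * RInt a11 0 x)
        + V1 s l x * (beta2 * V1 s l x ^ 3)); [ring|]. rewrite S2. ring. }
  rewrite (proj2 (conv_lin _ _ _ _ C1 conv_v4)), (proj2 (conv_lin 1 1 _ _ conv_a11T conv_a12S)), parts.
  unfold b2bar. fold bc.
  rewrite (RInt_gen_even (fun x => V1 s l x ^ 4) conv_v4).
  2:{ intros x. replace (V1 s l (- x) ^ 4) with ((V1 s l (- x) ^ 2) ^ 2) by ring. rewrite v_sq_even. ring. }
  replace (RInt_gen (fun x => phi11 x * V1 s l x ^ 2 * sech x * tail12 s l x) (Rbar_locally m_infty) (Rbar_locally p_infty))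
    with (2 * I0 (fun x => a11 x * T x)).
  - ring.
  - assert (E : forall x, a11 x * T x = phi11 x * V1 s l x ^ 2 * sech x * tail12 s l x)
      by (intros x; rewrite tail12_T; reflexivity).
    rewrite (I0_ext _ _ E). symmetry. apply RInt_gen_even; [now apply conv_ext with (1 := E)|].
    intros x. rewrite <- !E. unfold a11 at 1. rewrite (parity_phi11 x), v_sq_even, sech_even.
    assert (Ev : T (- x) = T x).
    { unfold T. rewrite (RInt_parity (-1) a12 x ca12); [ring|].
      intros y. unfold a12. rewrite (parity_phi12 y), v_sq_even, sech_even. ring. }
    rewrite Ev. unfold a11. ring.
Qed.

(** At t = 0 the solvability condition reads b J = -int V1 H. As J > 0, the sign of [b2bar] is the
    direction in which beta1 leaves bc. *)
Lemma leading_b : b2bar s beta2 l = 2 * Jint s l * bo (leading s beta2 l q w0).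
Proof.
  assert (JP := J_pos s l V1' q q' CV w0 hs SV Pv).
  rewrite b2bar_half.
  change (bo (leading s beta2 l q w0)) with
    (b_op s beta2 l 0 (mkX (u_op s l 0 (fun _ => 0)) (fun _ => 0) 0)).
  unfold b_op.
  rewrite (I0_ext (fun x => V1 s l x * Hsrc s beta2 l 0 (mkX (u_op s l 0 (fun _ => 0)) (fun _ => 0) 0) x)
   (fun x => V1 s l x * (2 * beta1c s l * U0 x * U2 s l x * V1 s l x + beta2 * V1 s l x ^ 3))).
  - field. lra.
  - intros x. unfold Hsrc, Hpoly, beta_, uo, wo, bo, mkX. rewrite <- leading_u.
    change (uo (leading s beta2 l q w0) x) with (u_op s l 0 (fun _ => 0) x). ring.
Qed.

(** The equations of u and w, multiplied by t and e t, are added to those of [U0] and e V1. At a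
    fixed point the updated [u] used inside Phi is [u] itself. *)
Lemma fixed_point_homoclinic (t K e : R) (X : idx -> R) : 0 <= t -> t = e ^ 2 ->
  reg s l K X -> (forall i, Phi s beta2 l q w0 t X i = X i) ->
  homoclinic s (beta1c s l + t * bo X) beta2
    (fun x => U0 x + t * uo X x) (fun x => e * (V1 s l x + t * wo X x)).
Proof.
  intros Ht Et RX FX.
  assert (Ku := kap_bounds s hs).
  set (Y := mkX (u_op s l t X) (wo X) (bo X)).
  assert (Eu : forall x, u_op s l t X x = uo X x) by (intros x; apply (FX (Some (true, x)))).
  assert (Ew : forall x, w_op s beta2 l q w0 t Y (b_op s beta2 l t Y) x = wo X x)
    by (intros x; apply (FX (Some (false, x)))).
  assert (Eb : b_op s beta2 l t Y = bo X) by apply (FX None).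
  rewrite Eb in Ew.
  assert (EH : forall x, Hsrc s beta2 l t Y x = Hsrc s beta2 l t X x).
  { intros x. unfold Hsrc, Y, uo, wo, bo, mkX. now rewrite Eu. }
  set (h := fun x => bo X * (U0 x ^ 2 * V1 s l x) + Hsrc s beta2 l t Y x) in *.
  assert (cH : cts (Hsrc s beta2 l t X)) by (apply (cts_Hsrc s beta2 l V1' q q' CV w0 SV t K X RX)).
  assert (ch : cts h).
  { unfold h. apply (cts_ext (fun x => bo X * (U0 x ^ 2 * v x) + Hsrc s beta2 l t X x)); [intros; now rewrite EH|].
    pose proof cts_U0. cts_tac. }
  assert (cN : cts (Nsrc s l t X)) by (apply (cts_Nsrc s l V1' q q' CV w0 SV t K X RX)).
  assert (Du : forall x, is_derive (uo X) x (green' phi12 phi12' phi11 phi11' (-1) (Nsrc s l t X) x)).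
  { intros x. apply (is_derive_ext (u_op s l t X)); [apply Eu|].
    apply (is_derive_green fsys_U _ x cN). }
  assert (Du' : forall x, is_derive (green' phi12 phi12' phi11 phi11' (-1) (Nsrc s l t X)) x
     ((1 - 6 * sech x ^ 2) * uo X x - Nsrc s l t X x)).
  { intros x. rewrite <- Eu. apply (is_derive_green' fsys_U _ x cN). }
  assert (Dw : forall x, is_derive (wo X) x (green' v V1' q q' w0 h x)).
  { intros x. eapply (is_derive_ext _ (wo X)); [apply Ew|].
    apply (is_derive_green SV _ x ch). }
  assert (Dw' : forall x, is_derive (green' v V1' q q' w0 h) x
     ((s - beta1c s l * U0 x ^ 2) * wo X x - (bo X * (U0 x ^ 2 * V1 s l x) + Hsrc s beta2 l t X x))).
  { intros x. rewrite <- Ew, <- EH, <- QV_beta by easy. apply (is_derive_green' SV _ x ch). }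
  destruct RX as [_ [_ [_ [_ BX]]]].
  assert (C0 := fs_C SV).
  assert (LU := lim_of_rho (fun x => U0 x + t * uo X x) (4 + t * K) (kap s) (proj1 Ku)).
  assert (LV := lim_of_rho (fun x => e * (V1 s l x + t * wo X x)) (Rabs e * (CV + t * K)) (kap s) (proj1 Ku)).
  destruct LU as [LU1 LU2].
  { intros x. assert (H1 := U0_rho s hs x). assert (H2 := BX (Some (true, x))). simpl in H2.
    eapply Rle_trans; [apply Rabs_triang|]. rewrite Rabs_mult, (Rabs_pos_eq t) by easy. unfold uo. nra. }
  destruct LV as [LV1 LV2].
  { intros x. assert (H1 := V1_rho s l V1' q q' CV w0 hs SV Pv x). assert (H2 := BX (Some (false, x))). simpl in H2.
    rewrite Rabs_mult, Rmult_assoc. apply Rmult_le_compat_l; [apply Rabs_pos|].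
    eapply Rle_trans; [apply Rabs_triang|]. rewrite Rabs_mult, (Rabs_pos_eq t) by easy. unfold wo. nra. }
  apply homoclinic_intro with
    (fun x => U0' x + t * green' phi12 phi12' phi11 phi11' (-1) (Nsrc s l t X) x)
    (fun x => e * (V1' x + t * green' v V1' q q' w0 h x)); auto.
  - intros x. assert (D1 := is_derive_U0 x). assert (D2 := Du x). auto_derive; [dside|]. dsub D1. dsub D2. ring.
  - intros x. assert (D1 := is_derive_U0' x). assert (D2 := Du' x).
    set (g := green' phi12 phi12' phi11 phi11' (-1) (Nsrc s l t X)) in *.
    auto_derive; [dside|]. dsub D1. dsub D2.
    replace (6 * sech x ^ 2) with (3 * U0 x ^ 2) by (rewrite U0_sq; ring).
    unfold Nsrc, Npoly, beta_. rewrite Et. ring.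
  - intros x. assert (D1 : is_derive (V1 s l) x (V1' x)) by apply (fs_p SV x).
    assert (D2 := Dw x). auto_derive; [dside|]. dsub D1. dsub D2. ring.
  - intros x. assert (D1 := fs_p' SV x). assert (D2 := Dw' x). unfold mu in D1. rewrite QV_beta in D1 by easy.
    set (g := green' v V1' q q' w0 h) in *.
    auto_derive; [dside|]. dsub D1. dsub D2. unfold v.
    unfold Hsrc, Hpoly, beta_. rewrite Et. ring.
Qed.

End Expansion.

(** * Standing waves *)

Lemma is_derive_pair (f g : R -> R) (x a b : R) : is_derive f x a -> is_derive g x b ->
  is_derive (V := C_R_NormedModule) (fun y => (f y, g y) : C) x (a, b).
Proof.
  intros Df Dg.
  assert (D := is_derive_plus (V := C_R_NormedModule) _ _ x _ _
    (is_derive_scal_l (V := C_R_NormedModule) f x a ((1, 0) : C) Df)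
    (is_derive_scal_l (V := C_R_NormedModule) g x b ((0, 1) : C) Dg)).
  replace ((a, b) : C) with (plus (G := C_R_NormedModule) (scal a ((1, 0) : C)) (scal b ((0, 1) : C))).
  - apply (is_derive_ext (V := C_R_NormedModule)) with (2 := D).
    intros y. unfold plus, scal; simpl. unfold prod_plus, prod_scal, plus, scal; simpl.
    unfold mult; simpl. f_equal; toR; ring.
  - unfold plus, scal; simpl. unfold prod_plus, prod_scal, plus, scal; simpl.
    unfold mult; simpl. f_equal; toR; ring.
Qed.

Lemma Cmod_standing (w : R) (f : R -> R) (t x : R) : Cmod (standing w f t x) ^ 2 = f x ^ 2.
Proof.
  unfold Cmod, standing; simpl fst; simpl snd. rewrite pow2_sqrt.
  - assert (E := sin2_cos2 (w * t)). unfold Rsqr in E.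
    transitivity ((sin (w * t) * sin (w * t) + cos (w * t) * cos (w * t)) * f x ^ 2); [ring|].
    rewrite E. ring.
  - pose proof (pow2_ge_0 (cos (w * t) * f x)). pose proof (pow2_ge_0 (sin (w * t) * f x)). lra.
Qed.

Definition standing_t (w : R) (f : R -> R) (t x : R) : C :=
  (- w * sin (w * t) * f x, w * cos (w * t) * f x).

Lemma is_derive_standing_t (w : R) (f : R -> R) (t x : R) :
  is_derive (V := C_R_NormedModule) (fun t' => standing w f t' x) t (standing_t w f t x).
Proof. unfold standing, standing_t. apply is_derive_pair; auto_derive; try easy; ring. Qed.

Lemma is_derive_standing_x (w : R) (f f' : R -> R) (t x : R) : is_derive f x (f' x) ->
  is_derive (V := C_R_NormedModule) (standing w f t) x (standing w f' t x).
Proof.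
  intros D. unfold standing. apply is_derive_pair.
  - apply (is_derive_scal f); exact D.
  - apply (is_derive_scal f); exact D.
Qed.

Lemma homoclinic_solitary (s b b2 : R) (U V : R -> R) :
  homoclinic s b b2 U V -> solitary_wave s b b2 U V.
Proof.
  intros H. destruct (homoclinic_ode _ _ _ _ _ H) as [D1 [D2 [D3 D4]]].
  exists (standing_t 1 U), (standing 1 (Derive U)),
    (standing 1 (fun x => U x - (U x ^ 2 + b * V x ^ 2) * U x)),
    (standing_t s V), (standing s (Derive V)),
    (standing s (fun x => s * V x - (b * U x ^ 2 + b2 * V x ^ 2) * V x)).
  intros t x. split; [apply is_derive_standing_t|].
  split; [apply is_derive_standing_x, D1|].
  split; [apply (is_derive_standing_x 1 (Derive U) (fun x => U x - (U x ^ 2 + b * V x ^ 2) * U x)), D2|].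
  split; [apply is_derive_standing_t|].
  split; [apply is_derive_standing_x, D3|].
  split; [apply (is_derive_standing_x s (Derive V) (fun x => s * V x - (b * U x ^ 2 + b2 * V x ^ 2) * V x)), D4|].
  rewrite !Cmod_standing. unfold standing, standing_t, Ci, RtoC, Cmult, Cplus; simpl.
  split; f_equal; ring.
Qed.

(** * Solutions near the fundamental wave *)

(** Having the least bound as a number allows absorption: a pointwise estimate by n / 2 + c yields n
    <= n / 2 + c. *)
Lemma sup_norm (f : R -> R) (B : R) : (forall x, Rabs (f x) <= B) ->
  exists n, 0 <= n /\ (forall x, Rabs (f x) <= n) /\
    forall n', (forall x, Rabs (f x) <= n') -> n <= n'.
Proof.
  intros H. destruct (completeness (fun y => exists x, y = Rabs (f x))) as [n [Hn Hl]].
  - exists B. intros y [x ->]. apply H.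
  - exists (Rabs (f 0)). now exists 0.
  - exists n. split; [|split].
    + eapply Rle_trans; [apply Rabs_pos|apply (Hn (Rabs (f 0))); now exists 0].
    + intros x. apply Hn. now exists x.
    + intros n' H'. apply Hl. intros y [x ->]. apply H'.
Qed.

Lemma parity_derive (sg : R) (f f' : R -> R) : (forall x, is_derive f x (f' x)) -> parity sg f ->
  parity (- sg) f'.
Proof.
  intros D P x.
  assert (D1 : is_derive (fun y => f (- y)) x (- f' (- x))).
  { assert (D0 := D (- x)). auto_derive; [dside|]. dsub D0. ring. }
  assert (D2 : is_derive (fun y => f (- y)) x (sg * f' x)).
  { apply (is_derive_ext (fun y => sg * f y)); [intros; now rewrite P|].
    apply (is_derive_scal f). apply D. }
  apply is_derive_unique in D1, D2. rewrite D1 in D2. lra.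
Qed.

(** The differential equations with named derivatives, a form convenient for translating and
    reflecting solutions. *)
Definition profile (s b b2 : R) (U U' V V' : R -> R) : Prop :=
  (forall x, is_derive U x (U' x)) /\
  (forall x, is_derive U' x (U x - (U x ^ 2 + b * V x ^ 2) * U x)) /\
  (forall x, is_derive V x (V' x)) /\
  (forall x, is_derive V' x (s * V x - (b * U x ^ 2 + b2 * V x ^ 2) * V x)).

Lemma is_derive_shift (f : R -> R) (c x l : R) : is_derive f (x + c) l ->
  is_derive (fun y => f (y + c)) x l.
Proof. intros D. auto_derive; [dside|]. dsub D. ring. Qed.

Lemma is_derive_reflect (f : R -> R) (c x l : R) : is_derive f (- x) l ->
  is_derive (fun y => c * f (- y)) x (- c * l).
Proof. intros D. auto_derive; [dside|]. dsub D. ring. Qed.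

Lemma profile_shift (s b b2 c : R) (U U' V V' : R -> R) : profile s b b2 U U' V V' ->
  profile s b b2 (fun x => U (x + c)) (fun x => U' (x + c)) (fun x => V (x + c)) (fun x => V' (x + c)).
Proof.
  intros [A [B [C D]]]. split; [|split; [|split]]; intros x; apply is_derive_shift; auto.
Qed.

Lemma profile_reflect (s b b2 sg : R) (U U' V V' : R -> R) : sg * sg = 1 ->
  profile s b b2 U U' V V' ->
  profile s b b2 (fun x => 1 * U (- x)) (fun x => - (1) * U' (- x))
    (fun x => sg * V (- x)) (fun x => - sg * V' (- x)).
Proof.
  intros Hs [A [B [C D]]].
  assert (E : forall y, (sg * y) ^ 2 = y ^ 2).
  { intros y. transitivity ((sg * sg) * y ^ 2); [ring|]. rewrite Hs. ring. }
  split; [|split; [|split]]; intros x.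
  - apply (is_derive_reflect U 1), A.
  - eapply is_derive_eq; [apply (is_derive_reflect U' (- (1))), B|]. rewrite E. ring.
  - apply (is_derive_reflect V sg), C.
  - eapply is_derive_eq; [apply (is_derive_reflect V' (- sg)), D|]. rewrite E. ring.
Qed.

Lemma U0_le_2 (x : R) : 0 < U0 x <= 2.
Proof.
  split; [apply U0_pos|]. unfold U0. pose proof (sech_le_1 x). pose proof (sech_pos x).
  assert (sqrt 2 <= 2).
  { rewrite <- (sqrt_Rsqr 2) at 2 by lra. apply sqrt_le_1; unfold Rsqr; lra. }
  pose proof (sqrt_pos 2). nra.
Qed.

Lemma U0_max (r : R) : 0 < r -> U0 r < U0 0.
Proof.
  intros Hr. unfold U0. apply Rmult_lt_compat_l; [apply sqrt_lt_R0; lra|].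
  assert (E0 : sech 0 = 1) by (unfold sech; rewrite cosh_0; apply Rinv_1). rewrite E0.
  assert (H := sech_le_1 r). destruct H as [H|H]; [easy|exfalso].
  assert (T := tanh_sq r). rewrite H in T.
  assert (Z : tanh r = 0) by nra. unfold tanh in Z. pose proof (cosh_pos r).
  assert (0 < sinh r).
  { unfold sinh. assert (exp (- r) < exp r) by (apply exp_increasing; lra). lra. }
  assert (0 < sinh r / cosh r) by (apply Rdiv_lt_0_compat; lra). lra.
Qed.

Lemma U0_lipschitz (x c : R) : Rabs (U0 (x + c) - U0 x) <= 2 * Rabs c.
Proof.
  destruct (MVT_gen U0 x (x + c) U0') as [y [_ E]].
  - intros; apply is_derive_U0.
  - intros; apply continuity_pt_filterlim, cts_U0.
  - rewrite E. replace (x + c - x) with c by ring. rewrite Rabs_mult.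
    apply Rmult_le_compat_r; [apply Rabs_pos|].
    replace (U0' y) with (- (U0 y * tanh y)) by (unfold U0', U0; ring).
    rewrite Rabs_Ropp, Rabs_mult. pose proof (U0_le_2 y). rewrite (Rabs_pos_eq (U0 y)) by lra.
    pose proof (tanh_abs y). pose proof (Rabs_pos (tanh y)). nra.
Qed.

(* Removes the translation invariance: U is normalized to have a maximum at 0. *)
Lemma center (eps : R) : 0 < eps -> exists eta, 0 < eta /\ forall U V, near_U0 eta U V ->
  (forall x, ex_derive U x) -> exists c, Derive U c = 0 /\
    near_U0 eps (fun x => U (x + c)) (fun x => V (x + c)).
Proof.
  (* [U0] is 2-Lipschitz, so a shift by at most eps / 4 costs at most eps / 2. *)
  intros He. set (r := eps / 4). assert (Hr : 0 < r) by (unfold r; lra).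
  assert (G := U0_max r Hr). set (gap := U0 0 - U0 r).
  (* With eta <= gap / 3 the values of U at -r and r stay below U 0, so the maximum on [-r, r] is
     interior and a critical point. *)
  exists (Rmin (eps / 2) (gap / 3)). split; [apply Rmin_glb_lt; unfold gap; lra|].
  intros U V N DU. set (eta := Rmin (eps / 2) (gap / 3)) in *.
  assert (E1 : eta <= eps / 2) by apply Rmin_l. assert (E2 : eta <= gap / 3) by apply Rmin_r.
  destruct (continuity_ab_maj U (- r) r) as [c [Mc Hc]]; [lra| |].
  { intros y _. apply continuity_pt_filterlim. apply @ex_derive_continuous. apply DU. }
  assert (B : forall y, U0 y - eta <= U y <= U0 y + eta).
  { intros y. destruct (N y) as [H _]. apply Rabs_le_between in H. lra. }
  assert (Mc0 := Mc 0 ltac:(lra)). assert (B0 := B 0).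
  assert (Hc' : - r < c < r).
  { assert (X1 : c <> r) by (intros ->; specialize (B r); unfold gap in *; lra).
    assert (X2 : c <> - r).
    { intros ->. specialize (B (- r)). rewrite U0_even in B. unfold gap in *; lra. }
    lra. }
  exists c. split.
  - assert (pr : derivable_pt U c) by now apply ex_derive_Reals_0.
    rewrite <- (Derive_Reals U c pr).
    apply (deriv_maximum U (- r) r c pr); try lra. intros y Hy1 Hy2. apply Mc. lra.
  - intros x. split.
    + replace (U (x + c) - U0 x) with ((U (x + c) - U0 (x + c)) + (U0 (x + c) - U0 x)) by ring.
      eapply Rle_trans; [apply Rabs_triang|].
      assert (H := U0_lipschitz x c). destruct (N (x + c)) as [H' _].
      assert (Rabs c <= r) by (apply Rabs_le; lra). unfold r in *. lra.
    + destruct (N (x + c)) as [_ H']. lra.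
Qed.

Lemma green_bound0 (Q p p' q q' : R -> R) (mu C w : R) (g : R -> R) (K : R) :
  fsys Q p p' q q' mu C w -> cts g -> (forall x, 0 <= x -> Rabs (g x) <= K) ->
  forall x, 0 <= x -> Rabs (green p q w g x) <= green_const mu C w 0 * K.
Proof.
  intros S G B x Hx. assert (Hm := fs_mu S).
  assert (E : forall y, K * exp (- 0 * y) = K).
  { intros y. replace (- 0 * y) with 0 by ring. rewrite exp_0. ring. }
  eapply Rle_trans; [apply (green_bound S g K 0 G ltac:(lra))|].
  - intros y Hy. rewrite E. now apply B.
  - exact Hx.
  - rewrite (Rmult_assoc _ K), E. lra.
Qed.

Lemma U_equation (b m n : R) (u V y : R) : Rabs u <= n -> n <= 1 -> Rabs V <= m -> 0 < y <= 2 ->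
  Rabs (3 * y * u ^ 2 + u ^ 3 + b * V ^ 2 * (y + u)) <= 7 * n ^ 2 + 3 * Rabs b * m ^ 2.
Proof.
  intros Hu Hn HV Hy.
  assert (P1 := Rabs_pos u). assert (P2 := Rabs_pos V). assert (P3 := Rabs_pos b).
  assert (S1 : Rabs (u ^ 2) <= n ^ 2) by (rewrite <- RPow_abs; apply pow_incr; lra).
  assert (S2 : Rabs (V ^ 2) <= m ^ 2) by (rewrite <- RPow_abs; apply pow_incr; lra).
  assert (Q1 := Rabs_pos (u ^ 2)). assert (Q2 := Rabs_pos (V ^ 2)).
  assert (S3 : Rabs (y + u) <= 3).
  { eapply Rle_trans; [apply Rabs_triang|]. rewrite (Rabs_pos_eq y); lra. }
  eapply Rle_trans; [apply Rabs_triang|]. eapply Rle_trans; [apply Rplus_le_compat_r, Rabs_triang|].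
  replace (u ^ 3) with (u ^ 2 * u) by ring.
  rewrite !Rabs_mult, (Rabs_pos_eq 3), (Rabs_pos_eq y) by lra.
  assert (3 * y * Rabs (u ^ 2) <= 6 * n ^ 2) by (apply Rmult_le_compat; lra).
  assert (Rabs (u ^ 2) * Rabs u <= n ^ 2 * 1) by (apply Rmult_le_compat; lra).
  assert (Rabs b * Rabs (V ^ 2) * Rabs (y + u) <= Rabs b * m ^ 2 * 3).
  { apply Rmult_le_compat; [now apply Rmult_le_pos|apply Rabs_pos|apply Rmult_le_compat_l; lra|easy]. }
  lra.
Qed.

(** What remains of the first equation after linearizing at [U0]: quadratic in (U - U0, V). *)
Definition Usrc (b : R) (U V : R -> R) (x : R) : R :=
  3 * U0 x * (U x - U0 x) ^ 2 + (U x - U0 x) ^ 3 + b * V x ^ 2 * (U0 x + (U x - U0 x)).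

Lemma profile_cts (s b b2 : R) (U U' V V' : R -> R) : profile s b b2 U U' V V' -> cts U /\ cts V.
Proof. intros [A [_ [C _]]]. split; eapply cts_derive; eauto. Qed.

Lemma cts_Usrc (b : R) (U V : R -> R) : cts U -> cts V -> cts (Usrc b U V).
Proof. intros. unfold Usrc. pose proof cts_U0. cts_tac. Qed.

Lemma U_repr (s b b2 m : R) (U U' V V' : R -> R) : profile s b b2 U U' V V' -> U' 0 = 0 ->
  (forall x, Rabs (U x - U0 x) <= 1) -> (forall x, Rabs (V x) <= m) ->
  forall x, U x - U0 x = green phi12 phi11 (-1) (Usrc b U V) x.
Proof.
  intros P H0 BU BV. destruct (profile_cts _ _ _ _ _ _ _ P) as [cU cV].
  destruct P as [A [B _]].
  set (M := 8 + (7 * 1 ^ 2 + 3 * Rabs b * m ^ 2)).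
  assert (PM : 8 <= M).
  { unfold M. pose proof (Rabs_pos b). pose proof (pow2_ge_0 m).
    assert (0 <= Rabs b * m ^ 2) by now apply Rmult_le_pos. lra. }
  assert (D1 : forall x, is_derive (fun x => U x - U0 x) x (U' x - U0' x)).
  { intros x. apply (is_derive_minus U U0); [apply A|apply is_derive_U0]. }
  assert (D2 : forall x, is_derive (fun x => U' x - U0' x) x
     ((1 - 6 * sech x ^ 2) * (U x - U0 x) - Usrc b U V x)).
  { intros x. eapply is_derive_eq; [apply (is_derive_minus U' U0'); [apply B|apply is_derive_U0']|].
    unfold minus, plus, opp; simpl. replace (sech x * (sech x * 1)) with (U0 x ^ 2 / 2) by (rewrite U0_sq; field).
    unfold Usrc. field. }
  refine (proj2 (green_repr fsys_U (fun x => U x - U0 x) (fun x => U' x - U0' x)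
    (Usrc b U V) (3 * M) (cts_Usrc b U V cU cV) D1 D2 _ _) _).
  - intros x _. specialize (BU x). lra.
  - apply (derive_bounded _ _ _ M D1 D2).
    + intros x _. specialize (BU x). lra.
    + intros x _. eapply Rle_trans; [apply Rabs_triang|]. rewrite Rabs_Ropp, Rabs_mult.
      assert (X := U_equation b m 1 (U x - U0 x) (V x) (U0 x) (BU x) ltac:(lra) (BV x) (U0_le_2 x)).
      fold (Usrc b U V x) in X.
      assert (Y : Rabs (1 - 6 * sech x ^ 2) <= 8).
      { pose proof (sech_pos x). pose proof (sech_le_1 x). assert (0 <= sech x ^ 2 <= 1) by nra.
        apply Rabs_le. lra. }
      assert (Rabs (1 - 6 * sech x ^ 2) * Rabs (U x - U0 x) <= 8 * 1) by
        (apply Rmult_le_compat; auto using Rabs_pos).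
      unfold M. lra.
  (* The normalization U'(0) = 0 is used here: with U0'(0) = phi11'(0) = 0 it gives the condition at
     0 that excludes the translation mode. *)
  - cbv beta. rewrite H0. unfold U0', phi11', sech, tanh.
    rewrite sinh_0. unfold Rdiv. ring.
Qed.

(** The supremum n of |U - U0| satisfies n <= G (7 n^2 + 3 B m^2); if n <= 1 / (14 G + 1), the
    quadratic term is at most n / 2 and is absorbed. *)
Lemma U_estimate (B : R) : 0 <= B -> exists C eta, 0 <= C /\ 0 < eta <= 1 /\
  forall s b b2 m U U' V V', profile s b b2 U U' V V' -> Rabs b <= B -> U' 0 = 0 ->
  (forall x, Rabs (U x - U0 x) <= eta) -> (forall x, Rabs (V x) <= m) ->
  forall x, Rabs (U x - U0 x) <= C * m ^ 2.
Proof.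
  intros HB.
  assert (PG := green_const_pos fsys_U 0 ltac:(lra)).
  set (G := green_const 1 6 (-1) 0) in *.
  assert (E14 : 0 < / (14 * G + 1) <= 1).
  { split; [apply Rinv_0_lt_compat; lra|]. rewrite <- Rinv_1. apply Rinv_le_contravar; lra. }
  exists (6 * G * B), (/ (14 * G + 1)).
  split; [apply Rmult_le_pos; lra|]. split; [easy|].
  intros s b b2 m U U' V V' P Hb H0 BU BV.
  destruct (sup_norm _ _ BU) as [n [Pn [Bn Ln]]].
  assert (Hn : n <= / (14 * G + 1)) by now apply Ln.
  assert (Half : forall U U' V V', profile s b b2 U U' V V' -> U' 0 = 0 ->
    (forall x, Rabs (U x - U0 x) <= n) -> (forall x, Rabs (V x) <= m) ->
    forall x, 0 <= x -> Rabs (U x - U0 x) <= G * (7 * n ^ 2 + 3 * B * m ^ 2)).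
  { clear U U' V V' P H0 BU BV Bn Ln. intros U U' V V' P H0 BU BV x Hx.
    destruct (profile_cts _ _ _ _ _ _ _ P) as [cU cV].
    rewrite (U_repr s b b2 m U U' V V' P H0) by (auto; intros y; specialize (BU y); lra).
    apply (green_bound0 _ _ _ _ _ _ _ _ _ _ fsys_U (cts_Usrc b U V cU cV)); [|easy].
    intros y _. eapply Rle_trans; [apply (U_equation b m n); auto; [lra|apply U0_le_2]|].
    pose proof (pow2_ge_0 m). assert (Rabs b * m ^ 2 <= B * m ^ 2) by (apply Rmult_le_compat_r; lra). lra. }
  assert (All : forall x, Rabs (U x - U0 x) <= G * (7 * n ^ 2 + 3 * B * m ^ 2)).
  { intros x. destruct (Rle_dec 0 x) as [Hx|Hx]; [now apply (Half U U' V V')|].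
    replace (U x - U0 x) with (1 * U (- - x) - U0 (- x)) by (rewrite Ropp_involutive, U0_even; ring).
    apply (Half (fun x => 1 * U (- x)) (fun x => - (1) * U' (- x)) (fun x => 1 * V (- x)) (fun x => - (1) * V' (- x))).
    - apply profile_reflect; [ring|easy].
    - rewrite Ropp_0, H0. ring.
    - intros y. rewrite Rmult_1_l, <- (U0_even y). apply Bn.
    - intros y. rewrite Rmult_1_l. apply BV.
    - lra. }
  assert (X := Ln _ All).
  assert (Y : 7 * G * n <= / 2).
  { apply Rle_trans with (7 * G * / (14 * G + 1)); [apply Rmult_le_compat_l; lra|].
    apply Rmult_le_reg_r with (14 * G + 1); [lra|]. rewrite Rmult_assoc, Rinv_l; lra. }
  intros x. eapply Rle_trans; [apply Bn|].
  assert (n <= / 2 * n + 3 * G * B * m ^ 2); [|lra].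
  replace (G * (7 * n ^ 2 + 3 * B * m ^ 2)) with ((7 * G * n) * n + 3 * G * B * m ^ 2) in X by ring.
  assert ((7 * G * n) * n <= / 2 * n) by (apply Rmult_le_compat_r; lra). lra.
Qed.

(** * Absence of solutions on the wrong side *)

Lemma V_equation (delta b b2 m n : R) (u V y : R) : Rabs u <= n -> n <= 1 -> Rabs V <= m ->
  0 < y <= 2 ->
  Rabs (delta * y ^ 2 * V + b * (2 * y * u + u ^ 2) * V + b2 * V ^ 3)
  <= (4 * Rabs delta + 5 * Rabs b * n + Rabs b2 * m ^ 2) * m.
Proof.
  intros Hu Hn HV Hy.
  assert (P1 := Rabs_pos u). assert (P2 := Rabs_pos V). assert (P3 := Rabs_pos b).
  assert (P4 := Rabs_pos delta). assert (P5 := Rabs_pos b2).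
  assert (S2 : Rabs (V ^ 2) <= m ^ 2) by (rewrite <- RPow_abs; apply pow_incr; lra).
  assert (Q2 := Rabs_pos (V ^ 2)).
  assert (S3 : Rabs (2 * y * u + u ^ 2) <= 5 * n).
  { eapply Rle_trans; [apply Rabs_triang|]. replace (u ^ 2) with (u * u) by ring.
    rewrite !Rabs_mult, (Rabs_pos_eq 2), (Rabs_pos_eq y) by lra.
    assert (2 * y * Rabs u <= 4 * n) by (apply Rmult_le_compat; lra).
    assert (Rabs u * Rabs u <= 1 * n) by (apply Rmult_le_compat; lra). lra. }
  assert (Q3 := Rabs_pos (2 * y * u + u ^ 2)).
  assert (S4 : 0 <= y ^ 2 <= 4) by nra.
  eapply Rle_trans; [apply Rabs_triang|]. eapply Rle_trans; [apply Rplus_le_compat_r, Rabs_triang|].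
  replace (V ^ 3) with (V ^ 2 * V) by ring.
  rewrite (Rabs_mult (delta * y ^ 2)), (Rabs_mult delta), (Rabs_mult (b * _)), (Rabs_mult b), (Rabs_mult b2),
    (Rabs_mult (V ^ 2)), (Rabs_pos_eq (y ^ 2)) by lra.
  assert (Rabs delta * y ^ 2 * Rabs V <= (Rabs delta * 4) * m).
  { apply Rmult_le_compat; [apply Rmult_le_pos; lra|easy|apply Rmult_le_compat_l; lra|easy]. }
  assert (Rabs b * Rabs (2 * y * u + u ^ 2) * Rabs V <= (Rabs b * (5 * n)) * m).
  { apply Rmult_le_compat; [apply Rmult_le_pos; lra|easy|apply Rmult_le_compat_l; lra|easy]. }
  assert (Rabs b2 * (Rabs (V ^ 2) * Rabs V) <= Rabs b2 * (m ^ 2 * m)).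
  { apply Rmult_le_compat_l; [easy|]. apply Rmult_le_compat; easy. }
  lra.
Qed.

Section ReducedPolynomials.
Variables (bc beta2 : R).

(** Here slot 0 is delta and slot 1 is a^2, for U = U0 + a^2 u and V = a (v + w) with [w] not
    rescaled further, since it is only known to be O(|delta| + a^2). *)
Definition N2poly (e : nat -> R) : R :=
  (bc + e 0%nat) * ((e 4%nat + e 3%nat) * (e 4%nat + e 3%nat) * e 5%nat)
  + e 1%nat * (3 * e 5%nat * e 2%nat * e 2%nat + e 1%nat * e 2%nat * e 2%nat * e 2%nat
     + (bc + e 0%nat) * ((e 4%nat + e 3%nat) * (e 4%nat + e 3%nat) * e 2%nat)).

Definition H2poly (e : nat -> R) : R :=
  2 * (bc + e 0%nat) * (e 5%nat * e 2%nat * (e 4%nat + e 3%nat))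
  + e 1%nat * (bc + e 0%nat) * (e 2%nat * e 2%nat * (e 4%nat + e 3%nat))
  + beta2 * ((e 4%nat + e 3%nat) * (e 4%nat + e 3%nat) * (e 4%nat + e 3%nat)).

Lemma tame_N2 : tame true N2poly.
Proof. unfold N2poly. tame_tac. Qed.
Lemma tame_H2 : tame true H2poly.
Proof. unfold H2poly. tame_tac. Qed.

End ReducedPolynomials.

Section Nonexistence.
Variables (s beta2 : R) (l : nat) (V1' q q' : R -> R) (CV w0 : R).
Hypothesis hs : 0 < s.
Let mu := sqrt s.
Let v := V1 s l.
Let bc := beta1c s l.
Let sg := psign l.
Hypothesis SV : fsys (QV mu (mu + INR l)) v V1' q q' mu CV w0.
Hypothesis Pv : parity sg v.
Hypothesis Pq : parity (- sg) q.

Let cv : cts v := cts_derive _ _ (fs_p SV).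
Let C0 : 0 <= CV := fs_C SV.
Let w00 : w0 <> 0 := fs_w SV.
Let mu0 : 0 < mu := fs_mu SV.
Let sg2 : sg * sg = 1 := psign_sq l.

Lemma exp_le_1 (x : R) : 0 <= x -> exp (- mu * x) <= 1.
Proof. intros Hx. rewrite <- exp_0. apply exp_le_compat. nra. Qed.

Lemma V1_le (x : R) : Rabs (v x) <= CV.
Proof.
  eapply Rle_trans; [apply (V1_rho s l V1' q q' CV w0 hs SV Pv)|].
  pose proof (rho_bounds (kap s) x (Rlt_le _ _ (proj1 (kap_bounds s hs)))). nra.
Qed.

Lemma V1'_le (x : R) : 0 <= x -> Rabs (V1' x) <= CV.
Proof.
  intros Hx. eapply Rle_trans; [apply (fs_pb' SV x Hx)|].
  pose proof (exp_le_1 x Hx). nra.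
Qed.

Definition Vsrc (delta : R) (U V : R -> R) (x : R) : R :=
  delta * U0 x ^ 2 * V x
  + (beta1c s l + delta) * (2 * U0 x * (U x - U0 x) + (U x - U0 x) ^ 2) * V x + beta2 * V x ^ 3.

Lemma cts_Vsrc (delta : R) (U V : R -> R) : cts U -> cts V -> cts (Vsrc delta U V).
Proof. intros. unfold Vsrc. pose proof cts_U0. cts_tac. Qed.

(** The coefficient a for which V - a V1 meets the condition at 0 of [green_repr], a Wronskian with
    the growing solution. *)
Definition amplitude (V V' : R -> R) : R := - (q 0 * V' 0 - q' 0 * V 0) / w0.

Lemma V_repr (delta m : R) (U U' V V' : R -> R) :
  profile s (bc + delta) beta2 U U' V V' ->
  (forall x, Rabs (U x - U0 x) <= 1) -> (forall x, Rabs (V x) <= m) ->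
  let a := amplitude V V' in
  (forall x, V x - a * v x = green v q w0 (Vsrc delta U V) x) /\
  I0 (fun x => v x * Vsrc delta U V x) = v 0 * V' 0 - V1' 0 * V 0.
Proof.
  intros P BU BV a. destruct (profile_cts _ _ _ _ _ _ _ P) as [cU cV].
  destruct P as [_ [_ [A B]]].
  assert (D1 : forall x, is_derive (fun x => V x - a * v x) x (V' x - a * V1' x)).
  { intros x. assert (E1 := A x). assert (E2 := fs_p SV x). auto_derive; [dside|].
    dsub E1. dsub E2. ring. }
  assert (D2 : forall x, is_derive (fun x => V' x - a * V1' x) x
     (QV mu (mu + INR l) x * (V x - a * v x) - Vsrc delta U V x)).
  { intros x. assert (E1 := B x). assert (E2 := fs_p' SV x). auto_derive; [dside|].
    dsub E1. dsub E2. unfold mu. rewrite QV_beta by easy. unfold Vsrc. fold bc. ring. }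
  assert (Pm : 0 <= m) by (eapply Rle_trans; [apply Rabs_pos|apply (BV 0)]).
  set (S1 := s + Rabs bc * 4).
  set (M := S1 * m + (4 * Rabs delta + 5 * Rabs (bc + delta) * 1 + Rabs beta2 * m ^ 2) * m).
  assert (PS1 : 0 <= S1) by (unfold S1; pose proof (Rabs_pos bc); lra).
  assert (BM : forall x, Rabs (Vsrc delta U V x) <= (4 * Rabs delta + 5 * Rabs (bc + delta) * 1 + Rabs beta2 * m ^ 2) * m).
  { intros x. apply V_equation; auto; [lra|apply U0_le_2]. }
  assert (PM : 0 <= (4 * Rabs delta + 5 * Rabs (bc + delta) * 1 + Rabs beta2 * m ^ 2) * m)
    by (eapply Rle_trans; [apply Rabs_pos|apply (BM 0)]).
  assert (BV' : forall x, 0 <= x -> Rabs (V' x) <= 3 * (m + M)).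
  { apply (derive_bounded V V' (fun x => QV mu (mu + INR l) x * V x - Vsrc delta U V x)).
    - exact A.
    - intros x. eapply is_derive_eq; [apply B|]. unfold mu; rewrite QV_beta by easy. unfold Vsrc. fold bc. ring.
    - intros x _. specialize (BV x). assert (0 <= S1 * m) by now apply Rmult_le_pos. unfold M. lra.
    - intros x _. eapply Rle_trans; [apply Rabs_triang|]. rewrite Rabs_Ropp, Rabs_mult.
      assert (Y : Rabs (QV mu (mu + INR l) x) <= S1).
      { unfold mu; rewrite QV_beta by easy. fold bc. eapply Rle_trans; [apply Rabs_triang|].
        rewrite Rabs_Ropp, Rabs_mult, (Rabs_pos_eq s) by lra. unfold S1.
        pose proof (U0_le_2 x). assert (Z : 0 <= U0 x ^ 2 <= 4) by nra. rewrite (Rabs_pos_eq (U0 x ^ 2)) by lra.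
        pose proof (Rabs_pos bc). assert (Rabs bc * U0 x ^ 2 <= Rabs bc * 4) by (apply Rmult_le_compat_l; lra). lra. }
      assert (Rabs (QV mu (mu + INR l) x) * Rabs (V x) <= S1 * m) by (apply Rmult_le_compat; auto using Rabs_pos).
      specialize (BM x). unfold M. lra. }
  assert (Pa := Rabs_pos a).
  destruct (green_repr SV (fun x => V x - a * v x) (fun x => V' x - a * V1' x)
    (Vsrc delta U V) (3 * (m + M) + m + Rabs a * CV) (cts_Vsrc delta U V cU cV) D1 D2) as [E1 E2].
  - intros x _. eapply Rle_trans; [apply Rabs_triang|]. rewrite Rabs_Ropp, Rabs_mult.
    assert (Rabs a * Rabs (v x) <= Rabs a * CV) by (apply Rmult_le_compat_l; [easy|apply V1_le]).
    specialize (BV x). assert (0 <= S1 * m) by now apply Rmult_le_pos. unfold M. lra.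
  - intros x Hx. eapply Rle_trans; [apply Rabs_triang|]. rewrite Rabs_Ropp, Rabs_mult.
    assert (Rabs a * Rabs (V1' x) <= Rabs a * CV) by (apply Rmult_le_compat_l; [easy|now apply V1'_le]).
    specialize (BV' x Hx). lra.
  - assert (W := fs_W SV 0). split.
    + apply E2. transitivity ((q 0 * V' 0 - q' 0 * V 0) + a * (v 0 * q' 0 - V1' 0 * q 0)); [ring|].
      rewrite W. unfold a, amplitude. field. exact w00.
    + rewrite E1. ring.
Qed.

Lemma amplitude_reflect (V V' : R -> R) :
  amplitude (fun x => sg * V (- x)) (fun x => - sg * V' (- x)) = amplitude V V'.
Proof.
  assert (H1 := Pq 0). assert (Pq' := parity_derive _ _ _ (fs_q SV) Pq 0).
  rewrite Ropp_0 in H1, Pq'. unfold amplitude. rewrite Ropp_0. f_equal. f_equal.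
  transitivity ((- sg * q 0) * V' 0 - (- - sg * q' 0) * V 0); [ring|]. rewrite <- H1, <- Pq'. reflexivity.
Qed.

(** Under V(x) -> sg V(-x) the Wronskian with [q], of parity -sg, is invariant, while the one with
    [V1], of parity sg, changes sign. So both half lines share the amplitude and have opposite
    boundary terms. *)
Lemma boundary_reflect (V V' : R -> R) :
  v 0 * (- sg * V' (- 0)) - V1' 0 * (sg * V (- 0)) = - (v 0 * V' 0 - V1' 0 * V 0).
Proof.
  assert (H1 := Pv 0). assert (Pv' := parity_derive _ _ _ (fs_p SV) Pv 0).
  rewrite Ropp_0 in *. 
  transitivity (- (sg * v 0) * V' 0 + (- sg * V1' 0) * V 0); [ring|]. rewrite <- H1, <- Pv'. ring.
Qed.

Let B := Rabs bc + 1.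

(** With m the supremum of |V|, variation of constants gives |V - a V1| <= G C2 h m <= m / 2, hence
    m <= 2 CV |a|. So a is nonzero and every bound in m becomes one in |a|. The last clause later
    bounds a by the size of V. *)
Lemma V_estimate : exists C eta, 0 <= C /\ 0 < eta <= 1 /\
  forall delta U U' V V', profile s (bc + delta) beta2 U U' V V' -> U' 0 = 0 -> Rabs delta <= eta ->
  (forall x, Rabs (U x - U0 x) <= eta) -> (forall x, Rabs (V x) <= eta) -> (exists x, V x <> 0) ->
  let a := amplitude V V' in
  a <> 0 /\ (forall x, Rabs (U x - U0 x) <= C * a ^ 2) /\ (forall x, Rabs (V x) <= C * Rabs a) /\
  (forall x, Rabs (V x - a * v x) <= C * (Rabs delta + a ^ 2) * Rabs a) /\
  (forall n, (forall x, Rabs (V x) <= n) -> forall x, Rabs (V x - a * v x) <= n).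
Proof.
  assert (PB : 1 <= B) by (unfold B; pose proof (Rabs_pos bc); lra).
  destruct (U_estimate B ltac:(lra)) as [C1 [eta1 [PC1 [Pe1 HU]]]].
  assert (PG := green_const_pos SV 0 ltac:(lra)).
  set (G := green_const mu CV w0 0) in *.
  set (C2 := 4 + 5 * B * C1 + Rabs beta2).
  assert (PC2 : 4 <= C2).
  { unfold C2. pose proof (Rabs_pos beta2). assert (0 <= 5 * B * C1) by (apply Rmult_le_pos; lra). lra. }
  assert (PGC : 0 <= G * C2) by (apply Rmult_le_pos; lra).
  (* Since h <= 2 eta2, this gives G C2 h <= 1/2. *)
  set (eta2 := / (4 * (G * C2) + 1)).
  assert (E2 : 0 < eta2 <= 1).
  { unfold eta2. split; [apply Rinv_0_lt_compat; lra|]. rewrite <- Rinv_1. apply Rinv_le_contravar; lra. }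
  assert (E2' : G * C2 * (2 * eta2) <= / 2).
  { apply Rmult_le_reg_r with (4 * (G * C2) + 1); [lra|].
    replace (G * C2 * (2 * eta2) * (4 * (G * C2) + 1)) with (2 * (G * C2) * (eta2 * (4 * (G * C2) + 1))) by ring.
    unfold eta2 at 1. rewrite Rinv_l; lra. }
  set (D := (2 * CV) ^ 2). assert (PD : 0 <= D) by apply pow2_ge_0.
  set (C := C1 * D + 2 * CV + G * C2 * (1 + D) * (2 * CV)).
  assert (Z1 : 0 <= C1 * D) by now apply Rmult_le_pos.
  assert (Z3 : 0 <= G * C2 * (1 + D) * (2 * CV)) by (apply Rmult_le_pos; [apply Rmult_le_pos|]; lra).
  exists C, (Rmin eta1 eta2). split; [unfold C; lra|]. split.
  { split; [apply Rmin_glb_lt; lra|]. pose proof (Rmin_l eta1 eta2). lra. }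
  intros delta U U' V V' P H0 Hd BU BV [x0 Hx0] a.
  assert (M1 := Rmin_l eta1 eta2). assert (M2 := Rmin_r eta1 eta2).
  destruct (sup_norm _ _ BV) as [m [Pm [Bm Lm]]].
  assert (Hm : m <= eta2) by (apply Lm; intros x; specialize (BV x); lra).
  assert (Hb : Rabs (bc + delta) <= B).
  { eapply Rle_trans; [apply Rabs_triang|]. unfold B. lra. }
  assert (BU1 : forall x, Rabs (U x - U0 x) <= C1 * m ^ 2).
  { apply (HU s (bc + delta) beta2 m U U' V V'); auto. intros x; specialize (BU x); lra. }
  assert (Pd := Rabs_pos delta). assert (Pa := Rabs_pos a).
  set (h := Rabs delta + m ^ 2).
  assert (Ph : 0 <= h) by (unfold h; pose proof (pow2_ge_0 m); lra).
  assert (Half : forall U U' V V', profile s (bc + delta) beta2 U U' V V' ->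
    (forall x, Rabs (U x - U0 x) <= C1 * m ^ 2) -> (forall x, Rabs (U x - U0 x) <= 1) ->
    (forall x, Rabs (V x) <= m) -> forall x, 0 <= x ->
    Rabs (V x - amplitude V V' * v x) <= G * (C2 * h * m)).
  { clear U U' V V' P H0 BU BV x0 Hx0 a Pa Bm Lm BU1. intros U U' V V' P B1 B2 B3 x Hx.
    rewrite (proj1 (V_repr delta m U U' V V' P B2 B3)).
    destruct (profile_cts _ _ _ _ _ _ _ P) as [cU cV].
    apply (green_bound0 _ _ _ _ _ _ _ _ _ _ SV (cts_Vsrc delta U V cU cV)); [|easy].
    intros y _.
    assert (B4 : Rabs (U y - U0 y) <= Rmin (C1 * m ^ 2) 1) by (apply Rmin_glb; auto).
    eapply Rle_trans; [apply (V_equation delta (bc + delta) beta2 m (Rmin (C1 * m ^ 2) 1)); auto; [apply Rmin_r|apply U0_le_2]|].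
    apply Rmult_le_compat_r; [easy|].
    assert (Rabs (bc + delta) * Rmin (C1 * m ^ 2) 1 <= B * (C1 * m ^ 2)).
    { apply Rmult_le_compat; [apply Rabs_pos| |easy|apply Rmin_l]. apply Rmin_glb; [|lra].
      apply Rmult_le_pos; [easy|apply pow2_ge_0]. }
    assert (0 <= (5 * B * C1 + Rabs beta2) * Rabs delta).
    { apply Rmult_le_pos; [|easy]. pose proof (Rabs_pos beta2).
      assert (0 <= 5 * B * C1) by (apply Rmult_le_pos; lra). lra. }
    pose proof (pow2_ge_0 m). unfold C2, h. lra. }
  assert (BU2 : forall x, Rabs (U x - U0 x) <= 1) by (intros x; specialize (BU x); lra).
  assert (All : forall x, Rabs (V x - a * v x) <= G * (C2 * h * m)).
  { intros x. destruct (Rle_dec 0 x) as [Hx|Hx]; [now apply (Half U U' V V')|].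
    assert (Asg := abs_sign sg sg2).
    assert (X := Half _ _ _ _ (profile_reflect _ _ _ sg _ _ _ _ sg2 P)
      ltac:(intros y; cbv beta; rewrite Rmult_1_l, <- (U0_even y); apply BU1)
      ltac:(intros y; cbv beta; rewrite Rmult_1_l, <- (U0_even y); apply BU2)
      ltac:(intros y; cbv beta; rewrite Rabs_mult, Asg, Rmult_1_l; apply Bm)
      (- x) ltac:(lra)).
    rewrite amplitude_reflect, Ropp_involutive, Pv in X; fold a in X.
    replace (sg * V x - a * (sg * v x)) with (sg * (V x - a * v x)) in X by ring.
    rewrite Rabs_mult, Asg, Rmult_1_l in X. exact X. }
  assert (Hh : h <= 2 * eta2).
  { unfold h. assert (m ^ 2 <= 1 * eta2); [|lra]. replace (m ^ 2) with (m * m) by ring.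
    apply Rmult_le_compat; lra. }
  assert (Hsm : G * (C2 * h * m) <= / 2 * m).
  { replace (G * (C2 * h * m)) with (G * C2 * h * m) by ring. apply Rmult_le_compat_r; [easy|].
    assert (G * C2 * h <= G * C2 * (2 * eta2)) by (apply Rmult_le_compat_l; lra). lra. }
  assert (Hma : m <= 2 * CV * Rabs a).
  { assert (m <= Rabs a * CV + / 2 * m); [|lra]. apply Lm. intros x.
    replace (V x) with (a * v x + (V x - a * v x)) by ring. eapply Rle_trans; [apply Rabs_triang|].
    rewrite Rabs_mult. assert (Rabs a * Rabs (v x) <= Rabs a * CV) by (apply Rmult_le_compat_l; [easy|apply V1_le]).
    specialize (All x). lra. }
  assert (Pm' : 0 < m).
  { apply Rabs_pos_lt in Hx0. specialize (Bm x0). lra. }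
  assert (Hm2 : m ^ 2 <= D * a ^ 2).
  { unfold D. rewrite <- Rpow_mult_distr, <- (pow2_abs (2 * CV * a)). apply pow_incr.
    split; [easy|]. rewrite Rabs_mult, (Rabs_pos_eq (2 * CV)) by lra. exact Hma. }
  assert (Pa2 := pow2_ge_0 a).
  split; [|split; [|split; [|split]]].
  - intros E. rewrite E, Rabs_R0 in Hma. lra.
  - intros x. eapply Rle_trans; [apply BU1|].
    assert (C1 * m ^ 2 <= C1 * (D * a ^ 2)) by (apply Rmult_le_compat_l; easy).
    assert (0 <= (2 * CV + G * C2 * (1 + D) * (2 * CV)) * a ^ 2) by (apply Rmult_le_pos; lra).
    unfold C. lra.
  - intros x. eapply Rle_trans; [apply Bm|]. 
    assert (0 <= (C1 * D + G * C2 * (1 + D) * (2 * CV)) * Rabs a) by (apply Rmult_le_pos; lra).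
    unfold C. lra.
  - intros x. eapply Rle_trans; [apply All|].
    assert (Hh' : h <= (1 + D) * (Rabs delta + a ^ 2)).
    { unfold h. assert (0 <= D * Rabs delta) by now apply Rmult_le_pos. lra. }
    assert (X : G * C2 * h * m <= G * C2 * ((1 + D) * (Rabs delta + a ^ 2)) * (2 * CV * Rabs a)).
    { apply Rmult_le_compat; [now apply Rmult_le_pos|easy|apply Rmult_le_compat_l; easy|easy]. }
    assert (0 <= (C1 * D + 2 * CV) * ((Rabs delta + a ^ 2) * Rabs a)).
    { apply Rmult_le_pos; [lra|]. apply Rmult_le_pos; lra. }
    unfold C. lra.
  - intros n Hn x. specialize (All x). specialize (Lm n Hn). lra.
Qed.

Lemma green_U_scal (c : R) (g : R -> R) (K x : R) : cts g -> (forall y, 0 <= y -> Rabs (g y) <= K) ->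
  green phi12 phi11 (-1) (fun y => c * g y) x = c * green phi12 phi11 (-1) g x.
Proof.
  intros G Bg.
  assert (Cv : conv (fun y => phi12 y * g y)).
  { apply (conv_pg fsys_U g K 0 G ltac:(lra)).
    intros y Hy. replace (- 0 * y) with 0 by ring. rewrite exp_0, Rmult_1_r. auto. }
  assert (Sc : forall p, cts p -> RInt (fun y => p y * (c * g y)) 0 x = c * RInt (fun y => p y * g y) 0 x).
  { intros p Cp. rewrite (RInt_ext _ (fun y => scal c (p y * g y))).
    - apply (RInt_scal (fun y => p y * g y)). apply cts_ex_RInt. cts_tac.
    - intros y _. toR. unfold scal; simpl; unfold mult; simpl. ring. }
  unfold green. rewrite (I0_ext _ (fun y => c * (phi12 y * g y))) by (intros; ring).
  rewrite (I0_scal c _ Cv), !Sc.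
  - field.
  - exact (cts_derive _ _ is_derive_phi12).
  - exact (cts_derive _ _ is_derive_phi11).
Qed.

Lemma U2src_le (x : R) : Rabs (beta1c s l * V1 s l x ^ 2 * U0 x) <= 2 * Rabs bc * CV ^ 2.
Proof.
  rewrite !Rabs_mult, <- RPow_abs, (Rabs_pos_eq (U0 x)) by (left; apply U0_pos).
  pose proof (U0_le_2 x). pose proof (Rabs_pos bc). pose proof (V1_le x).
  assert (Rabs (v x) ^ 2 <= CV ^ 2) by (apply pow_incr; split; [apply Rabs_pos|easy]).
  replace (2 * Rabs bc * CV ^ 2) with (Rabs bc * CV ^ 2 * 2) by ring.
  apply Rmult_le_compat; try lra.
  - apply Rmult_le_pos; [easy|apply pow_le, Rabs_pos].
  - apply Rmult_le_compat_l; easy.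
Qed.

Lemma cts_U2src : cts (fun x => beta1c s l * V1 s l x ^ 2 * U0 x).
Proof. fold v. pose proof cts_U0. cts_tac. Qed.

(** Rescaled by a^2 and a, the sources agree up to O(h) with their values at delta = a = w = 0. This
    identifies (U - U0) / a^2 with [U2], and then the projection of the second equation on [V1] with
    delta J - a^2 b2bar / 2, up to O(h^2). *)
Lemma half_line_identity (C : R) : 0 <= C -> exists C', 0 <= C' /\
  forall delta U U' V V', profile s (bc + delta) beta2 U U' V V' -> U' 0 = 0 -> Rabs delta <= 1 ->
  (forall x, Rabs (U x - U0 x) <= 1) ->
  let a := amplitude V V' in let h := Rabs delta + a ^ 2 in
  a <> 0 -> a ^ 2 <= 1 -> (forall x, Rabs (U x - U0 x) <= C * a ^ 2) ->
  (forall x, Rabs (V x) <= C * Rabs a) -> (forall x, Rabs (V x - a * v x) <= C * h * Rabs a) ->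
  Rabs ((v 0 * V' 0 - V1' 0 * V 0) / a - delta * Jint s l + a ^ 2 * (b2bar s beta2 l / 2)) <= C' * h ^ 2.
Proof.
  intros PC.
  assert (PGU := green_const_pos fsys_U 0 ltac:(lra)).
  set (GU := green_const 1 6 (-1) 0) in *.
  set (KU := GU * (2 * Rabs bc * CV ^ 2)).
  assert (PKU : 0 <= KU).
  { unfold KU. pose proof (Rabs_pos bc). pose proof (pow2_ge_0 CV). apply Rmult_le_pos; [easy|].
    apply Rmult_le_pos; lra. }
  set (K := 3 + C + 2 * C + CV + KU). assert (PK : 0 <= K) by (unfold K; lra).
  destruct (tame_N2 bc K PK) as [LN [PLN HN]].
  destruct (tame_H2 bc beta2 K PK) as [LH [PLH HH]].
  (* [D1 * h] is the distance to the environment with delta, a^2 and w set to 0; [D2 * h] is that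
     distance once u is also replaced by [U2]. *)
  set (D1 := 1 + C). set (D2 := D1 + GU * (LN * D1)).
  assert (PD1 : 1 <= D1) by (unfold D1; lra).
  assert (PG1 : 0 <= GU * (LN * D1)) by (apply Rmult_le_pos; [easy|apply Rmult_le_pos; lra]).
  assert (PD2 : D1 <= D2) by (unfold D2; lra).
  exists (CV / mu * (4 * C + LH * D2)). split.
  { apply Rmult_le_pos; [apply Rdiv_le_0_compat; lra|]. assert (0 <= LH * D2) by (apply Rmult_le_pos; lra). lra. }
  intros delta U U' V V' P H0 Hd BU1 a h Ha Ha1 BU BV BW.
  destruct (profile_cts _ _ _ _ _ _ _ P) as [cU cV].
  assert (Pd := Rabs_pos delta). assert (Pa2 := pow2_ge_0 a).
  assert (Pa2' : 0 < a ^ 2) by (apply pow2_gt_0; easy).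
  assert (Paa : 0 < Rabs a) by now apply Rabs_pos_lt.
  assert (Ph : 0 <= h) by (unfold h; lra). assert (Ph2 : h <= 2) by (unfold h; lra).
  set (uh := fun x => (U x - U0 x) / a ^ 2). set (wh := fun x => V x / a - v x).
  assert (Buh : forall x, Rabs (uh x) <= C).
  { intros x. unfold uh, Rdiv. rewrite Rabs_mult, (Rabs_pos_eq (/ a ^ 2)) by (left; now apply Rinv_0_lt_compat).
    apply Rmult_le_reg_r with (a ^ 2); [easy|]. rewrite Rmult_assoc, Rinv_l by lra. specialize (BU x). lra. }
  assert (Bwh : forall x, Rabs (wh x) <= C * h).
  { intros x. unfold wh. replace (V x / a - v x) with ((V x - a * v x) * / a) by (field; easy).
    rewrite Rabs_mult, Rabs_inv. apply Rmult_le_reg_r with (Rabs a); [easy|].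
    rewrite Rmult_assoc, Rinv_l by lra. specialize (BW x). lra. }
  assert (EU : forall x, Usrc (bc + delta) U V x = a ^ 2 * N2poly bc (env delta (a ^ 2) (uh x) (wh x) (v x) (U0 x))).
  { intros x. unfold Usrc, N2poly, uh, wh; cbn [env]. field. easy. }
  assert (EV : forall x, Vsrc delta U V x =
     a * (delta * U0 x ^ 2 * (v x + wh x) + a ^ 2 * H2poly bc beta2 (env delta (a ^ 2) (uh x) (wh x) (v x) (U0 x)))).
  { intros x. unfold Vsrc, H2poly, uh, wh; cbn [env]. fold bc. field. easy. }
  assert (EnvB : forall x, bounded_env K 1 (env delta (a ^ 2) (uh x) (wh x) (v x) (U0 x))).
  { intros x. pose proof (Buh x). pose proof (Bwh x). pose proof (V1_le x). pose proof (U0_le_2 x).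
    assert (C * h <= C * 2) by (apply Rmult_le_compat_l; easy).
    apply bounded_env_intro; rewrite ?(Rabs_pos_eq (a ^ 2)), ?(Rabs_pos_eq (U0 x)) by lra; unfold K; lra. }
  assert (Ch : 0 <= C * h) by now apply Rmult_le_pos.
  assert (HND : forall x, Rabs (N2poly bc (env delta (a ^ 2) (uh x) (wh x) (v x) (U0 x)) - bc * v x ^ 2 * U0 x) <= LN * (D1 * h)).
  { intros x. destruct (HN 1 (D1 * h) (env delta (a ^ 2) (uh x) (wh x) (v x) (U0 x)) (env 0 0 (uh x) 0 (v x) (U0 x))) as [_ Y].
    - lra.
    - unfold D1. lra.
    - apply EnvB.
    - pose proof (Buh x). pose proof (V1_le x). pose proof (U0_le_2 x).
      apply bounded_env_intro; rewrite ?Rabs_R0, ?(Rabs_pos_eq (U0 x)) by lra; unfold K; lra.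
    - pose proof (Bwh x).
      apply near_env_intro; rewrite ?Rminus_diag, ?Rminus_0_r, ?Rabs_R0, ?(Rabs_pos_eq (a ^ 2)) by lra; unfold D1, h in *; lra.
    - cbn [wt] in Y. rewrite Rmult_1_r in Y.
      replace (N2poly bc (env 0 0 (uh x) 0 (v x) (U0 x))) with (bc * v x ^ 2 * U0 x) in Y by (unfold N2poly; cbn [env]; ring).
      lra. }
  assert (BU2 : forall x, 0 <= x -> Rabs (U2 s l x) <= KU).
  { intros x Hx. rewrite (U2_green s l V1' q q' CV w0 SV).
    apply (green_bound0 _ _ _ _ _ _ _ _ _ _ fsys_U cts_U2src); [|easy]. intros y _. apply U2src_le. }
  assert (HUD : forall x, 0 <= x -> Rabs (uh x - U2 s l x) <= GU * (LN * (D1 * h))).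
  { intros x Hx.
    assert (cU0 := cts_U0). assert (cS := cts_U2src). assert (cUs := cts_Usrc (bc + delta) U V cU cV).
    assert (BUs : forall y, Rabs (Usrc (bc + delta) U V y - a ^ 2 * (bc * v y ^ 2 * U0 y)) <= a ^ 2 * (LN * (D1 * h))).
    { intros y. rewrite EU, <- Rmult_minus_distr_l, Rabs_mult, (Rabs_pos_eq (a ^ 2)) by easy.
      apply Rmult_le_compat_l; [easy|apply HND]. }
    assert (BS : forall y, Rabs (a ^ 2 * (bc * v y ^ 2 * U0 y)) <= a ^ 2 * (2 * Rabs bc * CV ^ 2)).
    { intros y. rewrite Rabs_mult, (Rabs_pos_eq (a ^ 2)) by easy. apply Rmult_le_compat_l; [easy|apply U2src_le]. }
    assert (E0 : forall k, forall y, k * exp (- 0 * y) = k).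
    { intros k y. replace (- 0 * y) with 0 by ring. rewrite exp_0. ring. }
    assert (X : green phi12 phi11 (-1) (Usrc (bc + delta) U V) x - green phi12 phi11 (-1) (fun y => a ^ 2 * (bc * v y ^ 2 * U0 y)) x
      = green phi12 phi11 (-1) (fun y => Usrc (bc + delta) U V y - a ^ 2 * (bc * v y ^ 2 * U0 y)) x).
    { apply (green_minus fsys_U _ _ (a ^ 2 * (LN * (D1 * h)) + a ^ 2 * (2 * Rabs bc * CV ^ 2)) 0 (a ^ 2 * (2 * Rabs bc * CV ^ 2)) cUs).
      - unfold bc, v. cts_tac.
      - lra.
      - intros y _. rewrite E0. replace (Usrc (bc + delta) U V y) with
          ((Usrc (bc + delta) U V y - a ^ 2 * (bc * v y ^ 2 * U0 y)) + a ^ 2 * (bc * v y ^ 2 * U0 y)) by ring.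
        eapply Rle_trans; [apply Rabs_triang|]. specialize (BUs y). specialize (BS y). lra.
      - intros y _. rewrite E0. apply BS. }
    assert (Y : Rabs (green phi12 phi11 (-1) (fun y => Usrc (bc + delta) U V y - a ^ 2 * (bc * v y ^ 2 * U0 y)) x)
       <= GU * (a ^ 2 * (LN * (D1 * h)))).
    { apply (green_bound0 _ _ _ _ _ _ _ _ _ _ fsys_U); [|intros; apply BUs|easy]. unfold bc, v. cts_tac. }
    rewrite <- X in Y. rewrite <- (U_repr s (bc + delta) beta2 (C * Rabs a) U U' V V' P H0 BU1 BV x) in Y.
    rewrite (green_U_scal (a ^ 2) (fun y => bc * v y ^ 2 * U0 y) (2 * Rabs bc * CV ^ 2) x cS (fun y _ => U2src_le y)) in Y.
    change (green phi12 phi11 (-1) (fun y => bc * v y ^ 2 * U0 y) x)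
      with (green phi12 phi11 (-1) (fun y => beta1c s l * V1 s l y ^ 2 * U0 y) x) in Y.
    rewrite <- (U2_green s l V1' q q' CV w0 SV x) in Y.
    apply Rmult_le_reg_l with (a ^ 2); [easy|].
    rewrite <- (Rabs_pos_eq (a ^ 2)) at 1 by easy. rewrite <- Rabs_mult.
    replace (a ^ 2 * (uh x - U2 s l x)) with (U x - U0 x - a ^ 2 * U2 s l x) by (unfold uh; field; easy).
    lra. }
  set (H0f := fun x => 2 * beta1c s l * U0 x * U2 s l x * V1 s l x + beta2 * V1 s l x ^ 3).
  assert (HHD : forall x, 0 <= x -> Rabs (H2poly bc beta2 (env delta (a ^ 2) (uh x) (wh x) (v x) (U0 x)) - H0f x) <= LH * (D2 * h)).
  { intros x Hx. destruct (HH 1 (D2 * h) (env delta (a ^ 2) (uh x) (wh x) (v x) (U0 x)) (env 0 0 (U2 s l x) 0 (v x) (U0 x))) as [_ Y].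
    - lra.
    - apply Rmult_le_pos; lra.
    - apply EnvB.
    - pose proof (BU2 x Hx). pose proof (V1_le x). pose proof (U0_le_2 x).
      apply bounded_env_intro; rewrite ?Rabs_R0, ?(Rabs_pos_eq (U0 x)) by lra; unfold K; lra.
    - pose proof (Bwh x). pose proof (HUD x Hx).
      assert (Y1 : 0 <= GU * (LN * D1) * h) by (apply Rmult_le_pos; lra).
      assert (Y2 : 0 <= C * h) by easy.
      apply near_env_intro; rewrite ?Rminus_diag, ?Rminus_0_r, ?Rabs_R0, ?(Rabs_pos_eq (a ^ 2)) by lra;
        unfold D2, D1, h in *; lra.
    - cbn [wt] in Y. rewrite Rmult_1_r in Y.
      replace (H2poly bc beta2 (env 0 0 (U2 s l x) 0 (v x) (U0 x))) with (H0f x) in Y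
        by (unfold H2poly, H0f, bc, v; cbn [env]; ring).
      lra. }
  assert (cU2 : cts (U2 s l)).
  { apply (cts_ext (green phi12 phi11 (-1) (fun y => beta1c s l * V1 s l y ^ 2 * U0 y))).
    - intros y. symmetry. apply (U2_green s l V1' q q' CV w0 SV).
    - apply (cts_green fsys_U _ cts_U2src). }
  assert (cVs := cts_Vsrc delta U V cU cV). assert (cU0 := cts_U0).
  assert (cH0 : cts H0f) by (unfold H0f; fold v; cts_tac).
  (* What remains, delta U0^2 w and a^2 times the error of H, are products of two factors O(h). *)
  set (E := fun x => / a * Vsrc delta U V x - delta * (U0 x ^ 2 * v x) - a ^ 2 * H0f x).
  assert (cE : cts E) by (unfold E; cts_tac).
  assert (BE : forall x, 0 <= x -> Rabs (E x) <= (4 * C + LH * D2) * h ^ 2).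
  { intros x Hx. unfold E. rewrite EV.
    replace (_ - _ - _) with (delta * U0 x ^ 2 * wh x
      + a ^ 2 * (H2poly bc beta2 (env delta (a ^ 2) (uh x) (wh x) (v x) (U0 x)) - H0f x)) by (field; easy).
    eapply Rle_trans; [apply Rabs_triang|].
    rewrite !Rabs_mult, (Rabs_pos_eq (a ^ 2)), (Rabs_pos_eq (U0 x ^ 2)) by (easy || apply pow2_ge_0).
    pose proof (U0_le_2 x). assert (Z : 0 <= U0 x ^ 2 <= 4) by nra.
    assert (Rabs delta * U0 x ^ 2 * Rabs (wh x) <= h * 4 * (C * h)).
    { apply Rmult_le_compat; [apply Rmult_le_pos; lra|apply Rabs_pos|apply Rmult_le_compat; unfold h; lra|apply Bwh]. }
    assert (a ^ 2 * Rabs (H2poly bc beta2 (env delta (a ^ 2) (uh x) (wh x) (v x) (U0 x)) - H0f x) <= h * (LH * (D2 * h))).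
    { apply Rmult_le_compat; [easy|apply Rabs_pos|unfold h; lra|now apply HHD]. }
    lra. }
  assert (E0 : forall k, forall y, k * exp (- 0 * y) = k).
  { intros k y. replace (- 0 * y) with 0 by ring. rewrite exp_0. ring. }
  assert (B1 : Rabs (I0 (fun x => v x * E x)) <= CV / mu * ((4 * C + LH * D2) * h ^ 2)).
  { apply (I0_pg_bound SV E _ 0 cE ltac:(lra)). intros x Hx. rewrite E0. now apply BE. }
  assert (Cg : forall g M, cts g -> (forall x, 0 <= x -> Rabs (g x) <= M) -> conv (fun x => v x * g x)).
  { intros g M cg Bg. apply (conv_pg SV g M 0 cg ltac:(lra)). intros x Hx. rewrite E0. auto. }
  assert (BUUv : forall x, Rabs (U0 x ^ 2 * v x) <= 4 * CV).
  { intros x. pose proof (U0_le_2 x). assert (Z : 0 <= U0 x ^ 2 <= 4) by nra.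
    rewrite Rabs_mult, (Rabs_pos_eq (U0 x ^ 2)) by lra. apply Rmult_le_compat; try lra; [apply Rabs_pos|apply V1_le]. }
  assert (Cv1 : conv (fun x => v x * (U0 x ^ 2 * v x))) by (apply Cg with (4 * CV); [cts_tac|auto]).
  assert (Cv2 : conv (fun x => v x * Vsrc delta U V x)).
  { apply Cg with ((4 * Rabs delta + 5 * Rabs (bc + delta) * 1 + Rabs beta2 * (C * Rabs a) ^ 2) * (C * Rabs a)); [easy|].
    intros x _. apply V_equation; auto; [lra|apply U0_le_2]. }
  assert (Cv3 : conv (fun x => v x * H0f x)).
  { apply Cg with (2 * Rabs bc * 2 * KU * CV + Rabs beta2 * CV ^ 3); [easy|]. intros x Hx. unfold H0f.
    eapply Rle_trans; [apply Rabs_triang|]. rewrite !Rabs_mult, (Rabs_pos_eq 2), <- RPow_abs by lra.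
    pose proof (Rabs_pos bc). pose proof (V1_le x). pose proof (BU2 x Hx). pose proof (U0_le_2 x).
    pose proof (Rabs_pos (v x)). pose proof (Rabs_pos (U2 s l x)). pose proof (Rabs_pos beta2).
    rewrite (Rabs_pos_eq (U0 x)) by lra.
    apply Rplus_le_compat.
    - fold bc v.
      assert (S0 : 0 <= 2 * Rabs bc * U0 x) by (apply Rmult_le_pos; lra).
      assert (S1 : 2 * Rabs bc * U0 x <= 2 * Rabs bc * 2) by (apply Rmult_le_compat_l; lra).
      assert (S2 : 2 * Rabs bc * U0 x * Rabs (U2 s l x) <= 2 * Rabs bc * 2 * KU) by (apply Rmult_le_compat; lra).
      apply Rmult_le_compat; [apply Rmult_le_pos; lra|lra|lra|lra].
    - apply Rmult_le_compat_l; [easy|]. apply pow_incr. fold v. lra. }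
  assert (IE : I0 (fun x => v x * E x) = / a * I0 (fun x => v x * Vsrc delta U V x) - delta * Jint s l - a ^ 2 * I0 (fun x => v x * H0f x)).
  { destruct (conv_lin (/ a) (- delta) _ _ Cv2 Cv1) as [Ca Ea].
    destruct (conv_lin 1 (- a ^ 2) _ _ Ca Cv3) as [Cb Eb].
    rewrite (I0_ext _ (fun x => 1 * (/ a * (v x * Vsrc delta U V x) + - delta * (v x * (U0 x ^ 2 * v x))) + - a ^ 2 * (v x * H0f x)))
      by (intros x; unfold E; ring).
    rewrite Eb, Ea. change (I0 (fun x => v x * (U0 x ^ 2 * v x))) with (Jint s l). ring. }
  rewrite (proj2 (V_repr delta (C * Rabs a) U U' V V' P BU1 BV)) in IE.
  assert (HB2 : b2bar s beta2 l = - 2 * I0 (fun x => v x * H0f x))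
    by exact (b2bar_half s beta2 l V1' q q' CV w0 SV Pv).
  replace ((v 0 * V' 0 - V1' 0 * V 0) / a - delta * Jint s l + a ^ 2 * (b2bar s beta2 l / 2))
    with (I0 (fun x => v x * E x)).
  - lra.
  - rewrite IE, HB2. field. easy.
Qed.

Lemma no_pair_wrong_side (hb : b2bar s beta2 l <> 0) : exists d eta, 0 < d /\ 0 < eta /\
  forall delta, Rabs delta < d -> delta * b2bar s beta2 l < 0 ->
  no_pair_near s (beta1c s l + delta) beta2 eta.
Proof.
  destruct V_estimate as [C [eta [PC [Peta HV]]]].
  destruct (half_line_identity C PC) as [C' [PC' HI]].
  assert (JP := J_pos s l V1' q q' CV w0 hs SV Pv).
  destruct (V1_nonzero s l hs) as [xs Hxs]. fold v in Hxs. apply Rabs_pos_lt in Hxs.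
  (* On the wrong side delta J and -a^2 b2bar / 2 have the same sign, so their sum is at least c h
     in modulus; r is such that C' h^2 < c h for 0 < h <= r. *)
  set (Bb := Rabs (b2bar s beta2 l) / 2).
  assert (PBb : 0 < Bb) by (unfold Bb; apply Rabs_pos_lt in hb; lra).
  set (c := Rmin (Jint s l) Bb).
  assert (Pc : 0 < c) by (apply Rmin_glb_lt; easy).
  assert (c1 : c <= Jint s l) by apply Rmin_l. assert (c2 : c <= Bb) by apply Rmin_r.
  set (r := c / (C' + 1)).
  assert (Pr : 0 < r) by (apply Rdiv_lt_0_compat; lra).
  assert (Er : C' * r < c).
  { assert (E : r * (C' + 1) = c) by (unfold r; field; lra). lra. }
  set (r1 := Rmin 1 (r / 2)).
  assert (Pr1 : 0 < r1) by (apply Rmin_glb_lt; lra).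
  assert (r11 : r1 <= 1) by apply Rmin_l. assert (r12 : r1 <= r / 2) by apply Rmin_r.
  assert (Pvr : 0 < Rabs (v xs) * r1) by (apply Rmult_lt_0_compat; lra).
  (* At a point where [V1] is nonzero, |a| |V1(xs)| <= 2 e forces |a| <= r1, so a^2 <= r / 2;
     together with |delta| < r / 2 this gives h <= r. *)
  set (e := Rmin eta (Rabs (v xs) * r1 / 2)).
  assert (Pe : 0 < e) by (apply Rmin_glb_lt; lra).
  assert (e1 : e <= eta) by apply Rmin_l. assert (e2 : e <= Rabs (v xs) * r1 / 2) by apply Rmin_r.
  destruct (center e Pe) as [eta' [Pe' HC]].
  exists (Rmin eta (r / 2)), eta'. split; [apply Rmin_glb_lt; lra|]. split; [easy|].
  intros delta Hd Hsgn U V HN [HP [_ [x0 Hx0]]].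
  assert (d1 := Rmin_l eta (r / 2)). assert (d2 := Rmin_r eta (r / 2)).
  destruct (HC U V HN) as [z [Hz HNz]]; [intros x; apply HP|].
  assert (P0 : profile s (bc + delta) beta2 U (Derive U) V (Derive V)) by (apply homoclinic_ode, HP).
  assert (P := profile_shift _ _ _ z _ _ _ _ P0).
  set (Uz := fun x => U (x + z)) in *. set (Uz' := fun x => Derive U (x + z)) in *.
  set (Vz := fun x => V (x + z)) in *. set (Vz' := fun x => Derive V (x + z)) in *.
  assert (HUz : Uz' 0 = 0) by (unfold Uz'; rewrite Rplus_0_l; exact Hz).
  assert (BU : forall x, Rabs (Uz x - U0 x) <= eta) by (intros x; apply Rle_trans with e; [apply (HNz x)|easy]).
  assert (BV : forall x, Rabs (Vz x) <= e) by (intros x; apply (HNz x)).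
  assert (BV' : forall x, Rabs (Vz x) <= eta) by (intros x; specialize (BV x); lra).
  assert (NZ : exists x, Vz x <> 0).
  { exists (x0 - z). unfold Vz. replace (x0 - z + z) with x0 by ring. exact Hx0. }
  destruct (HV delta Uz Uz' Vz Vz' P HUz ltac:(lra) BU BV' NZ) as [Ha [X1 [X2 [X3 X4]]]].
  set (a := amplitude Vz Vz') in *.
  assert (Paa : 0 < Rabs a) by now apply Rabs_pos_lt.
  assert (Har : Rabs a <= r1).
  { specialize (X4 e BV xs). specialize (BV xs).
    assert (Y : Rabs a * Rabs (v xs) <= 2 * e).
    { rewrite <- Rabs_mult. replace (a * v xs) with (Vz xs - (Vz xs - a * v xs)) by ring.
      eapply Rle_trans; [apply Rabs_triang|]. rewrite Rabs_Ropp. lra. }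
    apply Rmult_le_reg_r with (Rabs (v xs)); [easy|]. lra. }
  assert (Ha2 : a ^ 2 <= r1).
  { rewrite <- pow2_abs. replace r1 with (r1 * 1) by ring. simpl.
    rewrite Rmult_1_r. apply Rmult_le_compat; lra. }
  assert (Pa2 : 0 < a ^ 2) by now apply pow2_gt_0.
  assert (BU1 : forall x, Rabs (Uz x - U0 x) <= 1) by (intros x; specialize (BU x); lra).
  assert (Y1 := HI delta Uz Uz' Vz Vz' P HUz ltac:(lra) BU1 Ha (Rle_trans _ _ _ Ha2 r11) X1 X2 X3).
  assert (Y2 := HI delta _ _ _ _ (profile_reflect _ _ _ sg _ _ _ _ sg2 P)).
  cbv zeta in Y2. rewrite amplitude_reflect in Y2. fold a in Y1, Y2.
  assert (Asg := abs_sign sg sg2).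
  specialize (Y2 ltac:(cbv beta; rewrite Ropp_0, HUz; ring) ltac:(lra)
    ltac:(intros y; cbv beta; rewrite Rmult_1_l, <- (U0_even y); apply BU1) Ha (Rle_trans _ _ _ Ha2 r11)
    ltac:(intros y; cbv beta; rewrite Rmult_1_l, <- (U0_even y); apply X1)
    ltac:(intros y; cbv beta; rewrite Rabs_mult, Asg, Rmult_1_l; apply X2)).
  cbv beta in Y2. rewrite boundary_reflect in Y2.
  assert (Y3 : forall x, Rabs (sg * Vz (- x) - a * v x) <= C * (Rabs delta + a ^ 2) * Rabs a).
  { intros x. replace (v x) with (sg * v (- x)) by (rewrite Pv; transitivity ((sg * sg) * v x); [ring|rewrite sg2; ring]).
    replace (sg * Vz (- x) - a * (sg * v (- x))) with (sg * (Vz (- x) - a * v (- x))) by ring.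
    rewrite Rabs_mult, Asg, Rmult_1_l. apply X3. }
  specialize (Y2 Y3).
  set (h := Rabs delta + a ^ 2) in *.
  assert (Pdl := Rabs_pos delta).
  assert (Ph : 0 < h) by (unfold h; lra). assert (Hhr : h <= r) by (unfold h; lra).
  (* Adding the identities of the solution and of its reflection cancels the boundary terms. *)
  assert (Y4 : Rabs (delta * Jint s l - a ^ 2 * (b2bar s beta2 l / 2)) <= C' * h ^ 2).
  { replace (- (v 0 * Vz' 0 - V1' 0 * Vz 0) / a) with (- ((v 0 * Vz' 0 - V1' 0 * Vz 0) / a)) in Y2 by (field; easy).
    apply Rabs_le_between in Y1, Y2. apply Rabs_le. lra. }
  assert (Y5 : c * h <= Rabs (delta * Jint s l - a ^ 2 * (b2bar s beta2 l / 2))).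
  { assert (Q1 : c * Rabs delta <= Jint s l * Rabs delta) by (apply Rmult_le_compat_r; lra).
    assert (Q2 : c * a ^ 2 <= Bb * a ^ 2) by (apply Rmult_le_compat_r; lra).
    unfold h. destruct (Rlt_dec 0 delta) as [Pdel|Pdel].
    - assert (b2bar s beta2 l < 0) by nra. unfold Bb in Q2.
      rewrite (Rabs_pos_eq delta) in * by lra. rewrite (Rabs_left (b2bar s beta2 l)) in Q2 by easy.
      eapply Rle_trans; [|apply Rle_abs]. lra.
    - assert (0 < b2bar s beta2 l) by nra. unfold Bb in Q2.
      rewrite (Rabs_left1 delta) in * by lra. rewrite (Rabs_pos_eq (b2bar s beta2 l)) in Q2 by lra.
      rewrite <- Rabs_Ropp. eapply Rle_trans; [|apply Rle_abs]. lra. }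
  assert (Y6 : C' * h ^ 2 <= C' * r * h).
  { replace (C' * h ^ 2) with (C' * h * h) by ring. apply Rmult_le_compat_r; [lra|]. apply Rmult_le_compat_l; lra. }
  assert (C' * r * h < c * h) by (apply Rmult_lt_compat_r; lra).
  lra.
Qed.

End Nonexistence.

(** * The pitchfork *)

(** Nearest-point projection onto [0, t0], extending a function Lipschitz on this interval to the
    whole line. *)
Definition clip (t0 t : R) : R := Rmax 0 (Rmin t t0).

Lemma clip_range (t0 t : R) : 0 <= t0 -> 0 <= clip t0 t <= t0.
Proof. intros H. unfold clip, Rmax, Rmin. repeat destruct Rle_dec; lra. Qed.

Lemma clip_id (t0 t : R) : 0 <= t <= t0 -> clip t0 t = t.
Proof. intros H. unfold clip, Rmax, Rmin. repeat destruct Rle_dec; lra. Qed.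

Lemma clip_lipschitz (t0 t t' : R) : Rabs (clip t0 t - clip t0 t') <= Rabs (t - t').
Proof.
  unfold clip, Rmax, Rmin, Rabs. repeat destruct Rle_dec; repeat destruct Rcase_abs; lra.
Qed.

Lemma cts_lipschitz (f : R -> R) (L : R) : 0 <= L ->
  (forall x y, Rabs (f x - f y) <= L * Rabs (x - y)) -> cts f.
Proof.
  intros HL H x P [[e He] HP].
  exists (mkposreal (e / (L + 1)) ltac:(apply Rdiv_lt_0_compat; lra)).
  intros y Hy. apply HP. change (Rabs (f y - f x) < e).
  change (Rabs (y - x) < e / (L + 1)) in Hy.
  apply Rle_lt_trans with (1 := H y x).
  assert (E : e / (L + 1) * (L + 1) = e) by (field; lra).
  pose proof (Rabs_pos (y - x)). nra.
Qed.

Theorem theorem7p1 (s beta2 : R) (l : nat) (hs : 0 < s)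
    (hb : b2bar s beta2 l <> 0) :
  exists (e0 : R) (b : R -> R) (U V : R -> R -> R),
    0 < e0 /\
    (forall beta1, solitary_wave s beta1 beta2 U0 (fun _ => 0)) /\
    pitchfork s beta2 (beta1c s l) e0 b U V /\
    (0 < b2bar s beta2 l -> supercritical s beta2 (beta1c s l) e0 b) /\
    (b2bar s beta2 l < 0 -> subcritical s beta2 (beta1c s l) e0 b) /\
    (forall e, 0 < e < e0 ->
       solitary_wave s (b e) beta2 (U e) (V e) /\
       solitary_wave s (b e) beta2 (U e) (fun x => - V e x)) /\
    exists K : R, forall e, 0 < e < e0 ->
      Rabs (b e - beta1c s l) <= K * e ^ 2 /\
      forall x,
        Rabs (U e x - (U0 x + e ^ 2 * U2 s l x)) <= K * e ^ 4 /\
        Rabs (V e x - e * V1 s l x) <= K * e ^ 3.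
Proof.
  destruct (fsys_V s l hs) as [V1' [q [q' [CV [w0 [SV [Pv Pq]]]]]]].
  destruct (fixed_points s beta2 l V1' q q' CV w0 hs SV Pv Pq)
    as [t0 [K [L [X [Ht0 [PK [PL [HX HB]]]]]]]].
  destruct (no_pair_wrong_side s beta2 l V1' q q' CV w0 hs SV Pv Pq hb) as [dn [etan [Pdn [Petan HN]]]].
  assert (JP := J_pos s l V1' q q' CV w0 hs SV Pv).
  assert (EB := leading_b s beta2 l V1' q q' CV w0 hs SV Pv).
  assert (EU := leading_u s beta2 l V1' q q' CV w0 SV).
  assert (Eow := fs_C SV).
  set (bc := beta1c s l) in *. set (lead := leading s beta2 l q w0) in *.
  set (B0 := bo lead) in *.
  assert (HB0 : B0 <> 0) by (intros E; apply hb; rewrite EB, E; ring).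
  destruct (V1_nonzero s l hs) as [xs Hxs]. apply Rabs_pos_lt in Hxs. apply Rabs_pos_lt in HB0.
  (* e0 makes e^2 admissible and the corrections smaller than the leading terms *)
  set (c1 := Rabs (V1 s l xs) / (K + 1)). set (c2 := Rabs B0 / (L + 1)).
  assert (Pc1 : 0 < c1) by (apply Rdiv_lt_0_compat; lra).
  assert (Pc2 : 0 < c2) by (apply Rdiv_lt_0_compat; lra).
  assert (Ec1 : c1 * (K + 1) = Rabs (V1 s l xs)) by (unfold c1; field; lra).
  assert (Ec2 : c2 * (L + 1) = Rabs B0) by (unfold c2; field; lra).
  set (e0 := Rmin t0 (Rmin c1 c2)).
  assert (Pe0 : 0 < e0) by (unfold e0; repeat apply Rmin_glb_lt; lra).
  assert (e0t : e0 <= t0) by apply Rmin_l.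
  assert (e01 : e0 <= c1) by (unfold e0; eapply Rle_trans; [apply Rmin_r|apply Rmin_l]).
  assert (e02 : e0 <= c2) by (unfold e0; eapply Rle_trans; [apply Rmin_r|apply Rmin_r]).
  set (b := fun e => bc + e ^ 2 * bo (X (e ^ 2))).
  set (U := fun e x => U0 x + e ^ 2 * uo (X (e ^ 2)) x).
  set (V := fun e x => e * (V1 s l x + e ^ 2 * wo (X (e ^ 2)) x)).
  assert (Sq : forall e, 0 < e < e0 -> 0 < e ^ 2 <= e).
  { intros e He. split; [apply pow_lt; lra|]. nra. }
  assert (Adm : forall e, 0 < e < e0 -> 0 <= e ^ 2 <= t0) by (intros e He; specialize (Sq e He); lra).
  assert (Bo : forall e, 0 < e < e0 -> Rabs (bo (X (e ^ 2)) - B0) <= L * e ^ 2).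
  { intros e He. destruct (HX _ (Adm e He)) as [_ [_ D]]. specialize (D None). simpl om in D.
    rewrite Rmult_1_r in D. exact D. }
  assert (Bk : forall e, 0 < e < e0 -> Rabs (bo (X (e ^ 2))) <= K).
  { intros e He. destruct (HX _ (Adm e He)) as [[_ [_ [_ [_ D]]]] _]. specialize (D None). simpl om in D.
    rewrite Rmult_1_r in D. exact D. }
  assert (rho1 : forall x, 0 < rho (kap s) x <= 1).
  { intros x. apply rho_bounds. left. apply (kap_bounds s hs). }
  assert (Uk : forall e x, 0 < e < e0 -> Rabs (uo (X (e ^ 2)) x) <= K).
  { intros e x He. destruct (HX _ (Adm e He)) as [[_ [_ [_ [_ D]]]] _]. specialize (D (Some (true, x))). simpl om in D.
    specialize (rho1 x). unfold uo. nra. }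
  assert (Wk : forall e x, 0 < e < e0 -> Rabs (wo (X (e ^ 2)) x) <= K).
  { intros e x He. destruct (HX _ (Adm e He)) as [[_ [_ [_ [_ D]]]] _]. specialize (D (Some (false, x))). simpl om in D.
    specialize (rho1 x). unfold wo. nra. }
  assert (U2k : forall e x, 0 < e < e0 -> Rabs (uo (X (e ^ 2)) x - U2 s l x) <= L * e ^ 2).
  { intros e x He. destruct (HX _ (Adm e He)) as [_ [_ D]]. specialize (D (Some (true, x))). simpl om in D.
    specialize (rho1 x). rewrite <- EU. unfold uo.
    assert (0 <= L * e ^ 2) by (apply Rmult_le_pos; [easy|apply pow2_ge_0]). fold lead. nra. }
  assert (Hom : forall e, 0 < e < e0 -> homoclinic s (b e) beta2 (U e) (V e)).
  { intros e He. destruct (HX _ (Adm e He)) as [RX [FX _]].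
    apply (fixed_point_homoclinic s beta2 l V1' q q' CV w0 hs SV Pv (e ^ 2) K e (X (e ^ 2)) (proj1 (Adm e He)) eq_refl RX FX). }
  assert (Best : forall e, 0 < e < e0 -> Rabs (b e - bc) <= K * e ^ 2).
  { intros e He. unfold b. replace (bc + e ^ 2 * bo (X (e ^ 2)) - bc) with (bo (X (e ^ 2)) * e ^ 2) by ring.
    rewrite Rabs_mult, (Rabs_pos_eq (e ^ 2)) by apply pow2_ge_0.
    apply Rmult_le_compat_r; [apply pow2_ge_0|auto]. }
  assert (Vest : forall e x, 0 < e < e0 -> Rabs (V e x - e * V1 s l x) <= K * e ^ 3).
  { intros e x He. unfold V. replace (_ - _) with (wo (X (e ^ 2)) x * e ^ 3) by ring.
    assert (P3 : 0 <= e ^ 3) by (apply pow_le; lra).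
    rewrite Rabs_mult, (Rabs_pos_eq (e ^ 3)) by easy. apply Rmult_le_compat_r; auto. }
  assert (Uest : forall e x, 0 < e < e0 -> Rabs (U e x - U0 x) <= K * e ^ 2).
  { intros e x He. unfold U. replace (_ - _) with (uo (X (e ^ 2)) x * e ^ 2) by ring.
    rewrite Rabs_mult, (Rabs_pos_eq (e ^ 2)) by apply pow2_ge_0.
    apply Rmult_le_compat_r; [apply pow2_ge_0|auto]. }
  (* Otherwise e |V1(xs)| <= K e^3, which e^2 <= e <= c1 excludes. *)
  assert (NZ : forall e, 0 < e < e0 -> V e xs <> 0).
  { intros e He E. assert (H := Vest e xs He). rewrite E, Rminus_0_l, Rabs_Ropp, Rabs_mult, (Rabs_pos_eq e) in H by lra.
    destruct (Sq e He) as [S1 S2].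
    assert (H' : Rabs (V1 s l xs) <= K * e ^ 2).
    { apply Rmult_le_reg_l with e; [lra|]. replace (e * (K * e ^ 2)) with (K * e ^ 3) by ring. exact H. }
    assert (K * e ^ 2 <= K * e) by (apply Rmult_le_compat_l; lra).
    assert (K * e <= K * c1) by (apply Rmult_le_compat_l; lra). lra. }
  (* Here (b e - bc) / e^2 lies within L e^2 < |B0| of B0, hence has its sign. *)
  assert (Sgn : forall e, 0 < e < e0 -> 0 < (b e - bc) * B0).
  { intros e He. destruct (Sq e He) as [S1 S2]. unfold b.
    replace ((bc + e ^ 2 * bo (X (e ^ 2)) - bc) * B0) with (e ^ 2 * (bo (X (e ^ 2)) * B0)) by ring.
    apply Rmult_lt_0_compat; [easy|]. assert (H := Bo e He).
    assert (L * e ^ 2 < Rabs B0).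
    { assert (L * e ^ 2 <= L * c2) by (apply Rmult_le_compat_l; lra). lra. }
    apply Rabs_le_between in H. unfold Rabs in H0. destruct (Rcase_abs B0); nra. }
  (* [IVT_gen] asks for continuity on the whole line, whereas the Lipschitz bound holds on [0, t0]
     only; on the branch [h e] is b e - bc. *)
  set (h := fun e => e ^ 2 * bo (X (clip t0 (e ^ 2)))).
  assert (Ch : cts h).
  { unfold h. apply cts_mult; [apply (cts_pow (fun e => e)); intros x; apply continuous_id|].
    intros x. apply (continuous_comp (fun e => e ^ 2) (fun t => bo (X (clip t0 t)))).
    - apply (cts_pow (fun e => e)). intros y; apply continuous_id.
    - apply (cts_lipschitz (fun t => bo (X (clip t0 t))) L PL). intros y z.
      eapply Rle_trans; [apply HB; apply clip_range; lra|].
      apply Rmult_le_compat_l; [easy|apply clip_lipschitz]. }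
  set (e1 := e0 / 2). assert (He1 : 0 < e1 < e0) by (unfold e1; lra).
  assert (Hh : forall e, 0 < e < e0 -> b e = bc + h e).
  { intros e He. unfold b, h. rewrite clip_id by auto. reflexivity. }
  (* Such y - bc lies between h 0 = 0 and h e1; the parameter found is not 0 because y differs from
     bc. *)
  assert (Cover : forall y, 0 < (y - bc) * B0 -> Rabs (y - bc) < Rabs (h e1) -> exists e, 0 < e < e0 /\ b e = y).
  { intros y Hy1 Hy2. assert (H1 := Sgn e1 He1). rewrite (Hh e1 He1) in H1.
    assert (h0 : h 0 = 0) by (unfold h; ring).
    assert (Rng : Rmin (h 0) (h e1) <= y - bc <= Rmax (h 0) (h e1)).
    { rewrite h0. unfold Rmin, Rmax. unfold Rabs in Hy2.
      repeat destruct Rcase_abs in Hy2; destruct Rle_dec; nra. }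
    destruct (IVT_gen h 0 e1 (y - bc)) as [e [He E]]; [|exact Rng|].
    - intros x. apply continuity_pt_filterlim. apply Ch.
    - rewrite Rmin_left, Rmax_right in He by lra.
      assert (e <> 0) by (intros ->; rewrite h0 in E; rewrite <- E in Hy1; lra).
      exists e. assert (He' : 0 < e < e0) by (unfold e1 in *; lra). split; [easy|]. rewrite (Hh e He'). lra. }
  assert (Ph : 0 < Rabs (h e1)).
  { apply Rabs_pos_lt. intros E. assert (H1 := Sgn e1 He1). rewrite (Hh e1 He1), E in H1. lra. }
  exists e0, b, U, V. split; [easy|split; [|split; [|split; [|split; [|split]]]]].
  - intros beta1. apply homoclinic_solitary, homoclinic_U0.
  - split; [|split].
    + intros; apply homoclinic_U0.
    + intros e He. split; [auto|split; [apply homoclinic_opp; auto|exists xs; auto]].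
    + intros eta Heta. set (Q := K + Rabs (CV) + 1). assert (PQ : 0 < Q) by (unfold Q; pose proof (Rabs_pos CV); lra).
      exists (eta / (2 * Q)). split; [apply Rdiv_lt_0_compat; lra|]. intros e He Hed.
      destruct (Sq e He) as [S1 S2].
      assert (Eq : eta / (2 * Q) * (2 * Q) = eta) by (field; lra).
      assert (Qe : Q * (2 * e) < eta) by nra.
      assert (Ke : K * e ^ 2 <= K * e) by (apply Rmult_le_compat_l; lra).
      assert (Ke0 : 0 <= K * e) by (apply Rmult_le_pos; lra).
      assert (Ce0 : 0 <= CV * e) by (apply Rmult_le_pos; lra).
      assert (QE : K * e + CV * e <= eta) by (unfold Q in Qe; rewrite (Rabs_pos_eq CV) in Qe by easy; lra).
      split; [specialize (Best e He); lra|]. intros x. split; [specialize (Uest e x He); lra|].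
      replace (V e x) with ((V e x - e * V1 s l x) + e * V1 s l x) by ring.
      eapply Rle_trans; [apply Rabs_triang|]. rewrite Rabs_mult, (Rabs_pos_eq e) by lra.
      assert (HV := V1_rho s l V1' q q' CV w0 hs SV Pv x). specialize (rho1 x).
      assert (Rabs (V1 s l x) <= CV) by nra.
      assert (e * Rabs (V1 s l x) <= e * CV) by (apply Rmult_le_compat_l; lra).
      assert (K * e ^ 3 <= K * e).
      { apply Rmult_le_compat_l; [easy|]. replace (e ^ 3) with (e * e ^ 2) by ring. nra. }
      specialize (Vest e x He). lra.
  - intros Hp. assert (Bp : 0 < B0) by nra. split.
    + intros e He. specialize (Sgn e He). nra.
    + exists (Rmin dn (Rabs (h e1))), etan.
      assert (m1 := Rmin_l dn (Rabs (h e1))). assert (m2 := Rmin_r dn (Rabs (h e1))).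
      split; [apply Rmin_glb_lt; easy|]. split; [easy|]. split.
      * intros y Hy. apply Cover; [apply Rmult_lt_0_compat; lra|]. rewrite Rabs_pos_eq by lra. lra.
      * intros y Hy. replace y with (bc + (y - bc)) by ring. apply HN.
        -- rewrite Rabs_left by lra. lra.
        -- nra.
  - intros Hp. assert (Bp : B0 < 0) by nra. split.
    + intros e He. specialize (Sgn e He). nra.
    + exists (Rmin dn (Rabs (h e1))), etan.
      assert (m1 := Rmin_l dn (Rabs (h e1))). assert (m2 := Rmin_r dn (Rabs (h e1))).
      split; [apply Rmin_glb_lt; easy|]. split; [easy|]. split.
      * intros y Hy. apply Cover; [nra|]. rewrite Rabs_left by lra. lra.
      * intros y Hy. replace y with (bc + (y - bc)) by ring. apply HN.
        -- rewrite Rabs_pos_eq by lra. lra.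
        -- nra.
  - intros e He. split; apply homoclinic_solitary; [auto|apply homoclinic_opp; auto].
  - exists (K + L). intros e He. destruct (Sq e He) as [S1 S2].
    assert (L2 : 0 <= L * e ^ 2) by (apply Rmult_le_pos; lra).
    split; [specialize (Best e He); lra|]. intros x. split.
    + unfold U. replace (_ - _) with (e ^ 2 * (uo (X (e ^ 2)) x - U2 s l x)) by ring.
      rewrite Rabs_mult, (Rabs_pos_eq (e ^ 2)) by lra.
      assert (H := U2k e x He).
      assert (e ^ 2 * Rabs (uo (X (e ^ 2)) x - U2 s l x) <= e ^ 2 * (L * e ^ 2)) by (apply Rmult_le_compat_l; lra).
      assert (0 <= K * e ^ 4) by (apply Rmult_le_pos; [easy|apply pow_le; lra]). lra.
    + specialize (Vest e x He). assert (0 <= L * e ^ 3) by (apply Rmult_le_pos; [easy|apply pow_le; lra]). lra.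
Qed.
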